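(* Let $0<\varepsilon<\frac{1}{54}$ be fixed. For $x>1$ define $$W=W(x)=\sum_{\substack{1\le m_1<\sqrt{x}\\ 1\le m_2<\sqrt{x}}}\ \sum_{\substack{1\le q_1<\sqrt{x}+m_1\\ 1\le q_2<\sqrt{x}+m_2}}\ \#\Big\{(k_1,k_2)\in\mathbb{Z}_{>0}^2:\ |k_1-q_1|<2m_1,\ |k_2-q_2|<2m_2,\ m_1^2+k_1q_1=m_2^2+k_2q_2\le x\Big\},$$ where $m_1,m_2,q_1,q_2$ run over integers. Then, as $x\to+\infty$, $$W=c_0x^2+O\big(x^{2-1/54+\varepsilon}\big),\qquad c_0=\frac{13\,\zeta(2)}{14\,\zeta(3)}\,\mathfrak{S},$$ where $$\mathfrak{S}=\int_0^1du_1\int_0^1du_2\int_0^{1+u_1}dv_1\int_0^{1+u_2}\varphi(u_1,u_2,v_1,v_2)\,dv_2,$$ $$\varphi(u_1,u_2,v_1,v_2)=\frac{1}{v_1v_2}\max\Big(0,\ \min\big(1,(u_1+v_1)^2,(u_2+v_2)^2\big)-\max\big(u_1^2,u_2^2,(u_1-v_1)^2,(u_2-v_2)^2\big)\Big),$$ and the implied constant depends only on $\varepsilon$.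
   Context: $\zeta$ denotes the Riemann zeta function. The sum $W$ equals $\sum_{d\le x}g(d)^2$, where $g(d)$ is the number of pairs of integers $m,q\ge1$ with $m<\sqrt d$, $|q-\sqrt d|<m$, $q\mid d-m^2$ (writing $d=m^2+kq$ with $k\ge1$). *)

(* Defs.v *)
From mathcomp Require Import all_boot all_order all_algebra.
From mathcomp Require Import all_classical all_reals all_analysis.
Set Implicit Arguments. Unset Strict Implicit. Unset Printing Implicit Defensive.
Import Order.TTheory GRing.Theory Num.Theory.
Local Open Scope ring_scope.
Local Open Scope classical_set_scope.

(* Riemann zeta at an integer s >= 2: sum_{n>=1} n^(-s), as the limit of partial sums
   (computed in the extended reals, where it exists since terms are >= 0). *)
Definition zeta (R : realType) (s : nat) : R :=
  fine (\sum_(0 <= n <oo) (((n.+1)%:R : R) ^- s)%:E)%E.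

(* The counting function W(x).  All variables m_i, q_i, k_i are positive
   integers with m_i^2 + k_i q_i <= x, hence each is <= floor x; so summing
   over 0 .. floor x with the stated conditions as filters is exhaustive. *)
Definition W (R : realType) (x : R) : nat :=
  let T := (Num.truncn x).+1 in
  \sum_(m1 < T) \sum_(m2 < T) \sum_(q1 < T) \sum_(q2 < T)
  \sum_(k1 < T) \sum_(k2 < T)
   [&& (0 < m1)%N, (0 < m2)%N, (m1%:R < Num.sqrt x)%R, (m2%:R < Num.sqrt x)%R,
       (0 < q1)%N, (0 < q2)%N,
       (q1%:R < Num.sqrt x + m1%:R)%R, (q2%:R < Num.sqrt x + m2%:R)%R,
       (0 < k1)%N, (0 < k2)%N,
       (`|(k1%:Z - q1%:Z)%R| < (2 * m1)%:Z)%R,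
       (`|(k2%:Z - q2%:Z)%R| < (2 * m2)%:Z)%R,
       (m1 ^ 2 + k1 * q1 == m2 ^ 2 + k2 * q2)%N &
       ((m1 ^ 2 + k1 * q1)%N%:R <= x)%R].

(* The weight phi(u1,u2,v1,v2); for v1 v2 = 0 (a null set) the MathComp
   convention 0^-1 = 0 applies. *)
Definition phi (R : realType) (u1 u2 v1 v2 : R) : R :=
  (v1 * v2)^-1 *
  Num.max 0
    (Num.min 1 (Num.min ((u1 + v1) ^+ 2) ((u2 + v2) ^+ 2))
     - Num.max (Num.max (u1 ^+ 2) (u2 ^+ 2))
               (Num.max ((u1 - v1) ^+ 2) ((u2 - v2) ^+ 2))).

Definition frakS (R : realType) : R :=
  fine (\int[@lebesgue_measure R]_(u1 in `[0%R, 1%R])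
        \int[@lebesgue_measure R]_(u2 in `[0%R, 1%R])
        \int[@lebesgue_measure R]_(v1 in `[0%R, (1 + u1)%R])
        \int[@lebesgue_measure R]_(v2 in `[0%R, (1 + u2)%R])
          (phi u1 u2 v1 v2)%:E)%E.

Definition c0 (R : realType) : R :=
  13 * zeta R 2 / (14 * zeta R 3) * frakS R.

(* Main.v *)
(** Put m2 = e - m1 and d = m1^2 + k1 q1.  For fixed (e, q1, q2) the condition
    q2 | d - m2^2 becomes the linear congruence 2 e m1 + q1 k1 = e^2 (mod q2).
    Cutting the (m1, k1)-region into short boxes and expanding the congruence in additive
    characters, the frequencies h with q2 | 2 e h and q2 | q1 h give density
    rho / q2, where rho = g [g | e^2] and g = gcd(2e, q1, q2); the other
    frequencies contribute geometric sums that are small on average over (e, q1, q2).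
    Hence W is, up to O(x^(7/4 + o(1))), the sum over d <= x of
    sum rho(m1 + m2, q1, q2) / (q1 q2) over the admissible (m1, q1), (m2, q2).
    Writing rho as a signed divisor sum of phi(w), the inner sum splits into products of
    sums over residue classes modulo w, each being 2 sqrt(d) ln 2 / w^2 + O(log / w);
    this gives 2 (ln 2)^2 x^2 times the sum of phi(w) kappa(w) / w^3, kappa(w) being 1, 0, 2
    for w odd, 2 mod 4, 0 mod 4.  The series is 13 zeta(2) / (14 zeta(3)), and slicing
    frakS along the variable t = d / x yields frakS = 2 (ln 2)^2. *)

Require Import Defs.
From mathcomp Require Import all_boot all_order all_algebra cyclic.
From mathcomp Require Import all_classical all_reals all_analysis.
From mathcomp Require Import measurable_realfun ring lra zify.
Set Implicit Arguments.
Unset Strict Implicit.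
Unset Printing Implicit Defensive.
Import Order.TTheory GRing.Theory Num.Theory.
Import numFieldNormedType.Exports.
Local Open Scope ring_scope.

(** * Exponential sums *)

(** The range of [k1] depends on [m1], so the congruence is not counted over a rectangle. Along [H]
    consecutive values of [m1] its end points move by [O(n H / q1 + 1)], with [n] about [sqrt x].
    They are frozen at the first value; what changes lies in two windows that are again rectangles,
    so the same estimate controls it. The error for a rectangle depends neither on its position nor
    on the residue [e^2], which permits averaging over [(e, q1, q2)]: each block costs [n^3 log^3]
    for the frequencies and [n^2 H^2 log^3] for the windows, and there are about [n / H] blocks. The
    choice [H = sqrt n] balances the two and gives [n^(7/2) = x^(7/4)] up to logarithms.

    The characters are real cosines throughout, and all constants are explicit.

    The profile [max(0, min(1, 2 s / q - 1))] occurs twice: summed over [q] with [s = sqrt d] in the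
    count, and integrated over [v] with [s = sqrt t] in the singular integral. This is why both
    carry the factor [(ln 2)^2]. *)

Lemma sin_mul_cos (R : realType) (y z : R) :
  2 * (sin y * cos z) = sin (z + y) - sin (z - y).
Proof. rewrite sinD sinB; ring. Qed.

(** Multiplication by [2 sin y] makes the terms telescope. This is the geometric sum in real form,
    valid also when [sin y = 0]. *)
Lemma cos_sum_telescope (R : realType) (A B : nat) (y g : R) : (A <= B)%N ->
  2 * (sin y * \sum_(A <= k < B) cos (2 * y * k%:R + g)) =
  sin (2 * y * B%:R - y + g) - sin (2 * y * A%:R - y + g).
Proof.
move=> AB; rewrite !mulr_sumr.
under eq_bigr => k _ do
  rewrite sin_mul_cos.
rewrite -(telescope_sumr (fun k => sin (2 * y * k%:R - y + g)) AB).
apply: eq_bigr => k _; rewrite -[k.+1%:R]natr1.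
by congr (sin _ - sin _); ring.
Qed.

Lemma sum_nat_empty (V : nmodType) (A B : nat) (F : nat -> V) :
  (B <= A)%N -> \sum_(A <= i < B) F i = 0.
Proof. by move=> BA; rewrite big_geq. Qed.

Lemma norm_cos_sum (R : realType) (A B : nat) (y g : R) :
  `|sin y| * `|\sum_(A <= k < B) cos (2 * y * k%:R + g)| <= 1.
Proof.
case: (leqP A B) => [AB|/ltnW BA]; last first.
  by rewrite sum_nat_empty // normr0 mulr0.
have := cos_sum_telescope y g AB; set S := \sum_(_ <= _ < _) _ => E.
rewrite -normrM -(ler_pM2l (ltr0n R 2)) mulr1 -[X in X * _ <= _]ger0_norm//.
rewrite -normrM E (le_trans (ler_normB _ _))//.
have := sin_max (2 * y * B%:R - y + g).
have := sin_max (2 * y * A%:R - y + g).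
lra.
Qed.

(** Summing over [k] leaves a difference of two sines, linear in [m]; a shift of the phase by
    [pi / 2] turns them back into cosines, so the one-variable bound applies to the sum over [m]. *)
Lemma norm_cos_sum2 (R : realType) (A B C D : nat) (x y g : R) :
  `|sin x| * `|sin y| *
  `|\sum_(A <= m < B) \sum_(C <= k < D)
      cos (2 * x * m%:R + 2 * y * k%:R + g)| <= 1.
Proof.
case: (leqP C D) => [CD|/ltnW DC]; last first.
  by rewrite big1 ?normr0 ?mulr0// => m _; rewrite sum_nat_empty.
set S := \sum_(_ <= _ < _) _.
have E : 2 * (sin y * S) =
    \sum_(A <= m < B) cos (2 * x * m%:R + (2 * y * D%:R - y + g - pi / 2)) -
    \sum_(A <= m < B) cos (2 * x * m%:R + (2 * y * C%:R - y + g - pi / 2)).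
  rewrite /S !mulr_sumr -sumrB; apply: eq_bigr => m _.
  rewrite !addrA !cosBpihalf.
  have E := cos_sum_telescope y (2 * x * m%:R + g) CD.
  rewrite (_ : sin (_ + _ - y + g) = sin (2 * y * D%:R - y + (2 * x * m%:R + g))).
    rewrite (_ : sin (_ + _ - y + g) = sin (2 * y * C%:R - y + (2 * x * m%:R + g))).
      rewrite -E; congr (2 * (_ * _)); apply: eq_bigr => k _; congr cos; ring.
    congr sin; ring.
  congr sin; ring.
have := norm_cos_sum A B x (2 * y * D%:R - y + g - pi / 2).
have := norm_cos_sum A B x (2 * y * C%:R - y + g - pi / 2).
set U := \sum_(_ <= _ < _) _; set V := \sum_(_ <= _ < _) _ => hU hV.
rewrite -mulrA -(normrM (sin y)) -(ler_pM2l (ltr0n R 2)) mulr1 mulrCA.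
rewrite -[X in _ * (X * _) <= _]ger0_norm// -normrM E.
apply: le_trans (_ : `|sin x| * `|V| + `|sin x| * `|U| <= _).
  by rewrite -mulrDr ler_wpM2l// ler_normB.
lra.
Qed.

Lemma cosDpin (R : realType) (z : R) (n : nat) : cos (z + 2 * pi * n%:R) = cos z.
Proof.
rewrite -[RHS](periodicn (@cosD2pi R) n); congr cos.
by rewrite -mulr_natr -[pi *+ 2]mulr_natr; ring.
Qed.

Lemma norm_sinDpin (R : realType) (z : R) (n : nat) :
  `|sin (z + pi * n%:R)| = `|sin z|.
Proof.
rewrite (_ : pi * n%:R = pi *+ n); last by rewrite mulr_natr.
by rewrite (alternatingn (@sinDpi R)) normrM normrX normrN1 expr1n mul1r.
Qed.

Lemma norm_sin_modn (R : realType) (q r : nat) : (0 < q)%N ->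
  `|sin (pi * r%:R / q%:R : R)| = `|sin (pi * (r %% q)%:R / q%:R : R)|.
Proof.
move=> q0; rewrite {1}(divn_eq r q) natrD natrM addrC mulrDr mulrDl.
rewrite (_ : pi * (_ * q%:R) / _ = pi * (r %/ q)%:R) ?norm_sinDpin//.
by field; rewrite pnatr_eq0 -lt0n.
Qed.

(** Write [sin y = 2 cos(y/2) sin(y/2)] and [sin(y/2) = cos(c) y/2] by the mean value theorem. Both
    cosines are at least [cos(pi/4)], whose square is [1/2]. *)
Lemma sin_ge_half (R : realType) (y : R) : 0 <= y <= pi / 2 -> y / 2 <= sin y.
Proof.
move=> /andP[y0 yp]; have p0 := pi_gt0 R.
have pi4 : 0 < cos (pi / 4 : R) by apply: cos_gt0_pihalf; lra.
have cpi4 : cos (pi / 4 : R) ^+ 2 = 1 / 2.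
  have := cos_mulr2n (pi / 4 : R).
  rewrite (_ : pi / 4 *+ 2 = pi / 2) ?cos_pihalf; last by rewrite -mulr_natr; field.
  rewrite -[_ *+ 2]mulr_natr; lra.
have [->|yn0] := eqVneq y 0; first by rewrite sin0 mul0r.
have yh : 0 < y / 2 by rewrite divr_gt0// lt_def yn0.
have [c /[!in_itv]/= /andP[c0 cy]] : exists2 c : R, c \in `]0, (y / 2)[ &
    sin (y / 2) - sin 0 = cos c * (y / 2 - 0).
  apply: MVT yh _ _.
  exact/continuous_subspaceT/continuous_sin.
rewrite sin0 !subr0 => E.
have kc : cos (pi / 4 : R) <= cos c.
  by apply: ltW; rewrite ltr_cos ?in_itv/=; lra.
have ky : cos (pi / 4 : R) <= cos (y / 2).
  have : y / 2 <= pi / 4 by lra.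
  rewrite le_eqVlt => /orP[/eqP->//|h].
  by apply: ltW; rewrite ltr_cos ?in_itv/=; lra.
have -> : sin y = 2 * (cos (y / 2) * sin (y / 2)).
  rewrite -{1}[y](_ : y / 2 *+ 2 = _); last by rewrite -mulr_natr; field.
  by rewrite sin_mulr2n -mulr_natr mulrC.
rewrite E.
have : cos (pi / 4) ^+ 2 <= cos (y / 2) * cos c.
  by rewrite expr2 ler_pM// ltW.
rewrite cpi4; set u := cos (y / 2) * cos c => hu.
rewrite (_ : 2 * _ = u * y); last by rewrite /u; field.
nra.
Qed.

Lemma sin_angle_gt0 (R : realType) (q r : nat) : (0 < r < q)%N ->
  0 < sin (pi * r%:R / q%:R : R).
Proof.
move=> /andP[r0 rq]; have q0 : (0 < q)%N by apply: leq_trans rq.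
apply: sin_gt0_pi; rewrite divr_gt0 ?mulr_gt0 ?ltr0n ?pi_gt0//=.
by rewrite ltr_pdivrMr ?ltr0n// ltr_pM2l ?pi_gt0// ltr_nat.
Qed.

Lemma inv_sin_angle_le_half (R : realType) (q r : nat) : (0 < r)%N -> (2 * r <= q)%N ->
  (sin (pi * r%:R / q%:R : R))^-1 <= q%:R / r%:R.
Proof.
move=> r0 rq.
have q0 : 0 < q%:R :> R by rewrite ltr0n; lia.
have r0' : 0 < r%:R :> R by rewrite ltr0n.
have rq' : 2 * r%:R <= q%:R :> R by rewrite -natrM ler_nat.
have p2 := pi_ge2 R.
have h : r%:R / q%:R <= sin (pi * r%:R / q%:R : R).
  apply: le_trans (_ : pi * r%:R / q%:R / 2 <= _).
    have ht : 0 <= r%:R / q%:R :> R by rewrite divr_ge0.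
    rewrite -(mulrA pi); set t := r%:R / q%:R in ht *; nra.
  apply: sin_ge_half; rewrite divr_ge0 ?mulr_ge0 ?pi_ge0 ?ler0n//=.
  rewrite ler_pdivrMr// mulrAC; nra.
rewrite -[leRHS]invrK invf_div lef_pV2// posrE ?divr_gt0//.
by apply: lt_le_trans h; rewrite divr_gt0.
Qed.

(** One of the two terms suffices, according to the half of [(0, q)] that contains [r]. Keeping both
    replaces the distance to the nearest multiple of [q] by an expression that is summed over [r] at
    once. *)
Lemma inv_sin_angle_le (R : realType) (q r : nat) : (0 < r < q)%N ->
  `|sin (pi * r%:R / q%:R : R)|^-1 <= q%:R / r%:R + q%:R / (q - r)%:R.
Proof.
move=> rq; rewrite gtr0_norm ?sin_angle_gt0//.
have /andP[r0 rq'] := rq.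
case: (leqP (2 * r) q) => h.
  rewrite (le_trans (inv_sin_angle_le_half _ r0 h))// lerDl divr_ge0//.
have -> : sin (pi * r%:R / q%:R : R) = sin (pi * (q - r)%:R / q%:R).
  rewrite natrB 1?ltnW// -[LHS]opprK -sinN -sinDpi; congr sin.
  by field; rewrite pnatr_eq0; lia.
rewrite (le_trans (inv_sin_angle_le_half _ _ _)) ?lerDr ?divr_ge0//; lia.
Qed.

(** Harmonic numbers stand for logarithms in every error bound; [harm_le_ln] converts them only at
    the end. *)
Definition harm (R : realType) (n : nat) : R := \sum_(j < n) j.+1%:R^-1.

Lemma harm_le (R : realType) (m n : nat) : (m <= n)%N -> harm R m <= harm R n.
Proof.
move=> mn; rewrite /harm -!(big_mkord xpredT (fun j => j.+1%:R^-1 : R)).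
by rewrite (big_cat_nat (leq0n m) mn)//= lerDl sumr_ge0// => i _; rewrite invr_ge0.
Qed.

Lemma harm_ge0 (R : realType) (n : nat) : 0 <= harm R n.
Proof. by rewrite sumr_ge0// => i _; rewrite invr_ge0. Qed.

Lemma harm_ge1 (R : realType) (n : nat) : (0 < n)%N -> 1 <= harm R n.
Proof.
by move=> /(harm_le R); apply: le_trans; rewrite /harm big_ord1 invr1.
Qed.

(** * Averages of inverse sines, divisibility and gcds *)

Lemma sum_periodic (V : nmodType) (f : nat -> V) (w K : nat) :
  (forall a, f (w + a)%N = f a) ->
  \sum_(i < K * w) f i = (\sum_(i < w) f i) *+ K.
Proof.
move=> fw; elim: K => [|K IH]; first by rewrite mul0n big_ord0.
rewrite mulSn big_split_ord/= mulrS -IH; congr (_ + _).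
by apply: eq_bigr => i _; rewrite fw.
Qed.

Lemma sum_coprime_reindex (V : nmodType) (F : nat -> V) (u w : nat) :
  (0 < w)%N -> coprime w u ->
  \sum_(i < w) F ((i * u) %% w)%N = \sum_(i < w) F i.
Proof.
case: w => // w _ cop.
pose f (i : 'I_w.+1) : 'I_w.+1 := inord ((i * u) %% w.+1).
have fE i : f i = ((i * u) %% w.+1)%N :> nat by rewrite inordK ?ltn_pmod.
rewrite [RHS](reindex_inj (h := f)) => [|i j /(congr1 val)/=].
  by apply: eq_bigr => i _; rewrite fE.
rewrite !fE => /eqP; wlog ij : i j / (i <= j)%N.
  by move=> wl E; case: (leqP i j) => [|/ltnW] h; [|apply/esym]; apply: wl;
    rewrite // eq_sym.
rewrite eq_sym eqn_mod_dvd ?leq_mul2r ?ij ?orbT// -mulnBl Gauss_dvdl// => d.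
apply/val_inj/eqP; rewrite eqn_leq ij/= leqNgt; apply/negP => ij'.
have := dvdn_leq _ d; rewrite subn_gt0 ij' => /(_ isT).
by have := ltn_ord j; lia.
Qed.

(** Completing the range to full periods only increases a nonnegative sum, and multiplication by the
    unit [u] permutes each period. *)
Lemma sum_mul_le_period (R : realType) (F : nat -> R) (u w Y : nat) :
  (forall r, 0 <= F r) -> (forall r, F (r %% w)%N = F r) ->
  (0 < w)%N -> coprime w u ->
  \sum_(a < Y) F (a * u)%N <= (Y %/ w).+1%:R * \sum_(i < w) F i.
Proof.
move=> F0 Fw w0 cop.
have YK : (Y <= (Y %/ w).+1 * w)%N by rewrite ltnW// -ltn_divLR.
apply: le_trans (_ : \sum_(a < (Y %/ w).+1 * w) F (a * u)%N <= _).
  rewrite -!(big_mkord xpredT (fun a => F (a * u)%N)) (big_cat_nat (leq0n Y) YK)//=.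
  by rewrite lerDl sumr_ge0.
rewrite (sum_periodic (f := fun a => F (a * u)%N)).
  rewrite -[leLHS]mulr_natl ler_wpM2l// -(sum_coprime_reindex F w0 cop).
  by rewrite le_eqVlt; apply/orP; left; apply/eqP/eq_bigr => i _; rewrite Fw.
by move=> a; rewrite -Fw mulnDl (mulnC w) modnMDl Fw.
Qed.

(** Bound for a geometric sum with phase increment [2 pi r / q]. It is set to [0] at multiples of
    [q], where the trivial bound is used instead; see [geobound]. *)
Definition invsin (R : realType) (q r : nat) : R :=
  if (q %| r)%N then 0 else `|sin (pi * r%:R / q%:R)|^-1.

Lemma invsin_ge0 (R : realType) (q r : nat) : 0 <= invsin R q r.
Proof. by rewrite /invsin; case: ifP => // _; rewrite invr_ge0. Qed.

Lemma invsin_modn (R : realType) (q r : nat) : (0 < q)%N ->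
  invsin R q (r %% q) = invsin R q r.
Proof. by move=> q0; rewrite /invsin /dvdn modn_mod norm_sin_modn// modn_mod -norm_sin_modn. Qed.

Lemma invsin_scale (R : realType) (g q r : nat) : (0 < g)%N ->
  invsin R (g * q) (g * r) = invsin R q r.
Proof.
move=> g0; rewrite /invsin dvdn_pmul2l//; case: ifP => // _; congr (`|sin _|^-1).
by rewrite !natrM mulrCA -mulf_div divff ?mul1r// pnatr_eq0 -lt0n.
Qed.

Lemma sum_invsin_period (R : realType) (w : nat) : (0 < w)%N ->
  \sum_(i < w) invsin R w i <= 2 * w%:R * harm R w.
Proof.
case: w => // v _; rewrite big_ord_recl/= {1}/invsin dvdn0 add0r.
apply: le_trans (_ : 2 * v.+1%:R * harm R v <= _); last first.
  by rewrite ler_wpM2l ?harm_le.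
apply: le_trans (_ : \sum_(i < v) (v.+1%:R / i.+1%:R + v.+1%:R / (v - i)%:R) <= _).
  apply: ler_sum => i _; rewrite /invsin /bump/= add1n ifF; last first.
    by apply/negbTE/negP => /dvdn_leq/=; have := ltn_ord i; lia.
  by rewrite (le_trans (inv_sin_angle_le _ _)) ?subSS//; have := ltn_ord i; lia.
rewrite big_split/= -!mulr_sumr [X in _ + _ * X](reindex_inj rev_ord_inj)/=.
have -> : \sum_(j < v) (v - (v - j.+1))%:R^-1 = harm R v.
  by apply: eq_bigr => j _; rewrite subKn.
by rewrite -/(harm R v); lra.
Qed.

Lemma mul_period_le (Y w : nat) : (0 < w)%N -> (w <= Y)%N ->
  ((Y %/ w).+1 * w <= 2 * Y)%N.
Proof. by move=> w0 wY; have := leq_divM Y w; lia. Qed.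

(** Dividing [q] and [h] by their gcd reduces to a unit [u] modulo [w]. Since [w <= q <= Y], the
    number of periods needed is at most [2 Y / w]. *)
Lemma sum_invsin_le (R : realType) (q h Y : nat) : (0 < q)%N -> (q <= Y)%N ->
  \sum_(a < Y) invsin R q (a * h) <= 4 * Y%:R * harm R Y.
Proof.
move=> q0 qY; set g := gcdn q h.
have g0 : (0 < g)%N by rewrite gcdn_gt0 q0.
have [w qE] : exists w, q = (g * w)%N.
  by exists (q %/ g)%N; rewrite mulnC divnK// dvdn_gcdl.
have [u hE] : exists u, h = (g * u)%N.
  by exists (h %/ g)%N; rewrite mulnC divnK// dvdn_gcdr.
have w0 : (0 < w)%N by move: q0; rewrite qE muln_gt0 => /andP[].
have cop : coprime w u.
  by rewrite /coprime -(eqn_pmul2l g0) muln1 muln_gcdr -qE -hE.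
have wq : (w <= q)%N by rewrite qE leq_pmull.
have wY := leq_trans wq qY.
rewrite qE hE.
under eq_bigr => a _ do rewrite mulnCA invsin_scale//.
apply: le_trans (sum_mul_le_period Y _ _ w0 cop) _.
- by move=> r; exact: invsin_ge0.
- by move=> r; exact: invsin_modn.
apply: le_trans (ler_wpM2l (ler0n _ _) (sum_invsin_period R w0)) _.
rewrite mulrA; apply: ler_pM; rewrite ?mulr_ge0 ?harm_ge0 ?harm_le//.
by rewrite -!natrM ler_nat; have := mul_period_le w0 wY; lia.
Qed.

Lemma sum_dvdn_le (R : realType) (q h Y : nat) : (0 < q)%N -> (q <= Y)%N ->
  \sum_(a < Y) (q %| a * h)%:R <= 2 * Y%:R * (gcdn q h)%:R / q%:R :> R.
Proof.
move=> q0 qY; set g := gcdn q h.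
have g0 : (0 < g)%N by rewrite gcdn_gt0 q0.
have [w qE] : exists w, q = (g * w)%N.
  by exists (q %/ g)%N; rewrite mulnC divnK// dvdn_gcdl.
have [u hE] : exists u, h = (g * u)%N.
  by exists (h %/ g)%N; rewrite mulnC divnK// dvdn_gcdr.
have w0 : (0 < w)%N by move: q0; rewrite qE muln_gt0 => /andP[].
have cop : coprime w u.
  by rewrite /coprime -(eqn_pmul2l g0) muln1 muln_gcdr -qE -hE.
have wq : (w <= q)%N by rewrite qE leq_pmull.
have wY := leq_trans wq qY.
rewrite {1}qE {1}hE.
under eq_bigr => a _ do rewrite mulnCA dvdn_pmul2l//.
apply: le_trans (sum_mul_le_period (F := fun r => (w %| r)%N%:R : R) Y _ _ w0 cop) _.
- by move=> r; exact: ler0n.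
- by move=> r; rewrite /dvdn modn_mod.
rewrite (_ : \sum_(i < w) _ = 1); last first.
  case: (w) w0 => // v _; rewrite big_ord_recl big1 ?addr0 ?dvdn0// => i _.
  by rewrite gtnNdvd//; have := ltn_ord i; rewrite /= /bump; lia.
rewrite mulr1 ler_pdivlMr ?ltr0n// qE natrM mulrCA mulrC ler_wpM2r//.
by rewrite -!natrM ler_nat mul_period_le.
Qed.

Lemma sum_multiples (R : pzSemiRingType) (F : nat -> R) (g w : nat) : (0 < w)%N ->
  \sum_(h < g * w) (w %| h)%:R * F h = \sum_(j < g) F (j * w)%N.
Proof.
move=> w0; elim: g => [|g IH]; first by rewrite mul0n !big_ord0.
rewrite mulSnr big_split_ord/= IH big_ord_recr/=; congr (_ + _).
case: (w) w0 => // v _; rewrite big_ord_recl/= addn0 dvdn_mull// mul1r.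
rewrite big1 ?addr0// => i _; rewrite dvdn_addr ?dvdn_mull// gtnNdvd ?mul0r//.
by rewrite /bump/=; have := ltn_ord i; lia.
Qed.

Lemma sum_inv_le_harm (R : realType) (n : nat) : \sum_(j < n) j%:R^-1 <= harm R n.
Proof.
case: n => [|n]; first by rewrite big_ord0 harm_ge0.
by rewrite big_ord_recl/= invr0 add0r harm_le.
Qed.

Lemma sum_inv_multiples_le (R : realType) (g Y : nat) :
  \sum_(q < Y) (g %| q)%:R * q%:R^-1 <= g%:R^-1 * harm R Y.
Proof.
case: (posnP g) => [->|g0].
  rewrite invr0 mul0r big1// => q _; rewrite dvd0n; case: eqP => [->|_]/=.
    by rewrite invr0 mulr0.
  by rewrite mul0r.
have YY : (Y <= Y * g)%N by rewrite leq_pmulr.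
apply: le_trans (_ : \sum_(q < Y * g) (g %| q)%:R * q%:R^-1 <= _).
  rewrite -!(big_mkord xpredT (fun q => (g %| q)%:R * q%:R^-1 : R)).
  rewrite (big_cat_nat (leq0n Y) YY)//= lerDl sumr_ge0//.
rewrite (sum_multiples (fun q => q%:R^-1))//.
under eq_bigr => j _ do rewrite natrM invfM mulrC.
by rewrite -mulr_sumr ler_wpM2l ?invr_ge0// sum_inv_le_harm.
Qed.

(** The gcd is at most the sum of all common divisors [g]. Each [g] dividing [q] divides [q / g] of
    the [h < q], hence contributes [q]; so the inner sum is at most the number of divisors of [q]
    over [q], and that average splits into two harmonic sums. *)
Lemma sum_gcdn_le (R : realType) (Y : nat) :
  \sum_(q < Y) \sum_(h < q) (gcdn q h)%:R / q%:R ^+ 2 <= harm R Y ^+ 2.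
Proof.
apply: le_trans (_ : \sum_(q < Y) \sum_(g < Y) (g %| q)%:R * q%:R^-1 <= _).
  apply: ler_sum => q _; case: (posnP q) => [->|q0].
    by rewrite big_ord0 sumr_ge0.
  rewrite -mulr_suml -mulr_suml expr2 invfM mulrA ler_wpM2r ?invr_ge0//.
  rewrite ler_pdivrMr ?ltr0n//.
  apply: le_trans (_ : \sum_(h < q) \sum_(g < Y) (g %| q)%:R * ((g %| h)%:R * g%:R) <= _).
    apply: ler_sum => h _.
    have gY : (gcdn q h < Y)%N.
      by apply: leq_ltn_trans (ltn_ord q); rewrite dvdn_leq// dvdn_gcdl.
    rewrite (bigD1 (Ordinal gY))//= dvdn_gcdl dvdn_gcdr !mul1r lerDl sumr_ge0//.
  rewrite exchange_big/= mulr_suml; apply: ler_sum => g _.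
  rewrite -mulr_sumr; case: (boolP (g %| q)%N) => [gq|_]; last by rewrite !mul0r.
  have g0 : (0 < g)%N by apply: dvdn_gt0 gq.
  rewrite mul1r -(big_mkord xpredT (fun i => (g %| i)%:R * g%:R)).
  rewrite -{1}(divnK gq) big_mkord (sum_multiples (fun=> g%:R))//.
  by rewrite sumr_const card_ord mul1r -[leLHS]mulr_natr -natrM (mulnC g) divnK.
rewrite exchange_big/= expr2.
apply: le_trans (_ : \sum_(g < Y) g%:R^-1 * harm R Y <= _).
  by apply: ler_sum => g _; apply: sum_inv_multiples_le.
by rewrite -mulr_suml ler_wpM2r ?harm_ge0// sum_inv_le_harm.
Qed.

(* Bounds a geometric sum of length at most [H] with phase increment [2 pi r / q]. *)
Definition geobound (R : realType) (H q r : nat) : R :=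
  (q %| r)%:R * H%:R + invsin R q r.

Lemma geobound_ge0 (R : realType) (H q r : nat) : 0 <= geobound R H q r.
Proof. by rewrite addr_ge0 ?invsin_ge0// mulr_ge0. Qed.

Lemma norm_sin_gt0 (R : realType) (q r : nat) : (0 < q)%N -> ~~ (q %| r)%N ->
  0 < `|sin (pi * r%:R / q%:R : R)|.
Proof.
move=> q0 nd; rewrite norm_sin_modn// normr_gt0 gt_eqF// sin_angle_gt0//.
by rewrite lt0n ltn_pmod// andbT.
Qed.

Lemma norm_box_cos_sum (R : realType) (A B C D H L q u v : nat) (g : R) :
  (0 < q)%N -> (B - A <= H)%N -> (D - C <= L)%N ->
  `|\sum_(A <= m < B) \sum_(C <= k < D)
     cos (2 * (pi * u%:R / q%:R) * m%:R + 2 * (pi * v%:R / q%:R) * k%:R + g)|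
  <= geobound R H q u * geobound R L q v.
Proof.
move=> q0 BH DL; rewrite /geobound /invsin.
have const (a b : nat) (c : R) : \sum_(a <= i < b) c = (b - a)%:R * c.
  by rewrite sumr_const_nat mulr_natl.
(* In a direction whose frequency is divisible by [q] the sum is bounded by its length, in the other
   by the inverse sine. *)
case: (boolP (q %| u)%N) => qu; case: (boolP (q %| v)%N) => qv;
  rewrite /= !(mul1r, mul0r, addr0, add0r).
- apply: le_trans (ler_norm_sum _ _ _) _.
  apply: le_trans (_ : \sum_(A <= m < B) L%:R <= _).
    apply: ler_sum => m _; apply: le_trans (ler_norm_sum _ _ _) _.
    apply: le_trans (_ : \sum_(C <= k < D) 1 <= _).
      by apply: ler_sum => k _; exact: cos_max.
    by rewrite const mulr1 ler_nat.
  by rewrite const ler_wpM2r// ler_nat.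
- apply: le_trans (ler_norm_sum _ _ _) _.
  set s := `|sin _|.
  apply: le_trans (_ : \sum_(A <= m < B) s^-1 <= _).
    apply: ler_sum => m _.
    have := norm_cos_sum C D (pi * v%:R / q%:R) (2 * (pi * u%:R / q%:R) * m%:R + g).
    rewrite -ler_pdivlMl ?norm_sin_gt0// mulr1; congr (`|_| <= _).
    by apply: eq_bigr => k _; congr cos; ring.
  by rewrite const ler_wpM2r ?invr_ge0 ?normr_ge0// ler_nat.
- rewrite exchange_big/= mulrC; apply: le_trans (ler_norm_sum _ _ _) _.
  set s := `|sin _|.
  apply: le_trans (_ : \sum_(C <= k < D) s^-1 <= _).
    apply: ler_sum => k _.
    have := norm_cos_sum A B (pi * u%:R / q%:R) (2 * (pi * v%:R / q%:R) * k%:R + g).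
    rewrite -ler_pdivlMl ?norm_sin_gt0// mulr1; congr (`|_| <= _).
    by apply: eq_bigr => m _; congr cos; ring.
  by rewrite const mulrC ler_wpM2l ?invr_ge0 ?normr_ge0// ler_nat.
- have := norm_cos_sum2 A B C D (pi * u%:R / q%:R) (pi * v%:R / q%:R) g.
  by rewrite -ler_pdivlMl ?mulr_gt0 ?norm_sin_gt0// mulr1 invfM.
Qed.

(** * Completion of a linear congruence modulo [q] *)

Lemma sum_cos_orthogonal (R : realType) (q a b : nat) : (0 < q)%N ->
  \sum_(h < q) cos (2 * (pi * (a%:R - b%:R) / q%:R) * h%:R) =
  (a == b %[mod q])%:R * q%:R :> R.
Proof.
move=> q0; wlog ba : a b / (b <= a)%N.
  move=> wl; case: (leqP b a) => [/wl//|/ltnW ab].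
  rewrite eq_sym -wl//; apply: eq_bigr => h _; rewrite -cosN; congr cos; ring.
have qn0 : q%:R != 0 :> R by rewrite pnatr_eq0 -lt0n.
rewrite -natrB// eqn_mod_dvd//; set n := (a - b)%N.
case: (boolP (q %| n)%N) => [/dvdnP[t ->]|nd].
  rewrite mul1r -[q in RHS]card_ord -sumr_const; apply: eq_bigr => h _.
  rewrite -[RHS]cos0 -(cosDpin 0 (t * h)); congr cos.
  by rewrite !natrM; field.
have s0 := norm_sin_gt0 R q0 nd.
set y := pi * n%:R / q%:R in s0 *.
have := cos_sum_telescope y 0 (leq0n q); rewrite big_mkord.
under eq_bigr => h _ do rewrite addr0.
rewrite mulr0 !addr0 sub0r.
(* The two end phases differ by [n] full turns, so the telescoped difference vanishes, while [sin y]
   does not. *)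
rewrite (_ : 2 * y * q%:R - y = - y + pi *+ 2 *+ n); last first.
  by rewrite -[_ *+ n]mulr_natr -[_ *+ 2]mulr_natr /y; field.
rewrite (periodicn (@sinD2pi R)) subrr => /eqP.
by rewrite !mulf_eq0 pnatr_eq0/= -normr_eq0 gt_eqF//= mul0r => /eqP.
Qed.

(** Contribution of the frequencies [h] not killed by both coefficients, for the congruence
    [u m + v k = c (mod q)] in a box of sides at most [H] and [L]. Neither [c] nor the position of
    the box enters. *)
Definition boxerr (R : realType) (H L q u v : nat) : R :=
  q%:R^-1 * \sum_(h < q) (~~ ((q %| u * h)%N && (q %| v * h)%N))%:R *
    (geobound R H q (u * h) * geobound R L q (v * h)).

Lemma boxerr_ge0 (R : realType) (H L q u v : nat) : 0 <= boxerr R H L q u v.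
Proof.
rewrite mulr_ge0 ?invr_ge0 ?ler0n// sumr_ge0// => h _.
by rewrite !mulr_ge0 ?geobound_ge0 ?ler0n.
Qed.

(** [rho u v q c / q] is the density of the solutions of [u m + v k = c (mod q)]: there are [g q]
    pairs modulo [q] if [g] divides [c], and none otherwise. *)
Definition rho (u v q c : nat) : nat :=
  let g := gcdn (gcdn u v) q in if (g %| c)%N then g else 0%N.

(** The principal frequencies are the multiples of [w = q / g]. Writing [h = j w] leaves the
    orthogonality relation modulo [g], which tests whether [g] divides [c]. *)
Lemma sum_cos_principal (R : realType) (q u v c : nat) : (0 < q)%N ->
  \sum_(h < q) ((q %| u * h)%N && (q %| v * h)%N)%:R *
     cos (2 * (pi * c%:R / q%:R) * h%:R : R) =
  (rho u v q c)%:R.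
Proof.
move=> q0; rewrite /rho; set g := gcdn _ _.
have g0 : (0 < g)%N by rewrite gcdn_gt0 q0 orbT.
pose w := (q %/ g)%N.
have qE : q = (g * w)%N by rewrite /w mulnC divnK// dvdn_gcdr.
have w0 : (0 < w)%N by move: q0; rewrite qE muln_gt0 => /andP[].
have E h : (q %| u * h)%N && (q %| v * h)%N = (w %| h)%N.
  rewrite -dvdn_gcd -muln_gcdl -[RHS](dvdn_pmul2l g0) -qE.
  by rewrite /g [in RHS]muln_gcdl [in RHS]dvdn_gcd [(q %| q * h)%N]dvdn_mulr ?andbT.
under eq_bigr => h _ do rewrite E.
rewrite -(big_mkord xpredT (fun h => (w %| h)%:R *
     cos (2 * (pi * c%:R / q%:R) * h%:R : R))) [in X in \sum_(_ <= _ < X) _]qE big_mkord.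
rewrite (sum_multiples (fun h => cos (2 * (pi * c%:R / q%:R) * h%:R)))//.
transitivity (\sum_(j < g) cos (2 * (pi * (c%:R - 0%:R) / g%:R) * j%:R : R)).
  apply: eq_bigr => j _; congr cos; rewrite qE !natrM subr0; field.
  by rewrite !pnatr_eq0 -!lt0n g0 w0.
rewrite sum_cos_orthogonal// mod0n.
by rewrite /dvdn; case: ifP => _; rewrite ?mul1r ?mul0r.
Qed.

(* Completion over Z/q: frequencies h with q | uh and q | vh give the main term,
   all others contribute at most [boxerr]. *)
Lemma box_count (R : realType) (A B C D H L q u v c : nat) :
  (0 < q)%N -> (B <= A + H)%N -> (D <= C + L)%N ->
  `|\sum_(A <= m < B) \sum_(C <= k < D) (u * m + v * k == c %[mod q])%:R -
    (rho u v q c)%:R * ((B - A)%:R * (D - C)%:R) / q%:R|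
  <= boxerr R H L q u v.
Proof.
move=> q0 BH DL.
have q0' : 0 < q%:R :> R by rewrite ltr0n.
have qn0 : q%:R != 0 :> R by rewrite gt_eqF.
pose T (h : nat) : R := \sum_(A <= m < B) \sum_(C <= k < D)
  cos (2 * (pi * (u * h)%:R / q%:R) * m%:R + 2 * (pi * (v * h)%:R / q%:R) * k%:R +
   (- (2 * (pi * c%:R / q%:R) * h%:R))).
pose pr (h : nat) := (q %| u * h)%N && (q %| v * h)%N.
have E1 : \sum_(A <= m < B) \sum_(C <= k < D) (u * m + v * k == c %[mod q])%:R =
    q%:R^-1 * \sum_(h < q) T h.
  rewrite /T [in RHS]exchange_big/= mulr_sumr; apply: eq_bigr => m _.
  rewrite [in RHS]exchange_big/= mulr_sumr; apply: eq_bigr => k _.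
  apply: (mulIf qn0); rewrite -sum_cos_orthogonal// [RHS]mulrAC mulVf// mul1r.
  by apply: eq_bigr => h _; congr cos; rewrite !natrD !natrM; field.
have E2 : (rho u v q c)%:R * ((B - A)%:R * (D - C)%:R) / q%:R =
    q%:R^-1 * \sum_(h < q) (pr h)%:R * T h.
  rewrite -(sum_cos_principal R u v c q0) mulrC; congr (_ * _).
  rewrite mulr_suml; apply: eq_bigr => h _; rewrite /pr.
  case: andP => [[/dvdnP[s sE] /dvdnP[t tE]]|_]; last by rewrite !mul0r.
  rewrite !mul1r /T (eq_bigr (fun=> \sum_(C <= k < D)
      cos (2 * (pi * c%:R / q%:R) * h%:R))) => [|m _].
    by rewrite !sumr_const_nat -mulrnA -[RHS]mulr_natr natrM [X in _ * X = _]mulrC.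
  apply: eq_bigr => k _.
  (* At a principal frequency the phases in [m] and [k] are whole turns, so the summand is constant
     on the box. *)
  rewrite -[RHS]cosN -[RHS](cosDpin _ (s * m + t * k)); congr cos.
  by rewrite sE tE natrD !natrM; field.
rewrite E1 E2 -mulrBr -sumrB normrM gtr0_norm ?invr_gt0// /boxerr.
rewrite ler_wpM2l ?invr_ge0 ?ler0n//.
apply: le_trans (ler_norm_sum _ _ _) _; apply: ler_sum => h _.
rewrite -/(pr h); case: (pr h) => /=; first by rewrite mul1r subrr normr0 mul0r.
by rewrite mul0r subr0 mul1r norm_box_cos_sum// leq_subLR.
Qed.

(** At a nonprincipal frequency at least one factor is an inverse sine, so the product is bounded by
    [Y] times a divisibility indicator times an inverse sine, in either order, or by two inverse
    sines. Each factor is then averaged over its own variable. *)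
Lemma sum_nonprincipal_le (R : realType) (H L Y q h : nat) :
  (0 < q)%N -> (q <= Y)%N -> (H <= Y)%N -> (L <= Y)%N ->
  \sum_(a < Y) \sum_(b < Y) (~~ ((q %| a * h)%N && (q %| b * h)%N))%:R *
    (geobound R H q (a * h) * geobound R L q (b * h)) <=
  16 * Y%:R ^+ 3 * harm R Y * ((gcdn q h)%:R / q%:R) +
  16 * Y%:R ^+ 2 * harm R Y ^+ 2.
Proof.
move=> q0 qY HY LY.
set Z := \sum_(a < Y) (q %| a * h)%:R : R.
set S := \sum_(a < Y) invsin R q (a * h).
have Z0 : 0 <= Z by apply: sumr_ge0 => a _; rewrite ler0n.
have S0 : 0 <= S by apply: sumr_ge0 => a _; exact: invsin_ge0.
have ZE := sum_dvdn_le R h q0 qY; rewrite -/Z in ZE.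
have SE := sum_invsin_le R h q0 qY; rewrite -/S in SE.
apply: le_trans (_ : Y%:R * Z * S + Y%:R * Z * S + S * S <= _).
  rewrite -!(mulrA Y%:R) [X in _ + Y%:R * X + _]mulrC.
  rewrite /Z /S !mulr_suml !mulr_sumr -!big_split/=; apply: ler_sum => a _.
  rewrite !mulr_sumr -!big_split/=; apply: ler_sum => b _.
  rewrite /geobound.
  have := invsin_ge0 R q (a * h); have := invsin_ge0 R q (b * h).
  set s := invsin _ _ _; set t := invsin _ _ _ => s0 t0.
  have HY' : H%:R <= Y%:R :> R by rewrite ler_nat.
  have LY' : L%:R <= Y%:R :> R by rewrite ler_nat.
  have := ler0n R H; have := ler0n R L.
  case: (q %| a * h)%N; case: (q %| b * h)%N => /= L0 H0;
    rewrite ?(mul1r, mul0r, mulr0, add0r, addr0, mulr1); nra.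
have h0 : 0 <= harm R Y by exact: harm_ge0.
have Y0 : 0 <= Y%:R :> R by exact: ler0n.
set G := (gcdn q h)%:R / q%:R; set l := harm R Y in SE h0 *.
have ZE' : Z <= 2 * Y%:R * G by rewrite mulrA.
have ZS : Z * S <= (2 * Y%:R * G) * (4 * Y%:R * l) by rewrite ler_pM.
have SS : S * S <= (4 * Y%:R * l) * (4 * Y%:R * l) by rewrite ler_pM.
have YZS : Y%:R * (Z * S) <= 8 * Y%:R ^+ 3 * l * G.
  by apply: le_trans (ler_wpM2l Y0 ZS) _; rewrite le_eqVlt; apply/orP; left; apply/eqP; ring.
have SS' : S * S <= 16 * Y%:R ^+ 2 * l ^+ 2.
  by apply: le_trans SS _; rewrite le_eqVlt; apply/orP; left; apply/eqP; ring.
by rewrite -mulrA; lra.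
Qed.

Lemma sum_boxerr_le (R : realType) (H L Y : nat) : (H <= Y)%N -> (L <= Y)%N ->
  \sum_(q < Y) \sum_(a < Y) \sum_(b < Y) boxerr R H L q a b <=
  32 * Y%:R ^+ 3 * harm R Y ^+ 3.
Proof.
move=> HY LY; set l := harm R Y.
have l0 : 0 <= l by exact: harm_ge0.
apply: le_trans (_ : \sum_(q < Y) (\sum_(h < q)
   16 * Y%:R ^+ 3 * l * ((gcdn q h)%:R / q%:R ^+ 2) + 16 * Y%:R ^+ 2 * l ^+ 2) <= _).
  apply: ler_sum => q _; case: (posnP q) => [q0|q0].
    rewrite big1 ?addr_ge0// ?sumr_ge0// => [||a _].
    - by move=> h; rewrite !mulr_ge0 ?invr_ge0 ?exprn_ge0.
    - by rewrite !mulr_ge0 ?exprn_ge0.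
    - by rewrite big1// => b _; rewrite /boxerr q0 invr0 mul0r.
  rewrite /boxerr.
  under eq_bigr => a _ do rewrite -mulr_sumr exchange_big/=.
  rewrite -mulr_sumr exchange_big/=.
  rewrite ler_pdivrMl ?ltr0n// mulrDr mulr_sumr.
  apply: le_trans (_ : \sum_(h < q)
    (16 * Y%:R ^+ 3 * l * ((gcdn q h)%:R / q%:R) + 16 * Y%:R ^+ 2 * l ^+ 2) <= _).
    by apply: ler_sum => h _; apply: sum_nonprincipal_le => //; apply: ltnW.
  rewrite big_split/= sumr_const card_ord -[X in _ + X <= _]mulr_natl lerD2r; apply: ler_sum => h _.
  rewrite le_eqVlt; apply/orP; left; apply/eqP; field.
  by rewrite pnatr_eq0 -lt0n.
rewrite big_split/= sumr_const card_ord (_ : (16 * Y%:R ^+ 2 * l ^+ 2) *+ Y = 16 * Y%:R ^+ 3 * l ^+ 2); last by rewrite -[LHS]mulr_natr; ring.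
under eq_bigr => q _ do rewrite -mulr_sumr.
rewrite -mulr_sumr.
case: (posnP Y) => [Y0|Y0].
  by rewrite /l Y0 !(expr0n, mulr0, mul0r, addr0).
have Y3 : 0 <= 16 * Y%:R ^+ 3 * l by rewrite !mulr_ge0 ?exprn_ge0.
have := ler_wpM2l Y3 (sum_gcdn_le R Y); rewrite -/l; set s := _ * \sum_(_ < _) _.
have l1 : 1 <= l by exact: harm_ge1.
have : 16 * Y%:R ^+ 3 * l ^+ 2 <= 16 * Y%:R ^+ 3 * l ^+ 3.
  by rewrite ler_wpM2l ?mulr_ge0 ?exprn_ge0// ler_weXn2l.
lra.
Qed.

(** * Counting in short blocks *)

(* Encodes m < sqrt d and |q - sqrt d| < m; for q <= m the last condition is vacuous
   because the subtraction is truncated. *)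
Definition dom (m q d : nat) : bool :=
  [&& 0 < m, 0 < q, m ^ 2 < d, d < (q + m) ^ 2 & (q - m) ^ 2 < d]%N.

Lemma sqrn_lipschitz (a b M t : nat) : (a <= b + t -> a <= M -> b <= M ->
  a ^ 2 <= b ^ 2 + 2 * M * t)%N.
Proof.
move=> ab aM bM; rewrite -!mulnn; case: (leqP a b) => h.
  by rewrite (leq_trans (leq_mul h h))// leq_addr.
have [s sE] : exists s, a = (b + s)%N by exists (a - b)%N; lia.
subst a; nia.
Qed.

Definition dlo (e q1 q2 m : nat) : nat :=
  maxn (maxn (m ^ 2) ((e - m) ^ 2)) (maxn ((q1 - m) ^ 2) ((q2 - (e - m)) ^ 2)).
Definition dhi (X e q1 q2 m : nat) : nat :=
  minn X.+1 (minn ((q1 + m) ^ 2) ((q2 + (e - m)) ^ 2)).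

Lemma dom2E (X e q1 q2 m d : nat) : (0 < q1)%N -> (0 < q2)%N -> (0 < m < e)%N ->
  [&& (d <= X)%N, dom m q1 d & dom (e - m) q2 d] =
  (dlo e q1 q2 m < d < dhi X e q1 q2 m)%N.
Proof.
move=> q10 q20 /andP[m0 me]; rewrite /dom /dlo /dhi !gtn_max !leq_min m0 q10 q20.
rewrite subn_gt0 me/= ltnS.
case: (d <= X)%N => /=; last by rewrite !andbF.
by do !(case: (_ < _)%N; rewrite /= ?andbF ?andbT//).
Qed.

Lemma maxn_lipschitz (x y x' y' t : nat) : (x <= x' + t -> y <= y' + t ->
  maxn x y <= maxn x' y' + t)%N.
Proof. lia. Qed.

Lemma minn_lipschitz (x y x' y' t : nat) : (x <= x' + t -> y <= y' + t ->
  minn x y <= minn x' y' + t)%N.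
Proof. lia. Qed.

(** Subtracting [a^2] passes from [d] to [k q1]. The squares in the bounds have bases at most [4 n],
    so they move by at most [8 n H], and [a^2] itself by [2 n H]. *)
Lemma dlo_dhi_lipschitz (X n H e q1 q2 a b : nat) :
  (e <= 2 * n -> q1 <= 2 * n -> q2 <= 2 * n -> a <= b + H -> b <= a + H ->
   a <= n -> b <= n ->
  dlo e q1 q2 a - a ^ 2 <= dlo e q1 q2 b - b ^ 2 + 10 * n * H /\
  dhi X e q1 q2 a - a ^ 2 <= dhi X e q1 q2 b - b ^ 2 + 10 * n * H)%N.
Proof.
move=> en q1n q2n ab ba an bn.
have L (u v M : nat) : (u <= v + H)%N -> (u <= M)%N -> (v <= M)%N -> (M <= 4 * n)%N ->
    (u ^ 2 <= v ^ 2 + 8 * n * H)%N.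
  move=> h1 h2 h3 h4; apply: leq_trans (sqrn_lipschitz h1 h2 h3) _.
  by rewrite leq_add2l leq_mul2r; apply/orP; right; lia.
have B2 : (b ^ 2 <= a ^ 2 + 2 * n * H)%N by apply: sqrn_lipschitz.
have lo : (dlo e q1 q2 a <= dlo e q1 q2 b + 8 * n * H)%N.
  apply: maxn_lipschitz; first apply: maxn_lipschitz.
  - by apply: (L _ _ n) => //; lia.
  - by apply: (L _ _ (2 * n)%N) => //; lia.
  apply: maxn_lipschitz.
  - by apply: (L _ _ (2 * n)%N) => //; lia.
  - by apply: (L _ _ (2 * n)%N) => //; lia.
have hi : (dhi X e q1 q2 a <= dhi X e q1 q2 b + 8 * n * H)%N.
  apply: minn_lipschitz; first exact: leq_addr.
  apply: minn_lipschitz.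
  - by apply: (L _ _ (3 * n)%N) => //; lia.
  - by apply: (L _ _ (4 * n)%N) => //; lia.
have E : (10 * n * H = 8 * n * H + 2 * n * H)%N by rewrite -!mulnDl.
rewrite E; move: B2 lo hi; clear.
move: (dlo _ _ _ a) (dlo _ _ _ b) (dhi _ _ _ _ a) (dhi _ _ _ _ b) (a ^ 2)%N (b ^ 2)%N.
move: (8 * n * H)%N (2 * n * H)%N => x y; lia.
Qed.

(** With [khi], the ceiling of [h / q], this turns the strict bounds [l < k q < h] into the
    half-open range of [k] used by the big operators. *)
Definition klo (q l : nat) : nat := (l %/ q).+1.
Definition khi (q h : nat) : nat := ((h + q.-1) %/ q)%N.

Lemma kloE (q l k : nat) : (0 < q)%N -> (l < k * q)%N = (klo q l <= k)%N.
Proof. by move=> q0; rewrite /klo ltn_divLR. Qed.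

Lemma khiE (q h k : nat) : (0 < q)%N -> (k * q < h)%N = (k < khi q h)%N.
Proof. by move=> q0; rewrite /khi leq_divRL// mulSn; case: q q0 => // q _ /=; lia. Qed.

Lemma divn_lipschitz (q a b V : nat) : (0 < q)%N -> (a <= b + V)%N ->
  (a %/ q <= b %/ q + (V %/ q).+1)%N.
Proof.
move=> q0 h; rewrite -ltnS ltn_divLR//.
have := divn_eq b q; have := divn_eq V q; have := ltn_pmod b q0; have := ltn_pmod V q0.
move: (b %/ q)%N (V %/ q)%N (b %% q)%N (V %% q)%N => x y r s; nia.
Qed.

Lemma klo_khi_lipschitz (q a b V : nat) : (0 < q)%N -> (a <= b + V)%N ->
  (klo q a <= klo q b + (V %/ q).+1)%N /\ (khi q a <= khi q b + (V %/ q).+1)%N.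
Proof.
move=> q0 h; split; first by rewrite ltnS divn_lipschitz.
by rewrite divn_lipschitz//; lia.
Qed.

(** [(h - l).-1] is the number of integers strictly between [l] and [h]. One in [q] of them is a
    multiple of [q], with an error of at most one. *)
Lemma khi_sub_klo (q l h : nat) : (0 < q)%N ->
  (q * (khi q h - klo q l) <= (h - l).-1 + q)%N /\
  ((h - l).-1 <= q * (khi q h - klo q l) + q)%N.
Proof.
move=> q0; rewrite /khi /klo.
have := divn_eq l q; have := divn_eq (h + q.-1) q.
have := ltn_pmod l q0; have := ltn_pmod (h + q.-1) q0.
move: (l %/ q)%N ((h + q.-1) %/ q)%N (l %% q)%N ((h + q.-1) %% q)%N => x y r s.
move=> h1 h2 h3 h4; case: (leqP y x.+1) => h5.
  have -> : (y - x.+1 = 0)%N by lia.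
  split; nia.
have [z zE] : exists z, y = (x.+1 + z)%N by exists (y - x.+1)%N; lia.
subst y; rewrite addKn; split; nia.
Qed.

Lemma sum_interval (R : pzSemiRingType) (C D N : nat) (f : nat -> R) : (D <= N)%N ->
  \sum_(C <= k < D) f k = \sum_(k < N) (C <= k < D)%:R * f k.
Proof.
move=> DN; rewrite (big_nat_widenl _ _ _ _ _ (leq0n C)) (big_nat_widen _ _ _ _ _ DN).
rewrite big_mkord big_mkcond/=; apply: eq_bigr => i _.
by case: (C <= i)%N; case: (i < D)%N; rewrite /= ?mul1r ?mul0r.
Qed.

Lemma sum_interval_residue (R : pzRingType) (D l h q s : nat) (G : nat -> R) :
  (0 < q)%N -> (s <= l)%N -> (h <= D)%N ->
  \sum_(d < D) (l < d < h)%:R * ((q %| d - s)%N%:R * G d) =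
  \sum_(klo q (l - s) <= k < khi q (h - s)) G (s + k * q)%N.
Proof.
move=> q0 sl hD; rewrite (sum_interval _ _ (leqnn _)); set N := khi _ _.
have inside k : (klo q (l - s) <= k < N)%N = (l < s + k * q < h)%N.
  rewrite -kloE// -khiE//; case: (ltnP l (s + k * q)) => h1; last by rewrite ltnNge; lia.
  by apply/andP/idP; lia.
transitivity (\sum_(k < N) \sum_(d < D) (d == s + k * q :> nat)%N%:R * ((l < d < h)%:R * G d)).
  rewrite exchange_big/=; apply: eq_bigr => d _.
  case: (boolP (l < d < h)%N) => ldh; last first.
    by rewrite mul0r big1// => k _; rewrite mul0r mulr0.
  rewrite !mul1r; case: (boolP (q %| d - s)%N) => [/dvdnP[k kE]|nd].
    have dE : nat_of_ord d = (s + k * q)%N by move/andP: ldh => [? ?]; lia.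
    have kN : (k < N)%N by have := inside k; rewrite -dE ldh => /andP[].
    rewrite (bigD1 (Ordinal kN))//= dE eqxx big1 ?addr0// => j jk.
    rewrite (_ : (_ == _) = false) ?mul0r//; apply/negbTE.
    rewrite eqn_add2l eqn_pmul2r//; apply: contra jk => /eqP E.
    by apply/eqP/val_inj.
  rewrite mul0r big1// => k _; rewrite (_ : (_ == _) = false) ?mul0r//.
  by apply/negbTE; apply: contra nd => /eqP ->; rewrite addKn dvdn_mull.
apply: eq_bigr => k _; rewrite inside.
case: (boolP (l < s + k * q < h)%N) => ldh; last first.
  rewrite mul0r big1// => d _; case: eqP => [->|_]; last by rewrite mul0r.
  by rewrite (negbTE ldh) mul0r mulr0.
have kD : (s + k * q < D)%N by move/andP: ldh => [_ /leq_trans]; apply.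
rewrite (bigD1 (Ordinal kD))//= eqxx ldh !mul1r big1 ?addr0// => j jk.
rewrite (_ : (_ == _) = false) ?mul0r//; apply/negbTE.
by apply: contra jk => /eqP E; apply/eqP/val_inj.
Qed.

Lemma sum_interval_card (R : pzSemiRingType) (D l h : nat) : (h <= D)%N ->
  \sum_(d < D) (l < d < h)%:R = (h - l).-1%:R :> R.
Proof.
move=> hD; have <- : \sum_(l.+1 <= i < h) 1 = (h - l).-1%:R :> R.
  by rewrite sumr_const_nat subnS.
by rewrite (sum_interval _ _ hD); apply: eq_bigr => i _; rewrite mulr1.
Qed.

(** The intervals differ only within [U] of [C0] and [D0]. These windows depend only on the
    reference interval, so they form rectangles once [m] varies; the cap at [N] keeps their sides
    within the length allowed to a box. *)
Lemma interval_perturb (R : realType) (C D C0 D0 U N : nat) (c : nat -> R) :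
  (forall k, 0 <= c k) -> (C <= C0 + U)%N -> (C0 <= C + U)%N ->
  (D <= D0 + U)%N -> (D0 <= D + U)%N -> (D <= N)%N -> (D0 <= N)%N ->
  `|\sum_(C <= k < D) c k - \sum_(C0 <= k < D0) c k| <=
  \sum_(C0 - U <= k < minn (C0 + U) N) c k + \sum_(D0 - U <= k < minn (D0 + U) N) c k.
Proof.
move=> c0 h1 h2 h3 h4 DN D0N.
rewrite (sum_interval _ _ DN) (sum_interval _ _ D0N).
rewrite (sum_interval _ _ (geq_minr (C0 + U) N)) (sum_interval _ _ (geq_minr (D0 + U) N)).
rewrite -sumrB -big_split/=; apply: le_trans (ler_norm_sum _ _ _) _.
apply: ler_sum => k _; rewrite -mulrBl -mulrDl normrM (ger0_norm (c0 k)).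
rewrite ler_wpM2r//; have := ltn_ord k => kN.
have bnd (p p0 : bool) : `|p%:R - p0%:R| <= 1 :> R.
  by case: p; case: p0; rewrite ?subrr ?sub0r ?subr0 ?normrN ?normr1 ?normr0.
case: (boolP (C0 - U <= k < minn (C0 + U) N)%N) => w1.
  by rewrite (le_trans (bnd _ _))// lerDl.
case: (boolP (D0 - U <= k < minn (D0 + U) N)%N) => w2.
  by rewrite add0r bnd.
have -> : (C <= k < D)%N = (C0 <= k < D0)%N.
  have e1 : (C <= k)%N = (C0 <= k)%N by apply/idP/idP; lia.
  have e2 : (k < D)%N = (k < D0)%N by apply/idP/idP; lia.
  by rewrite e1 e2.
by rewrite subrr normr0 addr0.
Qed.

(** * Deviation from the expected density *)

Definition rho3 (e q1 q2 : nat) : nat := rho (2 * e) q1 q2 (e ^ 2).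

(** Error made, for [m1 = m] and [m2 = e - m], when the two divisibility conditions are replaced by
    their expected density: [1 / q1] for the first, and [rho3 / q2] for the second on average over
    pairs [(m, k)]. *)
Definition defect (R : realType) (X e q1 q2 m : nat) : R :=
  \sum_(d < X.+1) [&& (d <= X)%N, dom m q1 d & dom (e - m) q2 d]%:R *
    ((q1 %| d - m ^ 2)%N%:R * (q2 %| d - (e - m) ^ 2)%N%:R -
     (rho3 e q1 q2)%:R / (q1%:R * q2%:R)).

(* With m1 = m and m2 = e - m, the divisibility by q2 is linear in (m, k) on d = m^2 + k q1. *)
Lemma dvdn_linear (e m k q1 q2 : nat) : (m <= e)%N -> ((e - m) ^ 2 <= m ^ 2 + k * q1)%N ->
  (q2 %| m ^ 2 + k * q1 - (e - m) ^ 2)%N = (2 * e * m + q1 * k == e ^ 2 %[mod q2])%N.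
Proof.
move=> me h; rewrite -eqn_mod_dvd// -(eqn_modDl (2 * e * m)).
have [f fE] : exists f, e = (f + m)%N by exists (e - m)%N; rewrite subnK.
rewrite fE addnK (_ : 2 * (f + m) * m + f ^ 2 = m ^ 2 + (f + m) ^ 2)%N; last by rewrite -!mulnn; lia.
by rewrite addnCA eqn_modDl (mulnC k).
Qed.

Lemma subn_sub_common (s l h : nat) : (s <= l)%N -> ((h - s) - (l - s) = h - l)%N.
Proof. lia. Qed.

Lemma subn_lipschitz (a b c d u : nat) :
  (a <= c + u -> c <= a + u -> b <= d + u -> d <= b + u ->
   a - b <= 2 * u + (c - d) /\ c - d <= 2 * u + (a - b))%N.
Proof. lia. Qed.

Lemma window_width (a u m : nat) : (minn (a + u) m - (a - u) <= 2 * u)%N.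
Proof. lia. Qed.

Section Block.
Context (R : realType) (X e q1 q2 : nat).
Hypotheses (q10 : (0 < q1)%N) (q20 : (0 < q2)%N).

(** On [d = m^2 + k q1] the admissible [k] fill the range from [C m] to [D m], [c m k] tests the
    remaining congruence, and [cnt m] counts the admissible [d] before any divisibility is
    imposed. *)
Let C m := klo q1 (dlo e q1 q2 m - m ^ 2).
Let D m := khi q1 (dhi X e q1 q2 m - m ^ 2).
Let c (m k : nat) : R := (2 * e * m + q1 * k == e ^ 2 %[mod q2])%N%:R.
Let cnt m := (dhi X e q1 q2 m - dlo e q1 q2 m).-1.

Lemma defectE m : (0 < m < e)%N ->
  defect R X e q1 q2 m =
  \sum_(C m <= k < D m) c m k - (rho3 e q1 q2)%:R / (q1%:R * q2%:R) * (cnt m)%:R.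
Proof.
move=> me; have /andP[m0 me'] := me.
rewrite /defect.
have mlo : (m ^ 2 <= dlo e q1 q2 m)%N by rewrite /dlo !leq_max leqnn.
have elo : ((e - m) ^ 2 <= dlo e q1 q2 m)%N by rewrite /dlo !leq_max leqnn orbT.
have hX : (dhi X e q1 q2 m <= X.+1)%N by rewrite /dhi geq_minl.
under eq_bigr => d _ do rewrite dom2E// mulrBr.
rewrite sumrB -mulr_suml mulrC (sum_interval_card _ _ hX); congr (_ - _).
rewrite (sum_interval_residue (fun d => (q2 %| d - (e - m) ^ 2)%N%:R) q10 mlo hX).
apply: eq_big_nat => k /andP[Ck _]; rewrite dvdn_linear// ?(ltnW me')//.
move: Ck; rewrite -kloE// => Ck; apply: leq_trans elo _.
by rewrite -leq_subLR ltnW.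
Qed.

(** From [(q1 + m)^2 - m^2 = q1 (q1 + 2 m)] one gets [k < q1 + 2 m <= 4 n]. This is the origin of
    the side [4 n] of all boxes. *)
Lemma khi_le n m : (m <= n)%N -> (q1 <= 2 * n)%N -> (D m <= 4 * n)%N.
Proof.
move=> mn q1n; rewrite leqNgt -khiE// -leqNgt.
apply: leq_trans (_ : (q1 + m) ^ 2 - m ^ 2 <= _)%N.
  by apply: leq_sub2r; rewrite /dhi !geq_min leqnn orbT.
rewrite leq_subLR -!mulnn; have [s sE] : exists s, (4 * n = q1 + 2 * m + s)%N.
  by exists (4 * n - (q1 + 2 * m))%N; lia.
rewrite sE; nia.
Qed.

Lemma block_defect_le n H A B : (q1 <= 2 * n)%N -> (q2 <= 2 * n)%N -> (e <= 2 * n)%N ->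
  (0 < A)%N -> (B <= A + H)%N -> (B <= e)%N -> (B <= n)%N ->
  `|\sum_(A <= m < B) defect R X e q1 q2 m| <=
  3 * boxerr R H (4 * n) q2 (2 * e) q1 +
  (rho3 e q1 q2)%:R / q2%:R * (H%:R * (6 * ((10 * n * H) %/ q1).+1%:R + 1)).
Proof.
move=> q1n q2n en A0 BH Be Bn.
set U := (_ %/ q1).+1.
set r : R := (rho3 e q1 q2)%:R / q2%:R; set err := boxerr _ _ _ _ _ _.
have r0 : 0 <= r by rewrite divr_ge0.
have err0 : 0 <= err by exact: boxerr_ge0.
case: (leqP B A) => [BA|AB].
  rewrite sum_nat_empty// normr0; apply: addr_ge0; first exact: mulr_ge0.
  by apply: mulr_ge0 => //; apply: mulr_ge0 => //; apply: addr_ge0 => //; exact: mulr_ge0.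
have box C' D' : (D' <= C' + 4 * n)%N ->
    `|\sum_(A <= m < B) \sum_(C' <= k < D') c m k - r * ((B - A)%:R * (D' - C')%:R)| <= err.
  move=> h; have := box_count R (2 * e) q1 (e ^ 2) q20 BH h.
  by rewrite [_ / _]mulrAC.
set W1l := (C A - U)%N; set W1r := minn (C A + U) (4 * n).
set W2l := (D A - U)%N; set W2r := minn (D A + U) (4 * n).
have An : (A <= n)%N by apply: leq_trans (ltnW AB) Bn.
have lip m : (A <= m < B)%N ->
    [/\ C m <= C A + U, C A <= C m + U, D m <= D A + U & D A <= D m + U]%N.
  move=> /andP[Am mB].
  have mn : (m <= n)%N by apply: leq_trans (ltnW mB) Bn.
  have mA : (m <= A + H)%N by apply: leq_trans (ltnW mB) BH.
  have Am' : (A <= m + H)%N by apply: leq_trans Am (leq_addr _ _).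
  have [h1 h2] := dlo_dhi_lipschitz X en q1n q2n mA Am' mn An.
  have [h3 h4] := dlo_dhi_lipschitz X en q1n q2n Am' mA An mn.
  have [k1 _] := klo_khi_lipschitz q10 h1; have [_ k2] := klo_khi_lipschitz q10 h2.
  have [k3 _] := klo_khi_lipschitz q10 h3; have [_ k4] := klo_khi_lipschitz q10 h4.
  by split.
have c0 m k : 0 <= c m k by rewrite ler0n.
set hh : R := (B - A)%:R.
have hhH : 0 <= hh <= H%:R by rewrite ler0n/= ler_nat leq_subLR.
set S0 := \sum_(A <= m < B) \sum_(C A <= k < D A) c m k.
set S1 := \sum_(A <= m < B) \sum_(C m <= k < D m) c m k.
set w1 := \sum_(A <= m < B) \sum_(W1l <= k < W1r) c m k.
set w2 := \sum_(A <= m < B) \sum_(W2l <= k < W2r) c m k.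
have S01 : `|S1 - S0| <= w1 + w2.
  rewrite /S1 /S0 -sumrB -big_split/=; apply: le_trans (ler_norm_sum _ _ _) _.
  apply: ler_sum_nat => m mAB; have [h1 h2 h3 h4] := lip m mAB.
  apply: interval_perturb => //; last exact: khi_le.
  apply: khi_le => //; move/andP: mAB => [_ /ltnW/leq_trans]; exact.
have U0 : 0 <= U%:R :> R by [].
have width W W' : (W' <= W + 4 * n)%N -> (W' - W <= 2 * U)%N ->
    \sum_(A <= m < B) \sum_(W <= k < W') c m k <= r * (hh * (2 * U%:R)) + err.
  move=> h1 h2; have := box W W' h1; rewrite ler_distl => /andP[_].
  move/le_trans; apply; rewrite lerD2r ler_wpM2l// ler_wpM2l//.
  by rewrite -natrM ler_nat.
have w1le : w1 <= r * (hh * (2 * U%:R)) + err.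
  by apply: width; [rewrite /W1r (leq_trans (geq_minr _ _)) ?leq_addl|exact: window_width].
have w2le : w2 <= r * (hh * (2 * U%:R)) + err.
  by apply: width; [rewrite /W2r (leq_trans (geq_minr _ _)) ?leq_addl|exact: window_width].
have S0le : `|S0 - r * (hh * (D A - C A)%:R)| <= err.
  by apply: box; apply: leq_trans (khi_le An q1n) (leq_addl _ _).
have E : \sum_(A <= m < B) defect R X e q1 q2 m =
    (S1 - S0) + (S0 - r * (hh * (D A - C A)%:R)) +
    \sum_(A <= m < B) r * ((D A - C A)%:R - (cnt m)%:R / q1%:R).
  rewrite (eq_big_nat _ _ (F2 := fun m => \sum_(C m <= k < D m) c m k -
      r * ((cnt m)%:R / q1%:R))); last first.
    move=> m /andP[Am mB]; rewrite defectE; last by rewrite (leq_trans A0 Am) (leq_trans mB Be).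
    congr (_ - _); rewrite /r; field.
    by rewrite !pnatr_eq0 -!lt0n q10 q20.
  rewrite sumrB -/S1.
  under [X in _ = _ + X]eq_bigr => m _ do rewrite mulrBr.
  by rewrite sumrB sumr_const_nat -[X in _ + (X - _)]mulr_natl -/hh; ring.
(* Both end points move by at most [U], and rounding to multiples of [q1] costs [1]. *)
have cle m : (A <= m < B)%N -> `|(D A - C A)%:R - (cnt m)%:R / q1%:R| <= 2 * U%:R + 1 :> R.
  move=> mAB; have [h1 h2 h3 h4] := lip m mAB.
  have [k1 k2] := khi_sub_klo (dlo e q1 q2 m - m ^ 2) (dhi X e q1 q2 m - m ^ 2) q10.
  have lm : (m ^ 2 <= dlo e q1 q2 m)%N by rewrite /dlo !leq_max leqnn.
  have cE : ((dhi X e q1 q2 m - m ^ 2) - (dlo e q1 q2 m - m ^ 2)).-1 = cnt m.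
    by rewrite subn_sub_common.
  rewrite cE -/(C m) -/(D m) in k1 k2.
  apply: le_trans (_ : `|(D A - C A)%:R - (D m - C m)%:R| +
      `|(D m - C m)%:R - (cnt m)%:R / q1%:R| <= _); first exact: ler_distD.
  apply: lerD.
    have [j1 j2] := subn_lipschitz h3 h4 h1 h2.
    rewrite ler_distl lerBlDr -!natrM -!natrD !ler_nat; apply/andP; split.
      by rewrite addnC.
    by rewrite addnC.
  have q1' : 0 < q1%:R :> R by rewrite ltr0n.
  rewrite ler_distl lerBlDr -{1}(ler_pM2r q1') -[X in _ && X](ler_pM2r q1').
  rewrite !mulrDl mulfVK ?gt_eqF// !mul1r -!natrM -!natrD !ler_nat ![(_ * q1)%N]mulnC.
  by rewrite k1 k2.
rewrite E; apply: le_trans (ler_normD _ _) _.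
apply: le_trans (lerD (ler_normD _ _) (ler_norm_sum _ _ _)) _.
have last : \sum_(A <= m < B) `|r * ((D A - C A)%:R - (cnt m)%:R / q1%:R)| <=
    r * (hh * (2 * U%:R + 1)).
  rewrite (_ : r * _ = \sum_(A <= m < B) r * (2 * U%:R + 1)); last first.
    by rewrite sumr_const_nat -[RHS]mulr_natl mulrCA.
  apply: ler_sum_nat => m mAB.
  by rewrite normrM ger0_norm// ler_wpM2l// cle.
have : r * (hh * (6 * U%:R + 1)) <= r * (H%:R * (6 * U%:R + 1)).
  by rewrite ler_wpM2l// ler_wpM2r ?addr_ge0 ?mulr_ge0//; case/andP: hhH.
move: last S01 w1le w2le S0le; clear.
set x := \sum_(_ <= _ < _) `|_|; move: x `|S1 - S0| `|S0 - _| w1 w2 => x y z w1 w2.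
nra.
Qed.

End Block.

Lemma chain_blocks (R : realType) (F : nat -> R) (lo hi H K : nat) (E : R) :
  0 <= E ->
  (forall A B, (lo <= A)%N -> (B <= A + H)%N -> (B <= hi)%N ->
     `|\sum_(A <= m < B) F m| <= E) ->
  (hi <= lo + K * H)%N -> `|\sum_(lo <= m < hi) F m| <= K%:R * E.
Proof.
move=> E0; elim: K lo => [|K IH] lo blk hiK.
  by rewrite sum_nat_empty ?normr0 ?mul0r//; lia.
case: (leqP hi (lo + H)) => h.
  apply: le_trans (blk lo hi (leqnn _) h (leqnn _)) _.
  by rewrite ler_peMl// ler1n.
rewrite (@big_cat_nat _ _ _ (lo + H)%N) ?leq_addr//= 1?ltnW//.
apply: le_trans (ler_normD _ _) _; rewrite -add1n natrD mulrDl mul1r lerD//.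
  by apply: blk => //; exact: ltnW.
apply: IH => [A B hA|]; last by lia.
by apply: blk; lia.
Qed.

Lemma defect0 (R : realType) (X e q1 q2 m : nat) :
  (m == 0)%N || (e <= m)%N || (q1 == 0)%N || (q2 == 0)%N -> defect R X e q1 q2 m = 0.
Proof.
move=> h; rewrite /defect big1// => d _; rewrite (_ : [&& _, _ & _] = false) ?mul0r//.
apply/negP => /and3P[_ /and5P[m0 q10 _ _ _] /and5P[em q20 _ _ _]].
by move: h; lia.
Qed.

Lemma triple_defect_le (R : realType) (X n H e q1 q2 : nat) :
  (0 < n)%N -> (0 < H)%N -> (q1 <= 2 * n)%N -> (q2 <= 2 * n)%N -> (e <= 2 * n)%N ->
  `|\sum_(m < n) defect R X e q1 q2 m| <=
  (n %/ H).+1%:R * (3 * boxerr R H (4 * n) q2 (2 * e) q1 +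
    74 * (n * H ^ 2)%:R * ((rho3 e q1 q2)%:R / (q1%:R * q2%:R))).
Proof.
move=> n0 H0 q1n q2n en; set r : R := _ / (_ * _).
have r0 : 0 <= r by rewrite divr_ge0// mulr_ge0.
have E0 : 0 <= 3 * boxerr R H (4 * n) q2 (2 * e) q1 + 74 * (n * H ^ 2)%:R * r.
  by apply: addr_ge0; apply: mulr_ge0; rewrite ?boxerr_ge0 ?mulr_ge0.
case: (posnP q1) => [q10|q10].
  rewrite big1 ?normr0 ?mulr_ge0// => m _; apply: defect0.
  by rewrite q10 eqxx !orbT.
case: (posnP q2) => [q20|q20].
  rewrite big1 ?normr0 ?mulr_ge0// => m _; apply: defect0.
  by rewrite q20 eqxx !orbT.
have -> : \sum_(m < n) defect R X e q1 q2 m = \sum_(1 <= m < minn e n) defect R X e q1 q2 m.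
  rewrite (sum_interval _ _ (geq_minr e n)); apply: eq_bigr => m _.
  case: (boolP (1 <= m < minn e n)%N) => h; first by rewrite mul1r.
  by rewrite mul0r defect0//; move: h; have := ltn_ord m; lia.
apply: (chain_blocks (H := H)) => // [A B A1 BH Be|]; last first.
  apply: leq_trans (geq_minr e n) _; apply: leq_trans (_ : (n %/ H).+1 * H <= _)%N.
    by rewrite ltnW// -ltn_divLR.
  by rewrite leq_addl.
have [Be' Bn] : (B <= e)%N /\ (B <= n)%N by move: Be; rewrite leq_min => /andP.
apply: le_trans (block_defect_le R X q10 q20 q1n q2n en A1 BH Be' Bn) _.
rewrite lerD2l.
have q1' : 0 < q1%:R :> R by rewrite ltr0n.
have q2' : 0 < q2%:R :> R by rewrite ltr0n.
set V := (10 * n * H)%N.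
have -> : (rho3 e q1 q2)%:R / q2%:R = r * q1%:R :> R by rewrite /r; field; rewrite !gt_eqF.
rewrite [leRHS]mulrC -mulrA ler_wpM2l//.
have UV : (V %/ q1 * q1 <= V)%N := leq_divM _ _.
rewrite (_ : q1%:R * _ = (q1 * (H * (6 * (V %/ q1).+1 + 1)))%:R); last first.
  by rewrite !natrM natrD natrM.
rewrite -natrM ler_nat -mulnn.
(* Here [60 = 6 * 10] comes from [V = 10 n H], and [14 n] from [7 q1] with [q1 <= 2 n]; together
   they give the constant [74]. *)
have h1 : (q1 * (6 * (V %/ q1).+1 + 1) <= 60 * (n * H) + 14 * n)%N.
  by move: UV; rewrite /V; move: (V %/ q1)%N => t; nia.
have h2 : (n <= n * H)%N by rewrite leq_pmulr.
rewrite mulnCA (_ : 74 * (n * (H * H)) = H * (74 * (n * H)))%N; last by lia.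
by rewrite leq_mul2l; apply/orP; right; lia.
Qed.

(** Change of variables from [m2] to [e = m1 + m2]. Truncated subtraction sends every [e <= m] to
    [0], where [f] vanishes. *)
Lemma sum_subn_shift (V : nmodType) (n m : nat) (f : nat -> V) : (m <= n)%N ->
  f 0%N = 0 -> (forall j, (n <= j)%N -> f j = 0) ->
  \sum_(e < 2 * n) f (e - m)%N = \sum_(j < n) f j.
Proof.
move=> mn f0 fn; rewrite (_ : 2 * n = m + n + (n - m))%N; last by lia.
rewrite !big_split_ord/= big1 => [|i _].
  rewrite add0r [X in _ + X]big1 ?addr0 => [|i _].
    by apply: eq_bigr => i _; rewrite addKn.
  by rewrite fn//; lia.
by rewrite (_ : (_ - _ = 0)%N)//; have := ltn_ord i; lia.
Qed.

Lemma dom_lt (m q d X n : nat) : dom m q d -> (d <= X)%N -> (X < n ^ 2)%N ->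
  (m < n)%N /\ (q < 2 * n)%N.
Proof.
move=> /and5P[_ _ md _ qd] dX Xn.
have mn : (m < n)%N by rewrite -ltn_sqr; lia.
have : (q - m < n)%N by rewrite -ltn_sqr; lia.
by lia.
Qed.

(** [rho3] is at most the gcd [g], which is the term [w = g] of a nonnegative sum over common
    divisors. In that sum the variables [e], [q1], [q2] separate. *)
Lemma rho3_le_sum (R : realType) (n e q1 q2 : nat) : (q2 < 2 * n)%N ->
  (rho3 e q1 q2)%:R / (q1%:R * q2%:R) <=
  \sum_(w < 2 * n) w%:R * (w %| 2 * e)%N%:R * (((w %| q1)%N%:R * q1%:R^-1) *
     ((w %| q2)%N%:R * q2%:R^-1)) :> R.
Proof.
move=> q2n; case: (posnP q2) => [->|q20].
  by rewrite !(invr0, mulr0)// sumr_ge0// => w _; rewrite !(mulr0).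
set g := gcdn (gcdn (2 * e) q1) q2.
have gn : (g < 2 * n)%N by apply: leq_ltn_trans q2n; rewrite dvdn_leq// dvdn_gcdr.
have rg : (rho3 e q1 q2 <= g)%N by rewrite /rho3 /rho -/g; case: ifP.
rewrite (bigD1 (Ordinal gn))//=.
rewrite (dvdn_trans (dvdn_gcdl _ _) (dvdn_gcdl _ _)).
rewrite (dvdn_trans (dvdn_gcdl _ _) (dvdn_gcdr _ _)) dvdn_gcdr.
rewrite !mul1r mulr1 -invfM.
apply: le_trans (_ : g%:R / (q1%:R * q2%:R) <= _).
  by rewrite ler_wpM2r ?ler_nat// invr_ge0 mulr_ge0.
rewrite lerDl sumr_ge0//.
Qed.

Lemma sum_even (R : pzSemiRingType) (n : nat) (F : nat -> R) :
  \sum_(a < 4 * n) (2 %| a)%N%:R * F a = \sum_(e < 2 * n) F (2 * e)%N.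
Proof.
rewrite (_ : 4 * n = 2 * n * 2)%N ?sum_multiples//; last by lia.
by apply: eq_bigr => e _; rewrite mulnC.
Qed.

(** For each [w] the three separated sums are at most [8 n / w], [l / w] and [l / w]. With the
    weight [w] this leaves [8 n l^2 / w^2], and summing the weaker [1 / w] supplies the third factor
    [l]. *)
Lemma sum_rho3_le (R : realType) (n : nat) :
  \sum_(q1 < 2 * n) \sum_(q2 < 2 * n) \sum_(e < 2 * n)
    (rho3 e q1 q2)%:R / (q1%:R * q2%:R) <= 8 * n%:R * harm R (4 * n) ^+ 3.
Proof.
set l := harm R (4 * n).
have l0 : 0 <= l by exact: harm_ge0.
apply: le_trans (_ : \sum_(w < 2 * n) w%:R * (\sum_(e < 2 * n) (w %| 2 * e)%N%:R) *
  ((\sum_(q1 < 2 * n) (w %| q1)%N%:R * q1%:R^-1) *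
   (\sum_(q2 < 2 * n) (w %| q2)%N%:R * q2%:R^-1)) <= _).
  apply: le_trans (_ : \sum_(q1 < 2 * n) \sum_(q2 < 2 * n) \sum_(e < 2 * n)
      \sum_(w < 2 * n) w%:R * (w %| 2 * e)%N%:R * (((w %| q1)%N%:R * q1%:R^-1) *
        ((w %| q2)%N%:R * q2%:R^-1)) <= _).
    by do 3 (apply: ler_sum => ? _); apply: rho3_le_sum.
  under eq_bigr => q1 _ do (under eq_bigr => q2 _ do rewrite exchange_big/=; rewrite exchange_big/=).
  rewrite exchange_big/=; apply: ler_sum => w _.
  rewrite le_eqVlt; apply/orP; left; apply/eqP.
  rewrite big_distrlr/= mulr_sumr; apply: eq_bigr => q1 _.
  rewrite mulr_sumr; apply: eq_bigr => q2 _.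
  by rewrite mulr_sumr mulr_suml.
apply: le_trans (_ : \sum_(w < 2 * n) w%:R * (8 * n%:R / w%:R) *
   ((w%:R^-1 * l) * (w%:R^-1 * l)) <= _).
  apply: ler_sum => w _; case: (posnP w) => [->|w0]; first by rewrite !mul0r.
  have wn : (w <= 4 * n)%N by have := ltn_ord w; lia.
  have h q : harm R (2 * n) <= l by apply: harm_le; lia.
  have hw : \sum_(q < 2 * n) (w %| q)%N%:R * q%:R^-1 <= w%:R^-1 * l.
    apply: le_trans (sum_inv_multiples_le R w (2 * n)) _.
    by rewrite ler_wpM2l ?invr_ge0// harm_le//; lia.
  have hw0 : 0 <= \sum_(q < 2 * n) (w %| q)%N%:R * q%:R^-1 :> R.
    by rewrite sumr_ge0// => q _; rewrite mulr_ge0 ?invr_ge0.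
  apply: ler_pM; rewrite ?mulr_ge0 ?sumr_ge0//; last by apply: ler_pM.
  rewrite ler_wpM2l//.
  apply: le_trans (_ : \sum_(a < 4 * n) (w %| a)%N%:R <= _).
    rewrite -(sum_even n (fun a => (w %| a)%N%:R)).
    by apply: ler_sum => a _; case: (2 %| a)%N; rewrite ?mul1r ?mul0r.
  have := sum_dvdn_le R 1 w0 wn; rewrite gcdn1 mulr1.
  under eq_bigr => a _ do rewrite muln1.
  by move/le_trans; apply; rewrite ler_wpM2r ?invr_ge0// !natrM; lra.
have w2 (w : nat) : w%:R * (8 * n%:R / w%:R) * ((w%:R^-1 * l) * (w%:R^-1 * l)) <=
    8 * n%:R * l ^+ 2 * w%:R^-1.
  case: (posnP w) => [->|w0]; first by rewrite !(mul0r, invr0, mulr0).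
  have w1 : 1 <= w%:R :> R by rewrite ler1n.
  have wn0 : w%:R != 0 :> R by rewrite pnatr_eq0 -lt0n.
  rewrite [leLHS](_ : _ = 8 * n%:R * l ^+ 2 * w%:R^-1 * w%:R^-1); last by field.
  by rewrite ler_piMr ?invf_le1// ?mulr_ge0 ?exprn_ge0 ?invr_ge0// ltr0n.
apply: le_trans (_ : \sum_(w < 2 * n) 8 * n%:R * l ^+ 2 * w%:R^-1 <= _).
  by apply: ler_sum => w _; exact: w2.
rewrite -mulr_sumr [in leRHS](exprSr l 2) mulrA ler_wpM2l ?mulr_ge0 ?exprn_ge0//.
by apply: le_trans (sum_inv_le_harm R (2 * n)) _; apply: harm_le; lia.
Qed.


(** The coefficient [2 e] runs through the even numbers below [4 n]; by positivity the sum may be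
    extended to all coefficients and moduli below [4 n]. *)
Lemma sum_boxerr_triples_le (R : realType) (n H : nat) : (H <= 4 * n)%N ->
  \sum_(q1 < 2 * n) \sum_(q2 < 2 * n) \sum_(e < 2 * n)
    boxerr R H (4 * n) q2 (2 * e) q1 <= 32 * (4 * n)%:R ^+ 3 * harm R (4 * n) ^+ 3.
Proof.
move=> Hn; apply: le_trans (sum_boxerr_le R Hn (leqnn (4 * n))).
have widen (F : nat -> R) : (forall i, 0 <= F i) ->
    \sum_(i < 2 * n) F i <= \sum_(i < 4 * n) F i.
  move=> F0; have h : (2 * n <= 4 * n)%N by rewrite leq_mul2r orbT.
  rewrite -!(big_mkord xpredT F) (big_cat_nat (leq0n _) h)//= lerDl.
  by rewrite sumr_ge0.
have pos q a b : 0 <= boxerr R H (4 * n) q a b by exact: boxerr_ge0.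
rewrite exchange_big/=.
apply: le_trans (_ : \sum_(q < 2 * n) \sum_(a < 4 * n) \sum_(b < 4 * n)
   boxerr R H (4 * n) q a b <= _); last first.
  by apply: (widen (fun q => \sum_(a < 4 * n) \sum_(b < 4 * n) boxerr R H (4 * n) q a b));
    move=> q; do 2 (rewrite sumr_ge0// => ? _).
apply: ler_sum => q _; rewrite exchange_big/=.
apply: le_trans (_ : \sum_(e < 2 * n) \sum_(b < 4 * n) boxerr R H (4 * n) q (2 * e) b <= _).
  by apply: ler_sum => e _; apply: (widen (fun b => boxerr R H (4 * n) q (2 * e) b)).
rewrite -(sum_even n (fun a => \sum_(b < 4 * n) boxerr R H (4 * n) q a b)).
apply: ler_sum => a _.
by case: (2 %| a)%N; rewrite ?mulr1 ?mulr0 ?mul1r ?mul0r ?sumr_ge0.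
Qed.

Lemma total_defect_le (R : realType) (X n H : nat) :
  (0 < n)%N -> (X < n ^ 2)%N -> (0 < H)%N -> (H <= 4 * n)%N ->
  `|\sum_(d < X.+1) \sum_(m1 < n) \sum_(m2 < n) \sum_(q1 < 2 * n) \sum_(q2 < 2 * n)
     (dom m1 q1 d && dom m2 q2 d)%:R *
     ((q1 %| d - m1 ^ 2)%N%:R * (q2 %| d - m2 ^ 2)%N%:R -
      (rho3 (m1 + m2) q1 q2)%:R / (q1%:R * q2%:R))| <=
  (n %/ H).+1%:R * (6144 * n%:R ^+ 3 + 592 * n%:R ^+ 2 * H%:R ^+ 2) *
    harm R (4 * n) ^+ 3.
Proof.
move=> n0 Xn H0 Hn.
have -> : \sum_(d < X.+1) \sum_(m1 < n) \sum_(m2 < n) \sum_(q1 < 2 * n) \sum_(q2 < 2 * n)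
     (dom m1 q1 d && dom m2 q2 d)%:R *
     ((q1 %| d - m1 ^ 2)%N%:R * (q2 %| d - m2 ^ 2)%N%:R -
      (rho3 (m1 + m2) q1 q2)%:R / (q1%:R * q2%:R)) =
    \sum_(q1 < 2 * n) \sum_(q2 < 2 * n) \sum_(e < 2 * n) \sum_(m < n)
      defect R X e q1 q2 m.
  under eq_bigr => d _.
    under eq_bigr => m1 _.
      rewrite exchange_big/=.
      under eq_bigr => q1 _ do rewrite exchange_big/=.
      over.
    rewrite exchange_big/=.
    under eq_bigr => q1 _ do rewrite exchange_big/=.
    over.
  rewrite exchange_big/=; apply: eq_bigr => q1 _.
  rewrite exchange_big/=; apply: eq_bigr => q2 _.
  rewrite exchange_big/= [RHS]exchange_big/=; apply: eq_bigr => m1 _.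
  rewrite exchange_big/=.
  pose f (m2 : nat) : R := \sum_(d < X.+1) (dom m1 q1 d && dom m2 q2 d)%:R *
     ((q1 %| d - m1 ^ 2)%N%:R * (q2 %| d - m2 ^ 2)%N%:R -
      (rho3 (m1 + m2) q1 q2)%:R / (q1%:R * q2%:R)).
  rewrite -(sum_subn_shift (f := f) (ltnW (ltn_ord m1))).
  - apply: eq_bigr => e _; rewrite /f /defect; apply: eq_bigr => d _.
    have -> : (d <= X)%N by rewrite -ltnS.
    case: (ltnP m1 e) => me; first by rewrite subnKC// ltnW.
    by rewrite (_ : dom (e - m1) _ _ = false) ?andbF ?mul0r// /dom subn_gt0 ltnNge me.
  - by rewrite /f big1// => d _; rewrite andbF mul0r.
  - move=> j nj; rewrite /f big1// => d _.
    rewrite (_ : dom j _ _ = false) ?andbF ?mul0r//; apply/negP => hj.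
    by have [] := dom_lt hj (ltn_ord d : (d <= X)%N) Xn; lia.
apply: le_trans (ler_norm_sum _ _ _) _.
apply: le_trans (_ : \sum_(q1 < 2 * n) \sum_(q2 < 2 * n) \sum_(e < 2 * n)
   (n %/ H).+1%:R * (3 * boxerr R H (4 * n) q2 (2 * e) q1 +
    74 * (n * H ^ 2)%:R * ((rho3 e q1 q2)%:R / (q1%:R * q2%:R))) <= _).
  apply: ler_sum => q1 _; apply: le_trans (ler_norm_sum _ _ _) _.
  apply: ler_sum => q2 _; apply: le_trans (ler_norm_sum _ _ _) _.
  by apply: ler_sum => e _; apply: triple_defect_le => //; exact: ltnW.
have := sum_boxerr_triples_le R Hn.
move: (boxerr R H (4 * n)) => err h1.
under eq_bigr => q1 _.
  under eq_bigr => q2 _ do rewrite -mulr_sumr big_split/= -!mulr_sumr.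
  rewrite -mulr_sumr big_split/= -!mulr_sumr.
  over.
(* The constants are [6144 = 3 * 32 * 4^3] and [592 = 74 * 8]. *)
rewrite -mulr_sumr big_split/= -!mulr_sumr -mulrA ler_wpM2l//.
have h2 := sum_rho3_le R n.
have nH0 : 0 <= 74 * (n * H ^ 2)%:R :> R by rewrite mulr_ge0.
have := ler_wpM2l nH0 h2; move: h1.
set s := \sum_(_ < _) _; set t := _ * \sum_(_ < _) _; set l := harm _ _.
rewrite !natrM ?natrX; move: (n%:R : R) (H%:R : R) l => x y l.
lra.
Qed.

(** * W as a sum over d *)

(** Since [(q + m)^2 - m^2 = q (q + 2 m)] and [(q - m)^2 - m^2 = q (q - 2 m)], dividing by [q] turns
    the two bounds on [d] into [k < q + 2 m] and [q < k + 2 m]. *)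
Lemma domE (m q k : nat) :
  dom m q (m ^ 2 + k * q) =
  [&& (0 < m)%N, (0 < q)%N, (0 < k)%N & (`|(k%:Z - q%:Z)%R| < (2 * m)%:Z)%R].
Proof.
rewrite /dom; case: (posnP m) => [->//|m0]; case: (posnP q) => [->//|q0].
rewrite -[X in (X < _)%N]addn0 ltn_add2l muln_gt0 q0 andbT /=.
case: (posnP k) => //= k0.
have -> : (m ^ 2 + k * q < (q + m) ^ 2)%N = (k < q + 2 * m)%N.
  rewrite -(ltn_pmul2r (m := q))//; apply/idP/idP; nia.
have -> : ((q - m) ^ 2 < m ^ 2 + k * q)%N = (q < k + 2 * m)%N.
  case: (leqP q m) => h.
    rewrite (_ : (q - m = 0)%N); last by lia.
    by rewrite !addn_gt0 !muln_gt0 k0 q0 orbT/=; lia.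
  have [s sE] : exists s, q = (m + s)%N by exists (q - m)%N; lia.
  rewrite sE addKn -(ltn_pmul2r (m := (m + s)%N)); last by lia.
  by apply/idP/idP; nia.
lia.
Qed.

Lemma sum_bool_pick (N c : nat) (F : nat -> nat) :
  (\sum_(d < N) (d == c :> nat) * F d = (c < N) * F c)%N.
Proof.
case: (ltnP c N) => cN; last first.
  by rewrite big1// => d _; case: eqP => // E; have := ltn_ord d; lia.
rewrite (bigD1 (Ordinal cN))//= eqxx big1 ?addn0// => i ic.
by rewrite (_ : (_ == _) = false)//; apply/negbTE; apply: contra ic => /eqP E; apply/eqP/val_inj.
Qed.

Lemma sum_quotient (T m q d : nat) : (d < T)%N -> dom m q d ->
  (\sum_(k < T) (d == m ^ 2 + k * q) = (q %| d - m ^ 2))%N.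
Proof.
move=> dT /and5P[m0 q0 md _ _].
case: (boolP (q %| d - m ^ 2)%N) => [/dvdnP[k kE]|nd]; last first.
  rewrite big1// => k _; case: eqP => // E; move: nd.
  by rewrite E addKn dvdn_mull.
have kT : (k < T)%N.
  by apply: leq_ltn_trans dT; apply: leq_trans (leq_subr (m ^ 2) d); rewrite kE leq_pmulr.
have dE : d = (m ^ 2 + k * q)%N by rewrite -kE subnKC// ltnW.
rewrite (bigD1 (Ordinal kT))//= {1}dE eqxx big1 ?addn0// => j jk.
rewrite dE eqn_add2l eqn_pmul2r// (_ : (_ == _) = false)//.
by apply/negbTE; apply: contra jk => /eqP E; apply/eqP/val_inj.
Qed.

(** In the backward direction the bounds by [sqrt x] come from [m^2 < d], [(q - m)^2 < d] and
    [d <= x]. *)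
Lemma W_summandE (R : realType) (x : R) (m1 m2 q1 q2 k1 k2 : nat) : 0 <= x ->
  [&& (0 < m1)%N, (0 < m2)%N, (m1%:R < Num.sqrt x)%R, (m2%:R < Num.sqrt x)%R,
       (0 < q1)%N, (0 < q2)%N,
       (q1%:R < Num.sqrt x + m1%:R)%R, (q2%:R < Num.sqrt x + m2%:R)%R,
       (0 < k1)%N, (0 < k2)%N,
       (`|(k1%:Z - q1%:Z)%R| < (2 * m1)%:Z)%R,
       (`|(k2%:Z - q2%:Z)%R| < (2 * m2)%:Z)%R,
       (m1 ^ 2 + k1 * q1 == m2 ^ 2 + k2 * q2)%N &
       ((m1 ^ 2 + k1 * q1)%N%:R <= x)%R] =
  [&& (m1 ^ 2 + k1 * q1 < (Num.truncn x).+1)%N, dom m1 q1 (m1 ^ 2 + k1 * q1),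
      dom m2 q2 (m1 ^ 2 + k1 * q1) & (m1 ^ 2 + k1 * q1 == m2 ^ 2 + k2 * q2)%N].
Proof.
move=> x0; rewrite ltnS truncn_ge_nat//.
apply/idP/idP.
  move=> /and5P[a1 a2 _ _ /and5P[a3 a4 _ _ /and5P[a5 a6 a7 a8 /andP[E Ex]]]].
  rewrite Ex E andbT/= {1}domE a1 a3 a5 a7/= (eqP E) domE a2 a4 a6 a8//.
move=> /and4P[Ex d1 d2 E]; rewrite E Ex.
have bnd m q d : dom m q d -> d%:R <= x -> m%:R < Num.sqrt x /\ q%:R < Num.sqrt x + m%:R.
  move=> /and5P[_ _ md _ qd] dx.
  have lts (a : nat) : (a ^ 2 < d)%N -> a%:R < Num.sqrt x.
    move=> ad; rewrite -(ger0_norm (ler0n R a)) -sqrtr_sqr ltr_sqrt.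
      by apply: lt_le_trans dx; rewrite -natrX ltr_nat.
    by apply: lt_le_trans dx; rewrite ltr0n; lia.
  split; first exact: lts.
  have := lts _ qd; rewrite -(ltrD2r m%:R); apply: le_lt_trans.
  by rewrite -natrD ler_nat; lia.
have [b1 b2] := bnd _ _ _ d1 Ex; have [b3 b4] := bnd _ _ _ d2 Ex.
move: d1; rewrite domE => /and4P[a1 a3 a5 ->].
move: d2; rewrite (eqP E) domE => /and4P[a2 a4 a6 ->].
by rewrite a1 a2 a3 a4 a5 a6 b1 b2 b3 b4.
Qed.

Lemma sum_support (V : nmodType) (A B : nat) (f : nat -> V) :
  (forall i, (A <= i)%N || (B <= i)%N -> f i = 0) ->
  \sum_(i < A) f i = \sum_(i < B) f i.
Proof.
move=> f0; have H (C D : nat) : (C <= D)%N -> (forall i, (C <= i)%N -> f i = 0) ->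
    \sum_(i < C) f i = \sum_(i < D) f i.
  move=> CD h; rewrite -!(big_mkord xpredT f) (big_cat_nat (leq0n C) CD)/=.
  by rewrite [X in _ + X]big_nat [X in _ + X]big1 ?addr0// => i /andP[/h].
case: (leqP A B) => AB; first by apply: H => // i Ai; apply: f0; rewrite Ai.
by apply/esym/H => [|i Bi]; [exact: ltnW|apply: f0; rewrite Bi orbT].
Qed.

Lemma WE (R : realType) (x : R) (n : nat) : 0 <= x ->
  let X := Num.truncn x in (X < n ^ 2)%N ->
  (W x)%:R = \sum_(d < X.+1) \sum_(m1 < n) \sum_(m2 < n) \sum_(q1 < 2 * n) \sum_(q2 < 2 * n)
     (dom m1 q1 d && dom m2 q2 d)%:R *
     ((q1 %| d - m1 ^ 2)%N%:R * (q2 %| d - m2 ^ 2)%N%:R) :> R.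
Proof.
move=> x0 X Xn; set T := X.+1.
pose G (d m1 m2 q1 q2 : nat) : nat := ((dom m1 q1 d && dom m2 q2 d) *
  ((q1 %| d - m1 ^ 2) * (q2 %| d - m2 ^ 2)))%N.
have -> : W x = (\sum_(d < T) \sum_(m1 < T) \sum_(m2 < T) \sum_(q1 < T) \sum_(q2 < T)
     G d m1 m2 q1 q2)%N.
  rewrite /W -/X -/T.
  rewrite [RHS]exchange_big/=; apply: eq_bigr => m1 _.
  rewrite [RHS]exchange_big/=; apply: eq_bigr => m2 _.
  rewrite [RHS]exchange_big/=; apply: eq_bigr => q1 _.
  rewrite [RHS]exchange_big/=; apply: eq_bigr => q2 _.
  under eq_bigr => k1 _ do under eq_bigr => k2 _ do rewrite W_summandE//.
  (* The common value [d] becomes a summation variable, after which the sums over [k1] and [k2]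
     collapse to divisibility indicators. *)
  transitivity (\sum_(k1 < T) \sum_(d < T) \sum_(k2 < T)
    (d == m1 ^ 2 + k1 * q1 :> nat) * ((dom m1 q1 d && dom m2 q2 d) *
      (d == m2 ^ 2 + k2 * q2 :> nat)))%N.
    apply: eq_bigr => k1 _; rewrite [RHS]exchange_big/=; apply: eq_bigr => k2 _.
    rewrite (sum_bool_pick T _ (fun d => (dom m1 q1 d && dom m2 q2 d) *
      (d == m2 ^ 2 + k2 * q2 :> nat))%N).
    by rewrite -/X; case: (_ < _)%N; case: (dom m1 _ _); case: (dom m2 _ _); case: (_ == _)%N.
  rewrite exchange_big/=; apply: eq_bigr => d _.
  rewrite /G; case: (boolP (dom m1 q1 d && dom m2 q2 d)) => [/andP[h1 h2]|_]; last first.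
    by rewrite mul0n big1// => k1 _; rewrite big1// => k2 _; rewrite muln0.
  rewrite mul1n -(sum_quotient (ltn_ord d) h1) -(sum_quotient (ltn_ord d) h2).
  by rewrite big_distrlr/=; apply: eq_bigr => k1 _; apply: eq_bigr => k2 _; rewrite mul1n.
rewrite natr_sum; apply: eq_bigr => d _.
(* The summand vanishes outside either system of ranges, so [T] may be exchanged for [n] and [2 n],
   whichever is larger. *)
have G0 m1 m2 q1 q2 : (n <= m1)%N || (T <= m1)%N || ((n <= m2)%N || (T <= m2)%N) ||
   ((2 * n <= q1)%N || (T <= q1)%N) || ((2 * n <= q2)%N || (T <= q2)%N) ->
   G d m1 m2 q1 q2 = 0%N.
  move=> h; rewrite /G.
  case: (boolP (dom m1 q1 d && dom m2 q2 d)) => //= /andP[h1 h2]; rewrite mul1n.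
  have dX : (d <= X)%N by rewrite -ltnS.
  have [a1 a2] := dom_lt h1 dX Xn; have [a3 a4] := dom_lt h2 dX Xn.
  have small m q : dom m q d -> (m < T)%N /\ ((q %| d - m ^ 2) -> (q < T))%N.
    move=> /and5P[m0 q0 md _ _]; split.
      by rewrite ltnS; apply: leq_trans dX; apply: leq_trans (ltnW md); rewrite -mulnn leq_pmulr.
    move=> /dvdn_leq; rewrite subn_gt0 => /(_ md) qd.
    by rewrite ltnS (leq_trans qd)// (leq_trans (leq_subr _ _)).
  have [a5 a6] := small _ _ h1; have [a7 a8] := small _ _ h2.
  case: (boolP (q1 %| d - m1 ^ 2)%N) => // /a6 b1.
  case: (boolP (q2 %| d - m2 ^ 2)%N) => // /a8 b2.
  by move: h; lia.
rewrite natr_sum (sum_support (B := n)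
  (f := fun m1 : nat => (\sum_(m2 < T) \sum_(q1 < T) \sum_(q2 < T) G d m1 m2 q1 q2)%N%:R)); last first.
  by move=> m1 h; do 3 (rewrite big1// => ? _); apply: G0; lia.
apply: eq_bigr => m1 _; rewrite natr_sum (sum_support (B := n)
  (f := fun m2 : nat => (\sum_(q1 < T) \sum_(q2 < T) G d m1 m2 q1 q2)%N%:R)); last first.
  by move=> m2 h; do 2 (rewrite big1// => ? _); apply: G0; lia.
apply: eq_bigr => m2 _; rewrite natr_sum (sum_support (B := (2 * n)%N)
  (f := fun q1 : nat => (\sum_(q2 < T) G d m1 m2 q1 q2)%N%:R)); last first.
  by move=> q1 h; rewrite big1// => ? _; apply: G0; lia.
apply: eq_bigr => q1 _; rewrite natr_sum (sum_support (B := (2 * n)%N)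
  (f := fun q2 : nat => (G d m1 m2 q1 q2)%:R)); last first.
  by move=> q2 h; rewrite G0//; lia.
by apply: eq_bigr => q2 _; rewrite /G !natrM.
Qed.

(** * Arithmetic of rho *)

(* If w | 2e, the sum of exp(2 i pi u e^2 / w) over the u prime to w is phi(w) [sgnw w e]. *)
Definition sgnw (R : realType) (w e : nat) : R :=
  if (w %% 4 == 2)%N && odd e then -1 else 1.

Lemma sum_totient_dvdn_lt (R : realType) (N g : nat) : (0 < g)%N -> (g < N)%N ->
  \sum_(w < N) (w %| g)%N%:R * (totient w)%:R = g%:R :> R.
Proof.
move=> g0 gN; rewrite -[in RHS](sum_totient_dvd g) natr_sum [RHS]big_mkcond/=.
rewrite (sum_support (B := g.+1) (f := fun w : nat => (w %| g)%N%:R * (totient w)%:R)).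
  by apply: eq_bigr => w _; case: (w %| g)%N; rewrite ?mul1r ?mul0r.
move=> i h; rewrite (_ : (i %| g)%N = false) ?mul0r//.
by apply/negP => /(dvdn_leq g0); lia.
Qed.

Lemma totient_double_odd (v : nat) : odd v -> totient (2 * v) = totient v.
Proof. by move=> ov; rewrite totient_coprime ?coprime2n// (@totient_prime 2)// mul1n. Qed.

(** The identity [sum of phi(w) over w | g = g] is twisted by a sign that detects [g | e^2]. For
    even [e] the condition is automatic because [2 e] divides [e^2]. For odd [e] the sign is [-1]
    exactly at the even divisors of [g], which cancel everything when [g] is even. *)
Lemma rho3_totient (R : realType) (n e q1 q2 : nat) : (0 < q2)%N -> (q2 < 2 * n)%N ->
  (rho3 e q1 q2)%:R = \sum_(w < 2 * n)
    (totient w)%:R * (w %| 2 * e)%N%:R * sgnw R w e * ((w %| q1)%N%:R * (w %| q2)%N%:R).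
Proof.
move=> q20 q2n; set g := gcdn (gcdn (2 * e) q1) q2.
have g0 : (0 < g)%N by rewrite gcdn_gt0 q20 orbT.
have gn : (g < 2 * n)%N by apply: leq_ltn_trans q2n; rewrite dvdn_leq// dvdn_gcdr.
have ge : (g %| 2 * e)%N by rewrite (dvdn_trans (dvdn_gcdl _ _) (dvdn_gcdl _ _)).
transitivity (\sum_(w < 2 * n) (w %| g)%N%:R * (totient w)%:R * sgnw R w e); last first.
  apply: eq_bigr => w _; rewrite /g !dvdn_gcd.
  case: (w %| 2 * e)%N; case: (w %| q1)%N; case: (w %| q2)%N;
    by rewrite /= ?(mul1r, mul0r, mulr0, mulr1).
rewrite /rho3 /rho -/g; case: (boolP (odd e)) => oe; last first.
  under eq_bigr => w _ do rewrite /sgnw (negbTE oe) andbF mulr1.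
  rewrite sum_totient_dvdn_lt// ifT// -mulnn.
  rewrite -[X in (_ %| X * _)%N](odd_double_half e) (negbTE oe) add0n -muln2 -mulnA.
  by rewrite dvdn_mull.
have w4 (w : nat) : (w %| g)%N -> (w %% 4 == 2)%N = (2 %| w)%N.
  move=> wg; have w2e := dvdn_trans wg ge.
  apply/idP/idP => [/eqP h|/dvdnP[v vE]].
    by rewrite (divn_eq w 4) h dvdn_addr// dvdn_mull.
  move: w2e; rewrite vE mulnC dvdn_pmul2l// => ve.
  have ov : odd v by have := dvdn_odd ve oe.
  by rewrite -(odd_double_half v) ov; apply/eqP; lia.
have E : \sum_(w < 2 * n) (w %| g)%N%:R * (totient w)%:R * sgnw R w e =
    g%:R - 2 * \sum_(w < n * 2) (2 %| w)%N%:R * ((w %| g)%N%:R * (totient w)%:R).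
  rewrite -(sum_totient_dvdn_lt R g0 gn) mulr_sumr mulnC -sumrB.
  apply: eq_bigr => w _; rewrite /sgnw oe andbT.
  case: (boolP (w %| g)%N) => [wg|_]; last by rewrite !(mul0r, mulr0) subrr.
  by rewrite w4//; case: (2 %| w)%N => /=; ring.
rewrite {}E (sum_multiples (fun w => (w %| g)%N%:R * (totient w)%:R))//.
(* An odd [g] dividing [2 e] divides [e]. Otherwise [g = 2 h] with [h] odd, and [phi(2 v) = phi(v)]
   makes the even divisors sum to [h], so the result is [g - 2 h = 0]; accordingly [g] cannot divide
   the odd number [e^2]. *)
case: (boolP (odd g)) => og.
  rewrite big1 ?mulr0 ?subr0 => [|v _].
    by rewrite ifT// -mulnn dvdn_mull// -(@Gauss_dvdr _ 2)// coprimen2.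
  rewrite (_ : (_ %| _)%N = false) ?mul0r//; apply/negP => h.
  have : (2 %| g)%N by apply: dvdn_trans h; rewrite dvdn_mull.
  by rewrite dvdn2 og.
have [h hE] : exists h, g = (2 * h)%N by exists g./2; rewrite -{1}(odd_double_half g) (negbTE og); lia.
have h0 : (0 < h)%N by lia.
have hn : (h < n)%N by lia.
have oh : odd h.
  by apply: dvdn_odd oe; rewrite -(@dvdn_pmul2l 2)// -hE.
rewrite (eq_bigr (fun v : 'I_n => (v %| h)%N%:R * (totient v)%:R)) => [|v _]; last first.
  rewrite hE mulnC dvdn_pmul2l//; case: (boolP (v %| h)%N) => [vh|_]; last by rewrite !mul0r.
  by rewrite totient_double_odd//; apply: dvdn_odd vh oh.
rewrite sum_totient_dvdn_lt// ifF; first by rewrite hE natrM subrr.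
apply/negbTE; rewrite hE; apply: contraL oe => k.
have : (2 %| e ^ 2)%N by apply: dvdn_trans k; rewrite dvdn_mulr.
by rewrite Euclid_dvdX// andbT dvdn2.
Qed.

Definition kappa (w : nat) : nat :=
  if odd w then 1 else if (w %% 4 == 2)%N then 0 else 2.

(** The dependence on [c = m1 + m2] of the term [w]. It has period [w]: the sign matters only for
    even [w], when the parity of [c] is determined modulo [w]. *)
Definition hw (R : realType) (w c : nat) : R := (w %| 2 * c)%N%:R * sgnw R w c.

Lemma hw_periodic (R : realType) (w c : nat) : hw R w (w + c) = hw R w c.
Proof.
rewrite /hw /sgnw oddD mulnDr dvdn_addr; last by rewrite dvdn_mull.
case: (boolP (w %% 4 == 2)%N) => //= /eqP h.
by rewrite (_ : odd w = false) ?addFb//; lia.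
Qed.

(** For odd [w] only [c = 0] survives. For [w = 2 v] the classes [0] and [v] do, and the sign at [v]
    is [-1] exactly when [v] is odd. *)
Lemma sum_hw (R : realType) (w : nat) : (0 < w)%N -> \sum_(c < w) hw R w c = (kappa w)%:R.
Proof.
move=> w0; rewrite /kappa; case: (boolP (odd w)) => ow.
  case: w w0 ow => // w _ ow; rewrite big_ord_recl big1 => [|c _].
    by rewrite /hw /sgnw andbF muln0 dvdn0 mul1r addr0.
  rewrite /hw Gauss_dvdr ?coprimen2// gtnNdvd ?mul0r//.
have [v vE] : exists v, w = (2 * v)%N by exists w./2; rewrite -{1}(odd_double_half w) (negbTE ow); lia.
have v0 : (0 < v)%N by lia.
have -> : \sum_(c < w) hw R w c = \sum_(c < 2 * v) (v %| c)%N%:R * sgnw R w c.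
  rewrite -[in RHS]vE; apply: eq_bigr => c _; congr (_%:R * _).
  by rewrite -(@dvdn_pmul2l 2 v c)// -vE.
rewrite (sum_multiples (sgnw R w))// !big_ord_recl big_ord0 /= addr0 mul0n mul1n.
rewrite /sgnw andbF; case: (boolP (w %% 4 == 2)%N) => /= h.
  by rewrite (_ : odd v) ?subrr//; lia.
by rewrite -mulr2n.
Qed.

Lemma sum_abs_hw (R : realType) (w : nat) : (0 < w)%N -> \sum_(c < w) `|hw R w c| <= 4.
Proof.
move=> w0; apply: le_trans (_ : \sum_(c < w) (w %| c * 2)%N%:R <= _).
  apply: ler_sum => c _; rewrite /hw normrM normr_nat mulnC /sgnw.
  by case: ifP; rewrite ?normrN normr1 mulr1.
apply: le_trans (sum_dvdn_le R 2 w0 (leqnn w)) _.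
have w0' : 0 < w%:R :> R by rewrite ltr0n.
rewrite mulrAC mulfK ?gt_eqF//.
have : (gcdn w 2 <= 2)%N by rewrite dvdn_leq// dvdn_gcdr.
rewrite -(ler_nat R); lra.
Qed.

Lemma sum_shift_periodic (V : zmodType) (F : nat -> V) (w b : nat) :
  (forall a, F (w + a)%N = F a) -> \sum_(i < w) F (b + i)%N = \sum_(i < w) F i.
Proof.
move=> Fw; elim: b => [//|b IH]; rewrite -[RHS]IH.
have : \sum_(i < w.+1) F (b + i)%N = \sum_(i < w) F (b + i)%N + F (b + w)%N.
  by rewrite big_ord_recr.
rewrite big_ord_recl/= addn0 [(b + w)%N]addnC Fw addrC => /addIr <-.
by apply: eq_bigr => i _; rewrite /bump/= add1n addnS addSn.
Qed.

Lemma sum_by_residue (R : pzSemiRingType) (n w : nat) (f L : nat -> R) : (0 < w)%N ->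
  \sum_(m < n) f (m %% w)%N * L m =
  \sum_(b < w) f b * \sum_(m < n) (m %% w == b)%N%:R * L m.
Proof.
move=> w0; under [RHS]eq_bigr => b _ do rewrite mulr_sumr.
rewrite [RHS]exchange_big/=; apply: eq_bigr => m _.
have mw : (m %% w < w)%N by rewrite ltn_pmod.
rewrite (bigD1 (Ordinal mw))//= eqxx mul1r big1 ?addr0// => b bm.
rewrite (_ : (_ == _) = false) ?mul0r ?mulr0//; apply/negbTE.
by apply: contra bm => /eqP E; apply/eqP/val_inj.
Qed.

(** * Sums over residue classes *)

(** Both sides are [ln(1 + t) <= t], for [t = 1 / j] and [t = - 1 / (j + 1)]. *)
Lemma ln_succ_sub (R : realType) (j : nat) : (0 < j)%N ->
  j.+1%:R^-1 <= ln (j.+1%:R : R) - ln j%:R <= j%:R^-1.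
Proof.
move=> j0; have j0' : 0 < j%:R :> R by rewrite ltr0n.
have j1' : 0 < j.+1%:R :> R by rewrite ltr0n.
have jE : j.+1%:R = j%:R + 1 :> R by rewrite natr1.
rewrite -ln_div ?posrE//; apply/andP; split; last first.
  rewrite (_ : _ / _ = 1 + j%:R^-1); last by rewrite jE; field; rewrite gt_eqF.
  by apply: le_ln1Dx; rewrite (lt_trans (ltrN10 _))// invr_gt0.
rewrite -lerN2 -lnV ?posrE ?divr_gt0// invf_div.
rewrite (_ : _ / _ = 1 + (- j.+1%:R^-1)); last by rewrite jE; field; rewrite gt_eqF// -jE.
apply: le_ln1Dx; rewrite ltrN2 invf_lt1// jE; lra.
Qed.

Lemma sum_inv_ln (R : realType) (u v : nat) : (u <= v)%N ->
  ln (v.+1%:R : R) - ln u.+1%:R <= \sum_(u <= j < v) j.+1%:R^-1 /\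
  ((0 < u)%N -> \sum_(u <= j < v) j.+1%:R^-1 <= ln (v%:R : R) - ln u%:R).
Proof.
move=> uv; split.
  rewrite -(telescope_sumr (fun j => ln (j.+1%:R : R)) uv); apply: ler_sum_nat => j _.
  by have /andP[] := ln_succ_sub R (ltn0Sn j).
move=> u0; rewrite -(telescope_sumr (fun j => ln (j%:R : R)) uv); apply: ler_sum_nat => j /andP[uj _].
by have /andP[] := ln_succ_sub R (leq_trans u0 uj).
Qed.

Lemma nat_lt_real (R : realType) (b : R) : 0 <= b ->
  exists D : nat, (forall m, (m < D)%N = (m%:R < b)) /\ b <= D%:R < b + 1.
Proof.
move=> b0; have exP : exists m : nat, b <= m%:R.
  by exists (Num.truncn b).+1; rewrite ltW// -truncn_lt_nat.
case: (ex_minnP exP) => D bD Dmin; exists D; split => [m|].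
  rewrite ltNge; apply/idP/idP => [mD|].
    by apply/negP => /Dmin; rewrite leqNgt mD.
  by rewrite -ltNge => mb; rewrite -(ltr_nat R) (lt_le_trans mb).
rewrite bD/=; case: D {bD} Dmin => [|D] Dmin; first lra.
rewrite -natr1 ltrD2r ltNge; apply/negP => /Dmin; by rewrite ltnn.
Qed.

(* [tent y 0 = 0] because [y / 0 = 0]. *)
Definition tent (R : realType) (y : R) (j : nat) : R :=
  Num.max 0 (Num.min 1 (y / j%:R - 1)).

Lemma ln2_le1 (R : realType) : 0 <= ln (2 : R) <= 1.
Proof.
rewrite ln_ge0 ?ler1n//=; have := @le_ln1Dx R 1; rewrite (_ : 1 + 1 = 2 :> R); last by [].
by apply; lra.
Qed.

(* Riemann sum of min(1, y/t - 1) over (0, y), whose integral is y ln 2. *)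
Lemma sum_tent (R : realType) (y : R) (J : nat) : 0 < y -> y <= J%:R ->
  `|\sum_(j < J) tent y j - y * ln 2| <= 5.
Proof.
move=> y0 yJ; have [D [DE /andP[yD Dy]]] := nat_lt_real (ltW y0).
pose u := Num.truncn (y / 2).
have y20 : 0 <= y / 2 by lra.
have uE m : (m <= u)%N = (m%:R <= y / 2) by rewrite /u truncn_ge_nat.
have uy : u%:R <= y / 2 by rewrite -uE.
have uy1 : y / 2 < u%:R + 1 by rewrite natr1 -truncn_lt_nat.
have D0 : (0 < D)%N by rewrite DE.
have uD : (u < D)%N by rewrite DE; lra.
have DJ : (D <= J)%N by rewrite leqNgt DE -leNgt.
have [v vE] : exists v, D = v.+1 by exists D.-1; rewrite prednK.
have uv : (u <= v)%N by rewrite -ltnS -vE.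
have vy : v%:R < y by rewrite -DE vE.
have yv : y <= v%:R + 1 by rewrite natr1 -vE.
(* The profile is [1] up to [u = floor(y / 2)], [y / j - 1] for larger [j] below [y], and [0]
   beyond. *)
have SE : \sum_(j < J) tent y j = u%:R + y * \sum_(u <= j < v) j.+1%:R^-1 - (v%:R - u%:R).
  rewrite -(big_mkord xpredT (tent y)) (big_cat_nat (leq0n D) DJ)/=.
  rewrite [X in _ + X]big_nat [X in _ + X]big1 => [|j /andP[Dj _]]; last first.
    rewrite /tent max_l// ge_min; apply/orP; right.
    have yj : y <= j%:R by apply: le_trans yD _; rewrite ler_nat.
    have j0 : 0 < j%:R :> R by apply: lt_le_trans yj.
    by rewrite subr_le0 ler_pdivrMr// mul1r.
  rewrite addr0 vE big_nat_recl//= [tent y 0]/tent invr0 mulr0 sub0r.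
  rewrite max_l ?add0r; last by rewrite ge_min lerN10 orbT.
  rewrite (big_cat_nat (leq0n u) uv)/= -addrA; congr (_ + _).
    rewrite (eq_big_nat _ _ (F2 := fun=> 1)) ?sumr_const_nat ?subn0// => j /andP[_ ju].
    rewrite /tent min_l ?max_r// lerBrDr ler_pdivlMr ?ltr0n//.
    by move: ju; rewrite uE; lra.
  rewrite (_ : v%:R - u%:R = \sum_(u <= j < v) 1); last by rewrite sumr_const_nat natrB.
  rewrite mulr_sumr -sumrB.
  apply: eq_big_nat => j /andP[uj jv].
  have jy : j.+1%:R < y by rewrite -DE vE.
  have jy2 : y / 2 < j.+1%:R by rewrite ltNge -uE -ltnNge.
  have j0 : 0 < j.+1%:R :> R by rewrite ltr0n.
  rewrite /tent min_r ?max_r// ?subr_ge0 ?lerBlDr ?ler_pdivlMr ?ler_pdivrMr//; lra.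
have [lnlo lnhi] := sum_inv_ln R uv.
have /andP[l20 l21] := ln2_le1 R.
set S := \sum_(u <= j < v) _ in lnlo lnhi SE.
have v1 : 0 < v.+1%:R :> R by rewrite ltr0n.
have u1 : 0 < u.+1%:R :> R by rewrite ltr0n.
have lo : y * ln 2 - 2 <= y * S.
  have : y * (ln 2 - 2 / y) <= y * S.
    rewrite ler_wpM2l ?(ltW y0)//; apply: le_trans lnlo.
    rewrite -ln_div ?posrE// lerBlDr.
    have h2y : 0 < 2 / y by rewrite divr_gt0.
    have : ln (1 + 2 / y) <= 2 / y by apply: le_ln1Dx; lra.
    rewrite -(lerD2l (ln (v.+1%:R / u.+1%:R))); apply: le_trans.
    rewrite -lnM ?posrE ?divr_gt0//; last by lra.
    rewrite ler_ln ?posrE ?mulr_gt0 ?divr_gt0 ?invr_gt0//; try lra.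
    rewrite mulrAC ler_pdivlMr// -[v.+1%:R]natr1 -[u.+1%:R]natr1.
    have : (y / 2 + 1) * 2 = y * (1 + 2 / y) by field; rewrite gt_eqF.
    have : (y * (1 + 2 / y) <= (v%:R + 1) * (1 + 2 / y)) by rewrite ler_wpM2r//; lra.
    lra.
  by rewrite mulrBr mulrCA divff ?gt_eqF// mulr1.
rewrite SE ler_norml; apply/andP; split; first lra.
(* The logarithmic upper bound needs [u > 0]. For small [y] each term is at most [1], which is
   enough. *)
case: (lerP y 4) => y4.
  have S1 : y * S <= 2 * (v%:R - u%:R).
    rewrite -natrB// [leRHS]mulrC mulr_natl -(sumr_const_nat v u) mulr_sumr.
    apply: ler_sum_nat => j /andP[uj _].
    have jy2 : y / 2 < j.+1%:R by rewrite ltNge -uE -ltnNge.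
    by rewrite ler_pdivrMr ?ltr0n//; lra.
  have : 0 <= y * ln 2 by rewrite mulr_ge0// ltW.
  lra.
have u0 : (0 < u)%N by rewrite uE; lra.
have hi := lnhi u0.
have v0 : 0 < v%:R :> R by rewrite ltr0n (leq_trans u0).
have u0' : 0 < u%:R :> R by rewrite ltr0n.
have : y * S <= y * (ln 2 + 2 / (y - 2)).
  rewrite ler_wpM2l ?(ltW y0)//; apply: le_trans hi _.
  have h : 0 < 2 / (y - 2) by rewrite divr_gt0//; lra.
  have : ln (1 + 2 / (y - 2)) <= 2 / (y - 2) by apply: le_ln1Dx; lra.
  rewrite -(lerD2l (ln 2)); apply: le_trans.
  rewrite -ln_div ?posrE// -lnM ?posrE//; last lra.
  rewrite ler_ln ?posrE ?mulr_gt0 ?divr_gt0 ?invr_gt0//; try lra.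
  rewrite ler_pdivrMr//.
  have -> : 2 * (1 + 2 / (y - 2)) = y / (y / 2 - 1) by field; rewrite !gt_eqF//; lra.
  apply: le_trans (ltW vy) _; rewrite mulrAC ler_pdivlMr; last lra.
  by rewrite ler_wpM2l ?(ltW y0)//; lra.
have : y * (2 / (y - 2)) <= 4 by rewrite mulrA ler_pdivrMr; lra.
lra.
Qed.

Lemma count_residue (w b N : nat) : (b < w)%N ->
  (\sum_(0 <= m < N) (m %% w == b) = (N + (w.-1 - b)) %/ w)%N.
Proof.
move=> bw; have w0 : (0 < w)%N by apply: leq_trans bw.
elim: N => [|N IH]; first by rewrite big_geq// add0n divn_small//; lia.
rewrite big_nat_recr//= IH addSn divnS// addnC; congr (_ + _)%N.
have E : (N + (w.-1 - b)).+1 = (N + (w - b))%N by lia.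
rewrite E; congr nat_of_bool; apply/idP/idP => [/eqP h|].
  rewrite (divn_eq N w) h -addnA subnKC ?(ltnW bw)// dvdn_addr ?dvdnn//.
  by rewrite dvdn_mull.
move=> h; have : (N + (w - b) == 0 %[mod w])%N by rewrite mod0n.
rewrite -(eqn_modDr b) -addnA subnK ?(ltnW bw)// modnDr add0n.
by rewrite (modn_small bw).
Qed.

Lemma count_interval_residue (R : realType) (w b C D : nat) :
  (b < w)%N -> (C <= D)%N ->
  `|\sum_(C <= m < D) (m %% w == b)%N%:R - (D%:R - C%:R) / w%:R| <= 1 :> R.
Proof.
move=> bw CD; have w0 : (0 < w)%N by apply: leq_trans bw.
have w0' : 0 < w%:R :> R by rewrite ltr0n.
have E : \sum_(C <= m < D) (m %% w == b)%N%:R =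
   ((D + (w.-1 - b)) %/ w)%N%:R - ((C + (w.-1 - b)) %/ w)%N%:R :> R.
  rewrite -!count_residue// !natr_sum.
  by rewrite (big_cat_nat (leq0n C) CD)/= addrAC subrr add0r.
rewrite E; set c := (w.-1 - b)%N.
have hD := divn_eq (D + c) w; have hC := divn_eq (C + c) w.
have hD' := ltn_pmod (D + c) w0; have hC' := ltn_pmod (C + c) w0.
move: (_ %/ w)%N (_ %% w)%N hD hD' (_ %/ w)%N (_ %% w)%N hC hC' => x r hD hr y t hC ht.
have -> : D%:R - C%:R = (x%:R - y%:R) * w%:R + (r%:R - t%:R) :> R.
  have : (D + c)%N%:R = x%:R * w%:R + r%:R :> R by rewrite hD natrD natrM.
  have : (C + c)%N%:R = y%:R * w%:R + t%:R :> R by rewrite hC natrD natrM.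
  by rewrite !natrD; lra.
rewrite mulrDl mulfK ?gt_eqF// opprD addNKr normrN normrM normfV (gtr0_norm w0').
rewrite ler_pdivrMr// mul1r ler_norml.
have : r%:R <= w%:R :> R by rewrite ler_nat ltnW.
have : t%:R <= w%:R :> R by rewrite ler_nat ltnW.
have := ler0n R r; have := ler0n R t; lra.
Qed.

(** Length of the interval from [|q - s|] to [s] to which [dom] confines [m] when [s = sqrt d]. *)
Definition gap (R : realType) (s : R) (q : nat) : R := Num.max 0 (s - `|q%:R - s|).

Lemma dom_real (R : realType) (m q d : nat) : (0 < q)%N ->
  dom m q d = (`|q%:R - Num.sqrt (d%:R : R)| < m%:R) && (m%:R < Num.sqrt (d%:R : R)).
Proof.
move=> q0; set s := Num.sqrt _.
have s0 : 0 <= s by exact: sqrtr_ge0.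
have lts (a : nat) : (a ^ 2 < d)%N = (a%:R < s).
  rewrite -(ger0_norm (ler0n R a)) -sqrtr_sqr -natrX.
  case: (posnP d) => [d0|d0]; last by rewrite ltr_sqrt ?ltr_nat// ltr0n.
  by rewrite /s d0 ltn0 sqrtr0 ltNge sqrtr_ge0.
have slt (a : nat) : (d < a ^ 2)%N = (s < a%:R).
  rewrite -(ger0_norm (ler0n R a)) -sqrtr_sqr -natrX.
  case: (posnP a) => [->|a0]; last by rewrite ltr_sqrt ?ltr_nat// ltr0n expn_gt0 a0.
  by rewrite sqrtr0 ltNge s0.
rewrite /dom q0 !lts slt/= ltr_norml natrD.
apply/idP/idP.
  move=> /and4P[m0 ms sqm qms]; rewrite ms andbT; apply/andP; split; first lra.
  case: (leqP q m) => qm.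
    have : q%:R <= m%:R :> R by rewrite ler_nat.
    have : 0 < m%:R :> R by rewrite ltr0n.
    lra.
  by move: qms; rewrite natrB 1?ltnW//; lra.
move=> /andP[/andP[h1 h2] ms].
have m0 : 0 < m%:R :> R by lra.
rewrite -(ltr0n R) m0 ms/=; apply/andP; split; first lra.
case: (leqP q m) => qm; last by rewrite natrB 1?ltnW//; lra.
have -> : (q - m)%N = 0%N by lia.
lra.
Qed.

(** The length is [q] up to [s] and [2 s - q] from there to [2 s], so division by [q] gives the
    profile whose mass is [2 s ln 2]. *)
Lemma tent_gap (R : realType) (s : R) (q : nat) : 0 <= s ->
  q%:R^-1 * gap s q = tent (2 * s) q.
Proof.
move=> s0; rewrite /gap /tent; case: (posnP q) => [->|q0].
  by rewrite invr0 mul0r mulr0 sub0r max_l// ge_min lerN10 orbT.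
have q0' : 0 < q%:R :> R by rewrite ltr0n.
rewrite maxr_pMr ?invr_ge0// mulr0; congr Num.max.
have [qs|/negbTE/negbT] := boolP (q%:R <= s); last rewrite -ltNge => qs.
  rewrite ler0_norm ?subr_le0// opprB opprB addrC subrK mulVf ?gt_eqF// min_l//.
  by rewrite lerBrDr ler_pdivlMr//; lra.
rewrite gtr0_norm ?subr_gt0// min_r; first by field; rewrite gt_eqF.
by rewrite lerBlDr ler_pdivrMr//; lra.
Qed.

Lemma tent_mul (R : realType) (y : R) (w j : nat) : tent y (j * w) = tent (y / w%:R) j.
Proof. by rewrite /tent natrM invfM mulrA mulrAC. Qed.

(** An error of [1] comes from counting a residue class, another from rounding the end points of the
    interval. *)
Lemma count_dom (R : realType) (n w b q d : nat) :
  (b < w)%N -> (0 < q)%N -> (d < n ^ 2)%N ->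
  `|\sum_(m < n) (m %% w == b)%N%:R * (dom m q d)%:R - gap (Num.sqrt d%:R) q / w%:R| <= 2 :> R.
Proof.
move=> bw q0 dn; set s := Num.sqrt _.
have w0 : (0 < w)%N by apply: leq_trans bw.
have w0' : 0 < w%:R :> R by rewrite ltr0n.
have w1 : 1 <= w%:R :> R by rewrite ler1n.
have s0 : 0 <= s by exact: sqrtr_ge0.
set a := `|q%:R - s|; have a0 : 0 <= a by exact: normr_ge0.
have [D [DE /andP[sD Ds]]] := nat_lt_real s0.
pose C := (Num.truncn a).+1.
have CE m : (C <= m)%N = (a < m%:R) by rewrite /C -truncn_lt_nat.
have aC : a < C%:R by rewrite -CE.
have Ca : C%:R <= a + 1 by rewrite -natr1 lerD2r -truncn_ge_nat.
have Dn : (D <= n)%N.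
  rewrite leqNgt DE -leNgt /s -(ger0_norm (ler0n R n)) -sqrtr_sqr ler_sqrt//.
  by rewrite -natrX ler_nat ltnW.
have -> : \sum_(m < n) (m %% w == b)%N%:R * (dom m q d)%:R =
    \sum_(C <= m < D) (m %% w == b)%N%:R :> R.
  rewrite (sum_interval _ _ Dn); apply: eq_bigr => m _.
  by rewrite CE DE (dom_real R)// mulrC.
case: (leqP C D) => CD; last first.
  rewrite sum_nat_empty 1?ltnW// /gap -/a max_l ?mul0r ?subrr ?normr0//.
  have : D%:R <= a by move: CD; rewrite ltnS truncn_ge_nat.
  lra.
have h := count_interval_residue R bw CD.
rewrite (_ : _ - _ = (\sum_(C <= m < D) (m %% w == b)%N%:R - (D%:R - C%:R) / w%:R) +
   ((D%:R - C%:R - gap s q) / w%:R)); last by field; rewrite gt_eqF.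
apply: le_trans (ler_normD _ _) _.
have CD' : C%:R <= D%:R :> R by rewrite ler_nat.
have : `|(D%:R - C%:R - gap s q) / w%:R| <= 1.
  rewrite normrM normfV (gtr0_norm w0') ler_pdivrMr// mul1r.
  apply: le_trans w1; rewrite /gap -/a ler_norml /Num.max.
  case: ifP => [_|/negbT]; first by apply/andP; split; lra.
  by rewrite -leNgt => h0; apply/andP; split; lra.
lra.
Qed.

Definition resum (R : realType) (n w d b : nat) : R :=
  \sum_(m < n) (m %% w == b)%N%:R *
    \sum_(q < 2 * n) (dom m q d)%:R * ((w %| q)%N%:R * q%:R^-1).

(** One factor [1 / w] comes from the residue class of [m], the other from [q = j w], which rescales
    the profile to [2 s / w]. The constant is [7 = 2 + 5], from [count_dom] and [sum_tent]. *)
Lemma resum_approx (R : realType) (n w d b : nat) :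
  (0 < d)%N -> (b < w)%N -> (d < n ^ 2)%N ->
  `|resum R n w d b - 2 * Num.sqrt d%:R * ln 2 / w%:R ^+ 2| <= 7 * harm R (2 * n) / w%:R.
Proof.
move=> d0 bw dn; set s := Num.sqrt _; set l := harm _ _.
have w0 : (0 < w)%N by apply: leq_trans bw.
have w0' : 0 < w%:R :> R by rewrite ltr0n.
have n0 : (0 < n)%N by move: dn; case: (posnP n) => [->|].
have s0 : 0 < s by rewrite sqrtr_gt0 ltr0n.
have sn : s <= n%:R.
  by rewrite /s -(ger0_norm (ler0n R n)) -sqrtr_sqr ler_sqrt// -natrX ler_nat ltnW.
have l1 : 1 <= l by apply: harm_ge1; lia.
pose N q : R := \sum_(m < n) (m %% w == b)%N%:R * (dom m q d)%:R.
have E1 : resum R n w d b = \sum_(q < 2 * n) (w %| q)%N%:R * q%:R^-1 * N q.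
  rewrite /resum; under eq_bigr => m _ do rewrite mulr_sumr.
  rewrite exchange_big/=; apply: eq_bigr => q _; rewrite /N mulr_sumr.
  by apply: eq_bigr => m _; ring.
have E2 : \sum_(q < 2 * n) (w %| q)%N%:R * q%:R^-1 * (gap s q / w%:R) =
    w%:R^-1 * \sum_(j < 2 * n) tent (2 * s / w%:R) j.
  transitivity (w%:R^-1 * \sum_(q < 2 * n) (w %| q)%N%:R * tent (2 * s) q).
    by rewrite mulr_sumr; apply: eq_bigr => q _; rewrite -tent_gap ?ltW//; ring.
  congr (_ * _); under [RHS]eq_bigr => j _ do rewrite -tent_mul.
  rewrite -(sum_multiples (tent (2 * s)) (2 * n) w0).
  apply: (sum_support (f := fun q => (w %| q)%N%:R * tent (2 * s) q)) => q h.
  have nq : (2 * n <= q)%N.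
    by case/orP: h => // h; apply: leq_trans h; rewrite leq_pmulr.
  rewrite /tent max_l ?mulr0// ge_min; apply/orP; right.
  have nq' : 2 * n%:R <= q%:R :> R by rewrite -natrM ler_nat.
  have q0 : 0 < q%:R :> R by apply: lt_le_trans nq'; rewrite mulr_gt0 ?ltr0n.
  by rewrite subr_le0 ler_pdivrMr//; lra.
set y := 2 * s / w%:R in E2.
have y0 : 0 < y by rewrite divr_gt0 ?mulr_gt0.
have yn : y <= (2 * n)%:R.
  rewrite /y ler_pdivrMr// natrM; apply: le_trans (_ : 2 * n%:R * 1 <= _).
    by rewrite mulr1 ler_wpM2l.
  by rewrite ler_wpM2l ?ler1n.
have T := sum_tent y0 yn.
rewrite E1 (_ : _ - _ = (\sum_(q < 2 * n) (w %| q)%N%:R * q%:R^-1 * (N q - gap s q / w%:R)) +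
   w%:R^-1 * (\sum_(j < 2 * n) tent y j - y * ln 2)); last first.
  under [X in _ = X + _]eq_bigr => q _ do rewrite mulrBr.
  by rewrite sumrB E2 /y; field; rewrite gt_eqF.
apply: le_trans (ler_normD _ _) _.
have h1 : `|w%:R^-1 * (\sum_(j < 2 * n) tent y j - y * ln 2)| <= w%:R^-1 * 5.
  by rewrite normrM gtr0_norm ?invr_gt0// ler_wpM2l ?invr_ge0.
have h2 : `|\sum_(q < 2 * n) (w %| q)%N%:R * q%:R^-1 * (N q - gap s q / w%:R)| <=
    w%:R^-1 * l * 2.
  apply: le_trans (ler_norm_sum _ _ _) _.
  apply: le_trans (_ : \sum_(q < 2 * n) (w %| q)%N%:R * q%:R^-1 * 2 <= _).
    apply: ler_sum => q _; rewrite normrM ger0_norm ?mulr_ge0 ?invr_ge0//.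
    case: (posnP q) => [->|q0]; first by rewrite invr0 mulr0 !mul0r.
    by rewrite ler_wpM2l ?mulr_ge0 ?invr_ge0//; exact: count_dom.
  by rewrite -mulr_suml ler_wpM2r//; exact: sum_inv_multiples_le.
apply: le_trans (lerD h2 h1) _.
rewrite (_ : _ + _ = (l * 2 + 5) / w%:R); last ring.
by rewrite ler_wpM2r ?invr_ge0//; lra.
Qed.

Lemma hw_modn (R : realType) (w c : nat) : hw R w (c %% w) = hw R w c.
Proof.
rewrite [in RHS](divn_eq c w) addnC; elim: (c %/ w)%N => [|t IH]; first by rewrite mul0n addn0.
by rewrite IH mulSn addnCA hw_periodic.
Qed.

Lemma near_product (R : realType) (a E x y : R) : 0 <= a -> 0 <= E ->
  `|x - a| <= E -> `|y - a| <= E -> `|x * y - a ^+ 2| <= E * (2 * a + E).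
Proof.
move=> a0 E0 hx hy.
rewrite (_ : _ - _ = (x - a) * (y - a) + (x - a) * a + (y - a) * a); last ring.
apply: le_trans (ler_normD _ _) _; apply: le_trans (lerD (ler_normD _ _) (lexx _)) _.
rewrite !normrM (ger0_norm a0).
have := ler_pM (normr_ge0 _) (normr_ge0 _) hx hy.
have := ler_wpM2r a0 hx; have := ler_wpM2r a0 hy; lra.
Qed.

Section Modulus.
Context (R : realType) (n w d : nat).
Hypotheses (w0 : (0 < w)%N) (d0 : (0 < d)%N) (dn : (d < n ^ 2)%N).

Let L (m : nat) : R := \sum_(q < 2 * n) (dom m q d)%:R * ((w %| q)%N%:R * q%:R^-1).
Let s : R := Num.sqrt d%:R.
Let l : R := harm R (2 * n).

Lemma sum_hw_residues :
  \sum_(m1 < n) \sum_(m2 < n) hw R w (m1 + m2) * (L m1 * L m2) =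
  \sum_(b < w) \sum_(c < w) hw R w (b + c) * (resum R n w d b * resum R n w d c).
Proof.
transitivity (\sum_(m1 < n) (fun b => \sum_(m2 < n) (hw R w (b + m2 %% w) * L m2))
    (m1 %% w)%N * L m1).
  apply: eq_bigr => m1 _; rewrite mulr_suml; apply: eq_bigr => m2 _.
  by rewrite -hw_modn -[in RHS]hw_modn modnDm; ring.
rewrite (sum_by_residue _ (fun b => \sum_(m2 < n) (hw R w (b + m2 %% w) * L m2)) L w0).
apply: eq_bigr => b _; rewrite (sum_by_residue _ (fun c => hw R w (b + c)) L w0).
by rewrite mulr_suml; apply: eq_bigr => c _; rewrite /resum; ring.
Qed.

(** Replacing both [resum] factors by their main term [a] makes the sum over [c] equal to [kappa(w)]
    for every [b]. This gives [w kappa(w) a^2], which is the stated main term since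
    [a = 2 s ln 2 / w^2]. *)
Lemma sum_hw_approx :
  `|\sum_(m1 < n) \sum_(m2 < n) hw R w (m1 + m2) * (L m1 * L m2) -
    4 * d%:R * ln 2 ^+ 2 * ((kappa w)%:R / w%:R ^+ 3)| <=
  112 * n%:R * l / w%:R ^+ 2 + 196 * l ^+ 2 / w%:R.
Proof.
have w0' : 0 < w%:R :> R by rewrite ltr0n.
have wn0 : w%:R != 0 :> R by rewrite gt_eqF.
set a : R := 2 * s * ln 2 / w%:R ^+ 2; set E : R := 7 * l / w%:R.
have /andP[l20 l21] := ln2_le1 R.
have s0 : 0 <= s by exact: sqrtr_ge0.
have l0 : 0 <= l by exact: harm_ge0.
have sn : s <= n%:R.
  by rewrite /s -(ger0_norm (ler0n R n)) -sqrtr_sqr ler_sqrt// -natrX ler_nat ltnW.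
have a0 : 0 <= a by rewrite divr_ge0 ?exprn_ge0 ?mulr_ge0.
have E0 : 0 <= E by rewrite divr_ge0 ?mulr_ge0.
have main : 4 * d%:R * ln 2 ^+ 2 * ((kappa w)%:R / w%:R ^+ 3) =
    \sum_(b < w) \sum_(c < w) hw R w (b + c) * a ^+ 2.
  rewrite (eq_bigr (fun=> (kappa w)%:R * a ^+ 2)) => [|b _].
    rewrite sumr_const card_ord -[RHS]mulr_natr /a.
    have sd : s ^+ 2 = d%:R by rewrite sqr_sqrtr.
    by rewrite -sd; field.
  by rewrite -mulr_suml (sum_shift_periodic (F := hw R w)) ?sum_hw//; exact: hw_periodic.
rewrite sum_hw_residues main -sumrB.
apply: le_trans (ler_norm_sum _ _ _) _.
apply: le_trans (_ : \sum_(b < w) 4 * (E * (2 * a + E)) <= _).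
  apply: ler_sum => b _; rewrite -sumrB; apply: le_trans (ler_norm_sum _ _ _) _.
  apply: le_trans (_ : \sum_(c < w) `|hw R w (b + c)| * (E * (2 * a + E)) <= _).
    apply: ler_sum => c _; rewrite -mulrBr normrM ler_wpM2l//.
    by apply: near_product => //; exact: resum_approx.
  rewrite -mulr_suml ler_wpM2r ?mulr_ge0 ?addr_ge0 ?mulr_ge0//.
  rewrite (sum_shift_periodic (F := fun c => `|hw R w c|)) ?sum_abs_hw// => c.
  by rewrite hw_periodic.
rewrite sumr_const card_ord -[leLHS]mulr_natr.
have aE : a <= 2 * n%:R / w%:R ^+ 2.
  rewrite /a ler_wpM2r ?invr_ge0 ?exprn_ge0// -mulrA ler_wpM2l//.
  by rewrite -[leRHS]mulr1 ler_pM.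
apply: le_trans (_ : 4 * (E * (2 * (2 * n%:R / w%:R ^+ 2) + E)) * w%:R <= _).
  by rewrite ler_wpM2r// ler_wpM2l// ler_wpM2l// lerD2r ler_wpM2l.
by rewrite le_eqVlt; apply/orP; left; apply/eqP; rewrite /E; field.
Qed.

End Modulus.

Definition sigma_part (R : realType) (N : nat) : R :=
  \sum_(w < N) (totient w)%:R * ((kappa w)%:R / w%:R ^+ 3).

Lemma leq_totient (w : nat) : (totient w <= w)%N.
Proof.
case: w => // w; rewrite totient_count_coprime big_mkord.
by apply: leq_trans (leq_sum _ (fun i _ => leq_b1 _)) _; rewrite sum1_card card_ord.
Qed.

Lemma rho3_sum_approx (R : realType) (n d : nat) : (d < n ^ 2)%N ->
  `|\sum_(m1 < n) \sum_(m2 < n) \sum_(q1 < 2 * n) \sum_(q2 < 2 * n)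
     (dom m1 q1 d && dom m2 q2 d)%:R * ((rho3 (m1 + m2) q1 q2)%:R / (q1%:R * q2%:R)) -
    4 * d%:R * ln 2 ^+ 2 * sigma_part R (2 * n)| <=
  504 * n%:R * harm R (2 * n) ^+ 2.
Proof.
move=> dn; set l := harm R _; have l0 : 0 <= l by exact: harm_ge0.
case: (posnP d) => [d0|d0].
  rewrite d0 mulr0 !mul0r subr0 big1 => [|m1 _].
    by rewrite normr0; apply: mulr_ge0; [apply: mulr_ge0; exact: ler0n|exact: exprn_ge0].
  do 3 (rewrite big1// => ? _).
  by rewrite /dom !ltn0 !andbF mul0r.
pose L w (m : nat) : R := \sum_(q < 2 * n) (dom m q d)%:R * ((w %| q)%N%:R * q%:R^-1).
have -> : \sum_(m1 < n) \sum_(m2 < n) \sum_(q1 < 2 * n) \sum_(q2 < 2 * n)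
     (dom m1 q1 d && dom m2 q2 d)%:R * ((rho3 (m1 + m2) q1 q2)%:R / (q1%:R * q2%:R)) =
  \sum_(w < 2 * n) (totient w)%:R *
     \sum_(m1 < n) \sum_(m2 < n) hw R w (m1 + m2) * (L w m1 * L w m2).
  under [RHS]eq_bigr => w _ do rewrite mulr_sumr.
  rewrite [RHS]exchange_big/=; apply: eq_bigr => m1 _.
  under [RHS]eq_bigr => w _ do rewrite mulr_sumr.
  rewrite [RHS]exchange_big/=; apply: eq_bigr => m2 _.
  transitivity (\sum_(q1 < 2 * n) \sum_(w < 2 * n) \sum_(q2 < 2 * n)
     (totient w)%:R * (hw R w (m1 + m2) *
       ((dom m1 q1 d)%:R * ((w %| q1)%N%:R * q1%:R^-1) *
        ((dom m2 q2 d)%:R * ((w %| q2)%N%:R * q2%:R^-1))))).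
    apply: eq_bigr => q1 _; rewrite [RHS]exchange_big/=; apply: eq_bigr => q2 _.
    case: (boolP (dom m1 q1 d)) => h1; last first.
      by rewrite mul0r big1// => w _; rewrite !mul0r !mulr0.
    case: (boolP (dom m2 q2 d)) => h2; last first.
      by rewrite mul0r big1// => w _; rewrite !mul0r !mulr0.
    have q20 : (0 < q2)%N by case/and5P: h2.
    rewrite mul1r (rho3_totient R _ _ q20 (ltn_ord q2)) mulr_suml.
    by apply: eq_bigr => w _; rewrite /hw invfM !mul1r; ring.
  rewrite exchange_big/=; apply: eq_bigr => w _.
  rewrite /L big_distrlr/= !mulr_sumr; apply: eq_bigr => q1 _.
  by rewrite !mulr_sumr.
rewrite /sigma_part mulr_sumr -sumrB; apply: le_trans (ler_norm_sum _ _ _) _.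
(* The weight satisfies [phi(w) <= w]. Summing over [w < 2 n] gives [112 + 2 * 196 = 504]. *)
apply: le_trans (_ : \sum_(w < 2 * n) (112 * n%:R * l * w%:R^-1 + 196 * l ^+ 2) <= _).
  apply: ler_sum => w _; case: (posnP w) => [->|w0].
    by rewrite !mul0r mulr0 subrr normr0 invr0 mulr0 add0r mulr_ge0 ?exprn_ge0.
  rewrite [X in _ - X]mulrCA -mulrBr normrM normr_nat.
  apply: le_trans (_ : w%:R * (112 * n%:R * l / w%:R ^+ 2 + 196 * l ^+ 2 / w%:R) <= _).
    by apply: ler_pM; rewrite ?ler_nat ?leq_totient//; apply: sum_hw_approx.
  rewrite le_eqVlt; apply/orP; left; apply/eqP; field.
  by rewrite pnatr_eq0 -lt0n.
rewrite big_split/= sumr_const card_ord -mulr_sumr -[X in _ + X <= _]mulr_natr.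
have nl0 : 0 <= 112 * n%:R * l by rewrite !mulr_ge0.
have := ler_wpM2l nl0 (sum_inv_le_harm R (2 * n)); rewrite -/l natrM.
set t := _ * \sum_(_ < _) _; move: t (n%:R : R) => t x; lra.
Qed.

Lemma sum_natr_id (R : realType) (X : nat) :
  \sum_(d < X.+1) d%:R = X%:R * (X%:R + 1) / 2 :> R.
Proof.
elim: X => [|X IH]; first by rewrite big_ord_recl big_ord0 /= addr0 mul0r mul0r.
by rewrite big_ord_recr/= IH -[X.+1%:R]natr1; field.
Qed.

Lemma rho3_total_approx (R : realType) (X n : nat) : (X < n ^ 2)%N ->
  `|\sum_(d < X.+1) \sum_(m1 < n) \sum_(m2 < n) \sum_(q1 < 2 * n) \sum_(q2 < 2 * n)
     (dom m1 q1 d && dom m2 q2 d)%:R * ((rho3 (m1 + m2) q1 q2)%:R / (q1%:R * q2%:R)) -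
    2 * (X%:R * (X%:R + 1)) * ln 2 ^+ 2 * sigma_part R (2 * n)| <=
  504 * n%:R ^+ 3 * harm R (2 * n) ^+ 2.
Proof.
move=> Xn; have -> : 2 * (X%:R * (X%:R + 1)) * ln 2 ^+ 2 * sigma_part R (2 * n) =
  \sum_(d < X.+1) 4 * d%:R * ln 2 ^+ 2 * sigma_part R (2 * n) :> R.
  by rewrite -!mulr_suml -mulr_sumr sum_natr_id; field.
rewrite -sumrB; apply: le_trans (ler_norm_sum _ _ _) _.
apply: le_trans (_ : \sum_(d < X.+1) 504 * n%:R * harm R (2 * n) ^+ 2 <= _).
  apply: ler_sum => d _; apply: rho3_sum_approx.
  by apply: leq_trans Xn; rewrite ltn_ord.
rewrite sumr_const card_ord -[leLHS]mulr_natr.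
apply: le_trans (_ : 504 * n%:R * harm R (2 * n) ^+ 2 * (n ^ 2)%:R <= _).
  apply: ler_wpM2l; last by rewrite ler_nat.
  by apply: mulr_ge0; [apply: mulr_ge0; exact: ler0n|apply: exprn_ge0; exact: harm_ge0].
by rewrite natrX le_eqVlt; apply/orP; left; apply/eqP; ring.
Qed.

(** * The singular series *)

(** For [s > 0] the index [0] contributes [0], by the convention on inverses. *)
Definition zpart (R : realType) (s N : nat) : R := \sum_(k < N) k%:R ^- s.

(** Comparison with the telescoping series of [1 / (k (k + 1))]. *)
Lemma zpart_tail (R : realType) (s N M : nat) : (1 < s)%N -> (0 < N)%N -> (N <= M)%N ->
  \sum_(N <= k < M) k.+1%:R ^- s <= N%:R^-1 :> R.
Proof.
move=> s1 N0 NM; apply: le_trans (_ : N%:R^-1 - M%:R^-1 <= _); last by rewrite gerBl invr_ge0.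
rewrite -[leRHS]opprB -(telescope_sumr (fun k => k%:R^-1 : R) NM) -sumrN.
apply: ler_sum_nat => k /andP[Nk _]; rewrite opprB.
have k0 : 0 < k%:R :> R by rewrite ltr0n (leq_trans N0).
have k1 : 0 < k.+1%:R :> R by rewrite ltr0n.
apply: le_trans (_ : k.+1%:R ^- 2 <= _).
  by rewrite lef_pV2 ?posrE ?exprn_gt0// ler_weXn2l// ler1n.
rewrite (_ : _ - _ = (k%:R * k.+1%:R)^-1); last first.
  by rewrite -[k.+1%:R]natr1; field; rewrite natr1 !gt_eqF.
by rewrite lef_pV2 ?posrE ?exprn_gt0 ?mulr_gt0// expr2 ler_pM2r// ler_nat.
Qed.

Lemma zeta_bounds (R : realType) (s N : nat) : (1 < s)%N -> (0 < N)%N ->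
  zpart R s N.+1 <= zeta R s <= zpart R s N.+1 + N%:R^-1.
Proof.
move=> s1 N0.
have s0 : (0 < s)%N by apply: ltn_trans s1.
have E M : zpart R s M.+1 = \sum_(0 <= k < M) k.+1%:R ^- s.
  by rewrite /zpart big_ord_recl/= expr0n (gtn_eqF s0) invr0 add0r big_mkord.
pose u (k : nat) : \bar R := (k.+1%:R ^- s)%:E.
have u0 k : (0 <= k)%N -> true -> (0 <= u k)%E by rewrite lee_fin invr_ge0 exprn_ge0.
have SE M : (\sum_(0 <= k < M) u k)%E = (zpart R s M.+1)%:E by rewrite E sumEFin.
have lo : ((zpart R s N.+1)%:E <= \sum_(0 <= k <oo) u k)%E.
  by rewrite -SE; apply: nneseries_lim_ge.
have hi : (\sum_(0 <= k <oo) u k <= (zpart R s N.+1 + N%:R^-1)%:E)%E.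
  apply: lime_le; first by apply: is_cvg_nneseries => k _ _; exact: u0.
  near=> M; rewrite SE lee_fin !E.
  have NM : (N <= M)%N by near: M; exists N.
  by rewrite (big_cat_nat (leq0n N) NM)/= lerD2l zpart_tail.
have fn : (\sum_(0 <= k <oo) u k)%E \is a fin_num.
  rewrite fin_numElt (lt_le_trans (ltNyr _) lo)/=.
  exact: le_lt_trans hi (ltry _).
rewrite /zeta -/u; apply/andP; split.
  by rewrite -lee_fin fineK.
by rewrite -lee_fin fineK.
Unshelve. all: by end_near.
Qed.

Lemma zpart_le_zeta (R : realType) (s N : nat) : (1 < s)%N -> zpart R s N <= zeta R s.
Proof.
move=> s1; have /andP[h _] := zeta_bounds R s1 (ltn0Sn N); apply: le_trans h.
rewrite /zpart !big_ord_recr/= -addrA lerDl.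
by rewrite addr_ge0// invr_ge0 exprn_ge0.
Qed.

Lemma zeta_tail (R : realType) (s N : nat) : (1 < s)%N -> (0 < N)%N ->
  zeta R s <= zpart R s N + 2 / N%:R.
Proof.
move=> s1 N0; have /andP[_ h] := zeta_bounds R s1 N0; apply: le_trans h _.
rewrite /zpart big_ord_recr/= -addrA lerD2l (_ : 2 / N%:R = N%:R^-1 + N%:R^-1); last by ring.
rewrite lerD2r lef_pV2 ?posrE ?exprn_gt0 ?ltr0n// ler_eXnr ?ler1n//.
exact: ltnW.
Qed.

Lemma zeta_ge1 (R : realType) (s : nat) : (1 < s)%N -> 1 <= zeta R s.
Proof.
move=> s1; apply: le_trans (zpart_le_zeta R 2 s1).
rewrite /zpart !big_ord_recl big_ord0 /= expr0n (gtn_eqF (ltnW s1)) invr0 add0r addr0.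
by rewrite expr1n invr1.
Qed.

Definition phipart (R : realType) (N : nat) : R := \sum_(w < N) (totient w)%:R / w%:R ^+ 3.

Lemma phi_cube_le (R : realType) (w : nat) : (totient w)%:R / w%:R ^+ 3 <= w%:R ^- 2 :> R.
Proof.
case: (posnP w) => [->|w0]; first by rewrite mul0r expr0n invr0.
have w0' : 0 < w%:R :> R by rewrite ltr0n.
rewrite ler_pdivrMr ?exprn_gt0// (_ : w%:R ^- 2 * w%:R ^+ 3 = w%:R) ?ler_nat ?leq_totient//.
by field; rewrite gt_eqF.
Qed.

(* Dirichlet convolution phi * 1 = id on truncated sums. *)
Lemma zpart2_convolution (R : realType) (N : nat) :
  zpart R 2 N = \sum_(w < N) (totient w)%:R * \sum_(k < N) (w %| k)%N%:R * k%:R ^- 3.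
Proof.
under [RHS]eq_bigr => w _ do rewrite mulr_sumr.
rewrite [RHS]exchange_big/=; apply: eq_bigr => k _.
transitivity ((k%:R : R) ^- 3 * \sum_(w < N) (w %| k)%N%:R * (totient w)%:R); last first.
  by rewrite mulr_sumr; apply: eq_bigr => w _; ring.
case: (posnP k) => [->|k0]; first by rewrite !expr0n !invr0 mul0r.
rewrite sum_totient_dvdn_lt//; field.
by rewrite pnatr_eq0 -lt0n.
Qed.

Lemma sum_cube_multiples_le (R : realType) (w N : nat) : (0 < w)%N ->
  \sum_(k < N) (w %| k)%N%:R * k%:R ^- 3 <= w%:R ^- 3 * zeta R 3.
Proof.
move=> w0; have NN : (N <= N * w)%N by rewrite leq_pmulr.
apply: le_trans (_ : \sum_(k < N * w) (w %| k)%N%:R * k%:R ^- 3 <= _).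
  rewrite -!(big_mkord xpredT (fun k => (w %| k)%N%:R * k%:R ^- 3 : R)).
  rewrite (big_cat_nat (leq0n N) NN)//= lerDl sumr_ge0//.
rewrite (sum_multiples (fun k => k%:R ^- 3))//.
under eq_bigr => j _ do rewrite natrM exprMn invfM mulrC.
by rewrite -mulr_sumr ler_wpM2l ?invr_ge0 ?exprn_ge0//; exact: zpart_le_zeta.
Qed.

Lemma sum_cube_multiples_ge (R : realType) (w N : nat) : (0 < w)%N -> (w < N)%N ->
  w%:R ^- 3 * (zeta R 3 - 4 * w%:R / N%:R) <= \sum_(k < N) (w %| k)%N%:R * k%:R ^- 3.
Proof.
move=> w0 wN; set J := (N %/ w)%N.
have J0 : (0 < J)%N by rewrite divn_gt0// ltnW.
have JN : (J * w <= N)%N by exact: leq_divM.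
have NJ : (N <= 2 * J * w)%N.
  have := ltn_ceil N w0; rewrite -/J mulSn; nia.
apply: le_trans (_ : \sum_(k < J * w) (w %| k)%N%:R * k%:R ^- 3 <= _); last first.
  rewrite -!(big_mkord xpredT (fun k => (w %| k)%N%:R * k%:R ^- 3 : R)).
  rewrite (big_cat_nat (leq0n _) JN)//= lerDl sumr_ge0//.
rewrite (sum_multiples (fun k => k%:R ^- 3))//.
under [leRHS]eq_bigr => j _ do rewrite natrM exprMn invfM mulrC.
rewrite -mulr_sumr ler_wpM2l ?invr_ge0 ?exprn_ge0//.
have := @zeta_tail R 3 J isT J0; rewrite -/(zpart R 3 J) lerBlDr => /le_trans; apply.
rewrite lerD2l ler_pdivrMr ?ltr0n// mulrAC ler_pdivlMr; last by rewrite ltr0n; lia.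
by rewrite -!natrM ler_nat; nia.
Qed.

(** Truncated form of [zeta(2) = zeta(3) * (sum of phi(w) / w^3)]. Cutting the multiples of [w] at
    [N] loses at most [4 w / N] from [zeta(3)], hence [4 / (N w)] after weighting, and the sum over
    [w] is harmonic. Division by [zeta(3) >= 1] does not enlarge the error. *)
Lemma phipart_zeta (R : realType) (N : nat) : (0 < N)%N ->
  `|phipart R N - zeta R 2 / zeta R 3| <= 4 * harm R N / N%:R.
Proof.
move=> N0; have z3 := @zeta_ge1 R 3 isT; have z30 : 0 < zeta R 3 by lra.
have N0' : 0 < N%:R :> R by rewrite ltr0n.
have l1 := @harm_ge1 R N N0.
have h1 : zeta R 2 <= phipart R N * zeta R 3 + 2 / N%:R.
  apply: le_trans (@zeta_tail R 2 N isT N0) _; rewrite lerD2r zpart2_convolution.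
  rewrite /phipart mulr_suml; apply: ler_sum => w _; case: (posnP w) => [->|w0].
    by rewrite !mul0r.
  by rewrite -mulrA ler_wpM2l// sum_cube_multiples_le.
have h2 : phipart R N * zeta R 3 <= zeta R 2 + 4 * harm R N / N%:R.
  rewrite -lerBlDr; apply: le_trans (@zpart_le_zeta R 2 N isT).
  rewrite zpart2_convolution lerBlDr.
  apply: le_trans (_ : \sum_(w < N) ((totient w)%:R *
      (\sum_(k < N) (w %| k)%N%:R * k%:R ^- 3) + 4 / N%:R * w%:R^-1) <= _).
    rewrite /phipart mulr_suml; apply: ler_sum => w _; case: (posnP w) => [->|w0].
      by rewrite !mul0r add0r invr0 mulr0.
    rewrite (_ : _ * zeta R 3 = (totient w)%:R * (w%:R ^- 3 * (zeta R 3 - 4 * w%:R / N%:R)) +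
      (totient w)%:R / w%:R ^+ 3 * (4 * w%:R / N%:R)); last by ring.
    apply: lerD; first by rewrite ler_wpM2l// sum_cube_multiples_ge.
    have w0' : 0 < w%:R :> R by rewrite ltr0n.
    have wN : 0 <= 4 * w%:R / N%:R :> R by rewrite divr_ge0 ?mulr_ge0.
    apply: le_trans (ler_wpM2r wN (phi_cube_le R w)) _.
    by rewrite le_eqVlt; apply/orP; left; apply/eqP; field; rewrite !gt_eqF.
  rewrite big_split/= lerD2l -mulr_sumr [leRHS]mulrAC ler_wpM2l ?divr_ge0//.
  exact: sum_inv_le_harm.
have d0 : 0 < N%:R^-1 :> R by rewrite invr_gt0.
have hN : N%:R^-1 <= harm R N / N%:R by rewrite ler_peMl// ltW.
rewrite (_ : _ - _ = (phipart R N * zeta R 3 - zeta R 2) / zeta R 3); last first.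
  by field; rewrite gt_eqF.
rewrite normrM normfV (gtr0_norm z30) ler_pdivrMr//.
apply: le_trans (_ : 4 * harm R N / N%:R * 1 <= _); last first.
  by rewrite ler_wpM2l// divr_ge0 ?mulr_ge0 ?harm_ge0.
rewrite mulr1 ler_norml; apply/andP; split; last by lra.
by move: h1; rewrite -mulrA; lra.
Qed.

(** * The factor at the prime 2 *)

Definition phieven (R : realType) (N : nat) : R :=
  \sum_(w < N) (2 %| w)%N%:R * ((totient w)%:R / w%:R ^+ 3).
Definition phiodd (R : realType) (N : nat) : R :=
  \sum_(w < N) (odd w)%:R * ((totient w)%:R / w%:R ^+ 3).

Lemma totient_double_even (v : nat) : (0 < v)%N -> ~~ odd v -> totient (2 * v) = (2 * totient v)%N.
Proof.
move=> v0 ov; have [e [u [eE ou]]] : exists e u, v = (2 ^ e.+1 * u)%N /\ odd u.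
  have [u cu vE] := pfactor_coprime (isT : prime 2) v0.
  have : (0 < logn 2 v)%N by rewrite logn_gt0 mem_primes/= v0 dvdn2.
  case E : (logn 2 v) vE => [//|e] vE _.
  by exists e, u; rewrite mulnC -vE; split=> //; rewrite -coprime2n.
have cop f : coprime (2 ^ f) u by rewrite coprimeXl// coprime2n.
have E : (2 * v = 2 ^ e.+2 * u)%N by rewrite eE mulnA (expnS 2 e.+1).
rewrite E eE (totient_coprime (cop e.+2)) (totient_coprime (cop e.+1)).
by rewrite !totient_pfactor// !mul1n (expnS 2 e) mulnA.
Qed.

Lemma phi_split (R : realType) (N : nat) : phipart R N = phiodd R N + phieven R N.
Proof.
rewrite /phipart -big_split/=; apply: eq_bigr => w _; rewrite dvdn2.
by case: (odd w); rewrite ?mul1r ?mul0r ?addr0 ?add0r.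
Qed.

Lemma cube_double (R : realType) (v : nat) (t : R) :
  t / (v * 2)%:R ^+ 3 = t / v%:R ^+ 3 / 8.
Proof. by rewrite natrM exprMn invfM -[2 ^+ 3]natrX mulrA. Qed.

Lemma phieven_double (R : realType) (N : nat) :
  phieven R (2 * N) = phieven R N / 4 + phiodd R N / 8.
Proof.
rewrite /phieven mulnC (sum_multiples (fun w => (totient w)%:R / w%:R ^+ 3))//.
rewrite /phiodd !mulr_suml -big_split/=; apply: eq_bigr => v _.
rewrite cube_double; case: (posnP v) => [->|v0].
  by rewrite mul0n !(mul0r, mulr0, addr0).
rewrite dvdn2 mulnC; case: (boolP (odd v)) => ov /=.
  by rewrite totient_double_odd// mul0r mul0r add0r mul1r.
by rewrite totient_double_even// natrM; field; rewrite pnatr_eq0 -lt0n.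
Qed.

Lemma sigma_part_double (R : realType) (N : nat) :
  sigma_part R (2 * N) = phiodd R (2 * N) + phieven R N / 2.
Proof.
have E : \sum_(w < 2 * N) (2 %| w)%N%:R * ((totient w)%:R * ((kappa w)%:R / w%:R ^+ 3)) =
    phieven R N / 2.
  rewrite mulnC (sum_multiples (fun w => (totient w)%:R * ((kappa w)%:R / w%:R ^+ 3)))//.
  rewrite /phieven mulr_suml; apply: eq_bigr => v _.
  rewrite cube_double; case: (posnP v) => [->|v0]; first by rewrite mul0n !(mul0r, mulr0).
  rewrite /kappa oddM andbF mulnC dvdn2; case: (boolP (odd v)) => ov /=.
    by rewrite ifT ?mul0r ?mulr0//; lia.
  rewrite ifF; last by lia.
  by rewrite totient_double_even// natrM; field; rewrite pnatr_eq0 -lt0n.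
rewrite -E /phiodd /sigma_part -big_split/=; apply: eq_bigr => w _.
rewrite dvdn2 /kappa; case: (odd w) => /=; last by rewrite mul0r add0r mul1r.
by rewrite mul0r addr0 mul1r mulr1n mul1r.
Qed.

(** The doubling identities replace an Euler product. In the limit the even part [E] and the odd
    part [O] satisfy [E = E / 4 + O / 8] and [E + O = z] with [z = zeta(2) / zeta(3)]. Hence
    [O = 6 z / 7], [E = z / 7], and [O + E / 2 = 13 z / 14]. *)
Lemma sigma_part_limit (R : realType) (N : nat) : (0 < N)%N ->
  `|sigma_part R (2 * N) - 13 * zeta R 2 / (14 * zeta R 3)| <= 5 * harm R N / N%:R.
Proof.
move=> N0.
have N0' : 0 < N%:R :> R by rewrite ltr0n.
have z3 := @zeta_ge1 R 3 isT.
have pos w : 0 <= (totient w)%:R / w%:R ^+ 3 :> R by rewrite divr_ge0 ?exprn_ge0.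
have NN : (N <= 2 * N)%N by rewrite leq_pmull.
have mono (p : nat -> bool) : \sum_(w < N) (p w)%:R * ((totient w)%:R / w%:R ^+ 3) <=
    \sum_(w < 2 * N) (p w)%:R * ((totient w)%:R / w%:R ^+ 3) :> R.
  rewrite -!(big_mkord xpredT (fun w => (p w)%:R * ((totient w)%:R / w%:R ^+ 3) : R)).
  by rewrite (big_cat_nat (leq0n N) NN)//= lerDl sumr_ge0// => w _; rewrite mulr_ge0.
have e1 : phieven R N <= phieven R (2 * N) by exact: (mono (fun w => 2 %| w)%N).
have e2 : phiodd R N <= phiodd R (2 * N) by exact: (mono odd).
have tail : phipart R (2 * N) - phipart R N <= N%:R^-1.
  rewrite /phipart -!(big_mkord xpredT (fun w => (totient w)%:R / w%:R ^+ 3 : R)).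
  rewrite (big_cat_nat (leq0n N) NN)/= addrAC subrr add0r.
  apply: le_trans (_ : \sum_(N <= i < 2 * N) N%:R ^- 2 <= _).
    apply: ler_sum_nat => i /andP[Ni _]; apply: le_trans (phi_cube_le R i) _.
    have i0 : (0 < i)%N by apply: leq_trans Ni.
    by rewrite lef_pV2 ?posrE ?exprn_gt0 ?ltr0n// ler_pXn2r ?nnegrE// ler_nat.
  rewrite sumr_const_nat mul2n -addnn addnK -[leLHS]mulr_natr.
  by rewrite le_eqVlt; apply/orP; left; apply/eqP; field; rewrite gt_eqF.
have D := phieven_double R N.
have S := sigma_part_double R N.
have P1 := phi_split R N; have P2 := phi_split R (2 * N).
have := phipart_zeta R N0; rewrite ler_norml => /andP[h1 h2].
have hN : N%:R^-1 <= harm R N / N%:R by rewrite ler_peMl ?harm_ge1// invr_ge0.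
rewrite (_ : 13 * zeta R 2 / (14 * zeta R 3) = 13 / 14 * (zeta R 2 / zeta R 3)); last first.
  by field; rewrite gt_eqF//; lra.
rewrite ler_norml; move: h1 h2; rewrite -!mulrA.
move: (zeta R 2 / zeta R 3) (harm R N / N%:R) hN S D P1 P2 tail e1 e2 => z t.
by move=> *; apply/andP; split; lra.
Qed.

(** * The singular integral *)

Section IntegralKernels.
Local Open Scope classical_set_scope.

(* [expR (- ln v)] stands for [v^-1]: measurability lemmas exist for [expR] and [ln]. *)
Definition kern (R : realType) (u v t : R) : R :=
  if [&& 0 < v, u ^+ 2 < t, (u - v) ^+ 2 < t, t < (u + v) ^+ 2 & t < 1]
  then expR (- ln v) else 0.

Lemma kern_ge0 (R : realType) (u v t : R) : 0 <= kern u v t.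
Proof. by rewrite /kern; case: ifP => // _; exact: expR_ge0. Qed.

Lemma measurable_kern (R : realType) d (T : measurableType d) (f g h : T -> R) :
  measurable_fun setT f -> measurable_fun setT g -> measurable_fun setT h ->
  measurable_fun setT (fun x => kern (f x) (g x) (h x)).
Proof.
move=> mf mg mh; apply: measurable_fun_ifT.
- apply: measurable_and; first exact: measurable_fun_ltr.
  apply: measurable_and.
    by apply: measurable_fun_ltr => //; exact: measurable_funX.
  apply: measurable_and.
    apply: measurable_fun_ltr => //; apply: measurable_funX; exact: measurable_funB.
  apply: measurable_and.
    by apply: measurable_fun_ltr => //; apply: measurable_funX; exact: measurable_funD.
  exact: measurable_fun_ltr.
- apply: measurableT_comp; first exact: measurable_expR.
  apply: measurable_funN; apply: measurableT_comp => //; exact: measurable_ln.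
- exact: measurable_cst.
Qed.

(** Integrals run over the whole line: [kern] vanishes outside the domain of [frakS], so Tonelli
    applies without variable limits. *)
Definition kernv (R : realType) (u t : R) : \bar R :=
  (\int[@lebesgue_measure R]_v (kern u v t)%:E)%E.

Definition kernuv (R : realType) (t : R) : \bar R :=
  (\int[@lebesgue_measure R]_u kernv u t)%E.

Lemma kernv_ge0 (R : realType) (u t : R) : (0 <= kernv u t)%E.
Proof. by apply: integral_ge0 => v _; rewrite lee_fin kern_ge0. Qed.

Lemma kernuv_ge0 (R : realType) (t : R) : (0 <= kernuv t)%E.
Proof. by apply: integral_ge0 => v _; exact: kernv_ge0. Qed.

Lemma measurable_ekern (R : realType) d (T : measurableType d) (f g h : T -> R) :
  measurable_fun setT f -> measurable_fun setT g -> measurable_fun setT h ->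
  measurable_fun setT ((fun x => (kern (f x) (g x) (h x))%:E) : T -> \bar R).
Proof. by move=> mf mg mh; apply/measurable_EFinP; exact: measurable_kern. Qed.

Lemma measurable_kernv (R : realType) d (T : measurableType d) (f h : T -> R) :
  measurable_fun setT f -> measurable_fun setT h ->
  measurable_fun setT ((fun x => kernv (f x) (h x)) : T -> \bar R).
Proof.
move=> mf mh.
apply: (@measurable_fun_fubini_tonelli_F _ _ T (measurableTypeR R) R lebesgue_measure
  (fun z : T * measurableTypeR R => (kern (f z.1) z.2 (h z.1))%:E)).
  by apply: measurable_ekern; [exact: measurableT_comp|exact: measurable_snd|exact: measurableT_comp].
by move=> z; rewrite lee_fin kern_ge0.
Qed.

Lemma measurable_kernuv (R : realType) : measurable_fun setT (@kernuv R).
Proof.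
apply: (@measurable_fun_fubini_tonelli_F _ _ (measurableTypeR R) (measurableTypeR R) R lebesgue_measure
  (fun z : measurableTypeR R * measurableTypeR R => kernv z.2 z.1)).
  by apply: measurable_kernv; [exact: measurable_snd|exact: measurable_fst].
by move=> z; exact: kernv_ge0.
Qed.

Lemma integral_restrict0 (R : realType) (A : set R) (f : R -> \bar R) :
  (forall x, ~ A x -> f x = 0%E) ->
  (\int[@lebesgue_measure R]_(x in A) f x = \int[@lebesgue_measure R]_x f x)%E.
Proof.
move=> f0; rewrite integral_mkcond; apply: eq_integral => x _.
by rewrite /patch; case: ifPn => // /negP; rewrite inE => /f0.
Qed.

Lemma kern_support (R : realType) (u v t : R) : kern u v t != 0 ->
  [/\ 0 < u < 1, 0 < v < 1 + u & 0 < t < 1].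
Proof.
rewrite /kern; case: ifP => [/and5P[v0 ut uvt tuv t1] _|]; last by rewrite eqxx.
have t0 : 0 < t by apply: le_lt_trans ut; exact: sqr_ge0.
have u0 : 0 < u by nra.
have u1 : u < 1 by nra.
have vu : v < 1 + u by nra.
by rewrite u0 u1 v0 vu t0 t1.
Qed.

Lemma kernE (R : realType) (u v t : R) : 0 < v -> kern u v t =
  v^-1 * [&& u ^+ 2 < t, (u - v) ^+ 2 < t, t < (u + v) ^+ 2 & t < 1]%:R.
Proof.
move=> v0; rewrite /kern v0/=; case: ifP => _; last by rewrite mulr0.
by rewrite -lnV ?posrE// lnK ?posrE ?invr_gt0// mulr1.
Qed.

Lemma integral_itv_indic (R : realType) (a b : R) (P : R -> bool) (c : R) : 0 <= c ->
  (forall t, P t = (a < t < b)) ->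
  (\int[@lebesgue_measure R]_t (c * (P t)%:R)%:E = (c * Num.max 0 (b - a))%:E)%E.
Proof.
move=> c0 PE.
under eq_integral => t _ do rewrite EFinM.
rewrite ge0_integralZl_EFin//=; last first.
  apply/measurable_EFinP.
  rewrite (_ : (fun _ => _) = \1_(`]a, b[%classic)); first exact: measurable_indic.
  by apply/funext => t; rewrite indicE mem_setE in_itv/= PE.
have -> : (\int[@lebesgue_measure R]_t ((P t)%:R)%:E =
    \int[@lebesgue_measure R]_t (\1_(`]a, b[%classic) t)%:E)%E.
  by apply: eq_integral => t _; rewrite indicE mem_setE in_itv/= PE.
rewrite integral_indic// setIT [X in (_ * X)%E](lebesgue_measure_itv `]a, b[%R)/= lte_fin.
rewrite EFinM; congr (_ * _)%E; case: ltP => ab.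
  by rewrite -EFinB max_r// subr_ge0 ltW.
by rewrite max_l// subr_le0.
Qed.

(** The maximum in [phi] is the length of an intersection of two intervals in [t], one depending on
    [(u1, v1)] and one on [(u2, v2)]; their indicators multiply. *)
Lemma phi_integral (R : realType) (u1 u2 v1 v2 : R) :
  0 <= u1 -> 0 <= u2 -> 0 <= v1 -> 0 <= v2 ->
  ((phi u1 u2 v1 v2)%:E =
   \int[@lebesgue_measure R]_t ((kern u1 v1 t)%:E * (kern u2 v2 t)%:E))%E.
Proof.
move=> u10 u20 v10 v20.
(* At [v = 0] both sides vanish: [phi] through [0^-1 = 0], and [kern] through its condition
   [0 < v]. *)
have z (u : R) t : kern u 0 t = 0 by rewrite /kern ltxx.
have [v1z|v1n] := eqVneq v1 0.
  rewrite /phi v1z mul0r invr0 mul0r -[LHS](@integral0 _ _ _ (@lebesgue_measure R) setT).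
  by apply: eq_integral => t _; rewrite z mul0e.
have [v2z|v2n] := eqVneq v2 0.
  rewrite /phi v2z mulr0 invr0 mul0r -[LHS](@integral0 _ _ _ (@lebesgue_measure R) setT).
  by apply: eq_integral => t _; rewrite z mule0.
have v1p : 0 < v1 by rewrite lt_def v1n.
have v2p : 0 < v2 by rewrite lt_def v2n.
pose lo := Num.max (Num.max (u1 ^+ 2) (u2 ^+ 2)) (Num.max ((u1 - v1) ^+ 2) ((u2 - v2) ^+ 2)).
pose hi := Num.min 1 (Num.min ((u1 + v1) ^+ 2) ((u2 + v2) ^+ 2)).
pose P1 (t : R) := [&& u1 ^+ 2 < t, (u1 - v1) ^+ 2 < t, t < (u1 + v1) ^+ 2 & t < 1].
pose P2 (t : R) := [&& u2 ^+ 2 < t, (u2 - v2) ^+ 2 < t, t < (u2 + v2) ^+ 2 & t < 1].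
transitivity (\int[@lebesgue_measure R]_t ((v1 * v2)^-1 * (P1 t && P2 t)%:R)%:E)%E.
  rewrite (@integral_itv_indic _ lo hi); first by [].
    by rewrite invr_ge0 mulr_ge0.
  move=> t; rewrite /lo /hi !gt_max !lt_min /P1 /P2.
  by do !(case: (_ < _); rewrite /= ?andbF ?andbT//).
apply: eq_integral => t _; rewrite -EFinM !kernE// -/(P1 t) -/(P2 t) invfM; congr (_%:E).
by case: (P1 t); case: (P2 t); rewrite /= ?(mulr1, mulr0, mul0r).
Qed.

Local Open Scope ereal_scope.

Lemma integral_v2 (R : realType) (u1 u2 v1 : R) : (0 <= u1)%R -> (0 <= u2)%R -> (0 <= v1)%R ->
  \int[@lebesgue_measure R]_(v2 in `[0%R, (1 + u2)%R]) (phi u1 u2 v1 v2)%:E =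
  \int[@lebesgue_measure R]_t ((kern u1 v1 t)%:E * kernv u2 t).
Proof.
move=> u10 u20 v10.
transitivity (\int[@lebesgue_measure R]_v2 \int[@lebesgue_measure R]_t
    ((kern u1 v1 t)%:E * (kern u2 v2 t)%:E)).
  rewrite -(@integral_restrict0 _ `[0%R, (1 + u2)%R]).
    apply: eq_integral => v2; rewrite inE/= in_itv/= => /andP[v20 _].
    exact: phi_integral.
  move=> v2 nv; rewrite integral0_eq// => t _.
  have [->|/kern_support[_ /andP[v0 vu] _]] := eqVneq (kern u2 v2 t) 0%R; first by rewrite mule0.
  by exfalso; apply: nv; rewrite /= in_itv/= !ltW.
rewrite (@fubini_tonelli _ _ (measurableTypeR R) (measurableTypeR R) R lebesgue_measure lebesgue_measure
  (fun z => (kern u1 v1 z.2)%:E * (kern u2 z.1 z.2)%:E))/=.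
- apply: eq_integral => t _; rewrite /kernv -ge0_integralZl_EFin//.
  + by move=> v _; rewrite lee_fin kern_ge0.
  + exact: measurable_ekern.
  + exact: kern_ge0.
- apply: emeasurable_funM; apply: measurable_ekern => //; exact: measurable_snd || exact: measurable_fst.
- by move=> z; rewrite mule_ge0// lee_fin kern_ge0.
Qed.

Lemma integral_v1 (R : realType) (u1 u2 : R) : (0 <= u1)%R ->
  \int[@lebesgue_measure R]_(v1 in `[0%R, (1 + u1)%R])
    \int[@lebesgue_measure R]_t ((kern u1 v1 t)%:E * kernv u2 t) =
  \int[@lebesgue_measure R]_t (kernv u1 t * kernv u2 t).
Proof.
move=> u10; rewrite integral_restrict0; last first.
  move=> v nv; rewrite integral0_eq// => t _.
  have [->|/kern_support[_ /andP[v0 vu] _]] := eqVneq (kern u1 v t) 0%R; first by rewrite mul0e.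
  by exfalso; apply: nv; rewrite /= in_itv/= !ltW.
rewrite (@fubini_tonelli _ _ (measurableTypeR R) (measurableTypeR R) R lebesgue_measure lebesgue_measure
  (fun z => (kern u1 z.1 z.2)%:E * kernv u2 z.2))/=.
- apply: eq_integral => t _; rewrite [RHS]muleC /kernv -ge0_integralZl//.
  + by apply: eq_integral => v _; rewrite muleC.
  + exact: measurable_ekern.
  + by move=> v _; rewrite lee_fin kern_ge0.
  + exact: kernv_ge0.
- apply: emeasurable_funM.
    by apply: measurable_ekern.
  by apply: measurable_kernv => //; exact: measurable_snd.
- by move=> z; rewrite mule_ge0 ?kernv_ge0// lee_fin kern_ge0.
Qed.

Lemma kernv_support (R : realType) (u t : R) : kernv u t != 0 -> (0 < u < 1)%R.
Proof.
apply: contraNT => nu; rewrite /kernv integral0_eq// => v _.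
have [->//|/kern_support[u01 _ _]] := eqVneq (kern u v t) 0%R.
by rewrite u01 in nu.
Qed.

Lemma integral_u (R : realType) (f : R -> \bar R) : measurable_fun setT f ->
  (forall t, 0 <= f t) ->
  \int[@lebesgue_measure R]_(u in `[0%R, 1%R]) \int[@lebesgue_measure R]_t (f t * kernv u t) =
  \int[@lebesgue_measure R]_t (f t * kernuv t).
Proof.
move=> mf f0; rewrite integral_restrict0; last first.
  move=> u nu; rewrite integral0_eq// => t _.
  have [->|/kernv_support/andP[v0 vu]] := eqVneq (kernv u t) 0; first by rewrite mule0.
  by exfalso; apply: nu; rewrite /= in_itv/= !ltW.
rewrite (@fubini_tonelli _ _ (measurableTypeR R) (measurableTypeR R) R lebesgue_measure lebesgue_measure
  (fun z => f z.2 * kernv z.1 z.2))/=.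
- apply: eq_integral => t _; rewrite /kernuv -ge0_integralZl//.
  + exact: measurable_kernv.
  + by move=> v _; exact: kernv_ge0.
- apply: emeasurable_funM.
    by apply: measurableT_comp => //; exact: measurable_snd.
  by apply: measurable_kernv.
- by move=> z; rewrite mule_ge0 ?kernv_ge0.
Qed.

(** For fixed [t] the pairs [(u1, v1)] and [(u2, v2)] are independent. Moving the four integrals
    inside one at a time leaves a square. *)
Lemma frakS_kernuv (R : realType) :
  frakS R = fine (\int[@lebesgue_measure R]_t (kernuv t * kernuv t)).
Proof.
rewrite /frakS; congr fine.
transitivity (\int[@lebesgue_measure R]_(u1 in `[0%R, 1%R])
   \int[@lebesgue_measure R]_t (kernuv t * kernv u1 t)); last first.
  by rewrite integral_u//; [exact: measurable_kernuv|exact: kernuv_ge0].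
apply: eq_integral => u1; rewrite inE/= in_itv/= => /andP[u10 _].
transitivity (\int[@lebesgue_measure R]_(u2 in `[0%R, 1%R])
   \int[@lebesgue_measure R]_t (kernv u1 t * kernv u2 t)).
  apply: eq_integral => u2; rewrite inE/= in_itv/= => /andP[u20 _].
  rewrite -(integral_v1 u2 u10); apply: eq_integral => v1; rewrite inE/= in_itv/= => /andP[v10 _].
  exact: integral_v2.
rewrite integral_u.
- by apply: eq_integral => t _; rewrite muleC.
- exact: measurable_kernv.
- by move=> t; exact: kernv_ge0.
Qed.

End IntegralKernels.

Section SingularIntegral.
Local Open Scope classical_set_scope.

(** With [s = sqrt t] the conditions on [u] amount to [|v - s| < u < s]: the continuous counterpart
    of [dom_real] and [gap]. *)
Lemma integral_kern_u (R : realType) (v t : R) : 0 < v -> 0 < t < 1 ->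
  (\int[@lebesgue_measure R]_u (kern u v t)%:E =
   (v^-1 * Num.max 0 (Num.sqrt t - `|v - Num.sqrt t|))%:E)%E.
Proof.
move=> v0 /andP[t0 t1]; set s := Num.sqrt t.
have s0 : 0 < s by rewrite sqrtr_gt0.
have ts : t = s ^+ 2 by rewrite sqr_sqrtr// ltW.
rewrite -(@integral_itv_indic _ _ _ (fun u => [&& u ^+ 2 < t, (u - v) ^+ 2 < t,
  t < (u + v) ^+ 2 & t < 1])).
- by apply: eq_integral => u _; rewrite kernE.
- by rewrite invr_ge0 ltW.
move=> u; rewrite t1 andbT ltr_norml ts.
have s0' := ltW s0.
have sq x : (x ^+ 2 < s ^+ 2) = (- s < x < s).
  by rewrite -(real_normK (num_real x)) ltr_pXn2r ?nnegrE// ltr_norml.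
have qs x : (s ^+ 2 < x ^+ 2) = ~~ (- s <= x <= s).
  by rewrite -(real_normK (num_real x)) ltr_pXn2r ?nnegrE// ltNge ler_norml.
rewrite !sq qs negb_and -!ltNge.
apply/idP/idP.
  move=> /and3P[/andP[h1 h2] /andP[h3 h4] /orP[h5|h5]]; last by rewrite h2 andbT; apply/andP; split; lra.
  by exfalso; lra.
move=> /andP[/andP[h1 h2] h3]; apply/and3P; split.
- by rewrite h3 andbT; lra.
- by apply/andP; split; lra.
- by apply/orP; right; lra.
Qed.

Lemma integral_ln_tent (R : realType) (s : R) : 0 < s ->
  (\int[@lebesgue_measure R]_(v in `[s, (2 * s)%R]) (2 * s / v - 1)%:E =
   (2 * s * ln 2 - s)%:E)%E.
Proof.
move=> s0; have s2 : s < 2 * s by lra.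
pose F (v : R) := 2 * s * ln v - v.
have dF (v : R) : 0 < v -> is_derive v (1 : R) F (2 * s / v - 1).
  move=> v0; rewrite /F.
  have -> : 2 * s / v - 1 = (2 * s) *: v^-1 - 1 by [].
  have dl := is_derive1_ln v0.
  exact: is_deriveB.
have cF (v : R) : 0 < v -> {for v, continuous F}.
  by move=> v0; apply: differentiable_continuous; apply/derivable1_diffP; have [] := dF v v0.
rewrite (@continuous_FTC2 _ _ F)//.
- rewrite -EFinB /F lnM ?posrE//; congr EFin; ring.
- apply: continuous_in_subspaceT => v; rewrite inE/= in_itv/= => /andP[sv _].
  have v0 : v != 0 by rewrite gt_eqF// (lt_le_trans s0).
  apply: cvgB; last exact: cvg_cst.
  by apply: cvgM; [exact: cvg_cst|apply: cvgV => //; exact: cvg_id].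
- split.
  + move=> v; rewrite in_itv/= => /andP[sv _].
    by have [] := dF v (lt_trans s0 sv).
  + by apply: cvg_at_right_filter; exact: cF.
  + by apply: cvg_at_left_filter; apply: cF; lra.
- move=> v; rewrite in_itv/= => /andP[sv _].
  by rewrite derive1E; have [_ ->] := dF v (lt_trans s0 sv).
Qed.

(** After exchanging the order, the integrand in [v] is [1] up to [s] and [2 s / v - 1] from [s] to
    [2 s]. The pieces contribute [s] and [2 s ln 2 - s]. *)
Lemma kernuvE (R : realType) (t : R) : 0 < t < 1 ->
  kernuv t = (2 * Num.sqrt t * ln 2)%:E.
Proof.
move=> t01; have /andP[t0 t1] := t01; set s := Num.sqrt t.
have s0 : 0 < s by rewrite sqrtr_gt0.
pose h (v : R) : \bar R := (\int[@lebesgue_measure R]_u (kern u v t)%:E)%E.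
have mf : measurable_fun setT (fun z : measurableTypeR R * measurableTypeR R => (kern z.1 z.2 t)%:E).
  exact: measurable_ekern.
have mh : measurable_fun setT (h : measurableTypeR R -> \bar R).
  apply: (@measurable_fun_fubini_tonelli_G _ _ (measurableTypeR R) (measurableTypeR R) R
    lebesgue_measure (fun z => (kern z.1 z.2 t)%:E) mf).
  by move=> z; rewrite lee_fin kern_ge0.
have h0 v : (0 <= h v)%E by apply: integral_ge0 => u _; rewrite lee_fin kern_ge0.
have -> : kernuv t = (\int[@lebesgue_measure R]_v h v)%E.
  apply: (@fubini_tonelli _ _ (measurableTypeR R) (measurableTypeR R) R
    lebesgue_measure lebesgue_measure (fun z => (kern z.1 z.2 t)%:E) mf).
  by move=> z; rewrite lee_fin kern_ge0.
have hE v : 0 < v -> h v = (v^-1 * Num.max 0 (s - `|v - s|))%:E.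
  by move=> v0; exact: integral_kern_u.
rewrite -(@integral_restrict0 _ (`]0, s] `|` `]s, (2 * s)%R])); last first.
  move=> v nv; case: (leP v 0) => v0.
    rewrite /h integral0_eq// => u _.
    have [->//|/kern_support[_ /andP[v0' _] _]] := eqVneq (kern u v t) 0.
    by have := lt_le_trans v0' v0; rewrite ltxx.
  rewrite hE// max_l ?mulr0// subr_le0.
  have sv : 2 * s < v.
    rewrite ltNge; apply/negP => vs; apply: nv; rewrite /= !in_itv/= v0 vs andbT.
    by case: (leP v s) => ?; [left|right].
  by rewrite ger0_norm; lra.
rewrite ge0_integral_setU//=; first last.
- apply/disj_setPS => v [] /=; rewrite !in_itv/= => /andP[_ vs] /andP[sv _].
  by have := lt_le_trans sv vs; rewrite ltxx.
- exact: measurable_funTS.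
have -> : (\int[@lebesgue_measure R]_(v in `]0%R, s]) h v = s%:E)%E.
  rewrite (eq_integral (cst 1%E)).
    rewrite integral_cst// mul1e [LHS](lebesgue_measure_itv `]0%R, s]%R) /= lte_fin s0.
    by rewrite -EFinB subr0.
  move=> v; rewrite inE/= in_itv/= => /andP[v0 vs].
  rewrite hE// ler0_norm ?subr_le0// opprB opprB addrC subrK max_r ?ltW//.
  by rewrite mulVf// gt_eqF.
rewrite (@integral_itv_obnd_cbnd R); last exact: measurable_funTS.
transitivity (s%:E + \int[@lebesgue_measure R]_(v in `[s, (2 * s)%R]) (2 * s / v - 1)%:E)%E.
  congr (_ + _)%E; apply: eq_integral => v; rewrite inE/= in_itv/= => /andP[sv vs].
  have v0 : 0 < v by apply: lt_le_trans sv.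
  rewrite hE// ger0_norm ?subr_ge0// max_r; last by lra.
  by congr EFin; field; rewrite gt_eqF.
by rewrite integral_ln_tent// -EFinD; congr EFin; ring.
Qed.

Lemma kernuv0 (R : realType) (t : R) : ~ (0 < t < 1) -> kernuv t = 0%E.
Proof.
move=> nt; rewrite /kernuv integral0_eq// => u _; rewrite /kernv integral0_eq// => v _.
by have [->//|/kern_support[_ _]] := eqVneq (kern u v t) 0.
Qed.

Lemma frakSE (R : realType) : frakS R = 2 * ln 2 ^+ 2.
Proof.
rewrite frakS_kernuv -(@integral_restrict0 _ `]0%R, 1%R[); last first.
  by move=> t; rewrite /= in_itv/= => nt; rewrite kernuv0// mul0e.
set l := ln 2.
transitivity (fine (\int[@lebesgue_measure R]_(t in `]0%R, 1%R[) (4 * l ^+ 2 * t)%:E)%E).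
  congr fine; apply: eq_integral => t; rewrite inE/= in_itv/= => t01; rewrite kernuvE// -EFinM.
  have /andP[t0 _] := t01.
  have ts : t = Num.sqrt t ^+ 2 by rewrite sqr_sqrtr// ltW.
  by congr EFin; rewrite [in RHS]ts -/l; ring.
have mt (D : set R) : measurable_fun D (fun t : R => 4 * l ^+ 2 * t).
  by apply: measurable_funTS; apply: measurable_funM => //; exact: measurable_cst.
rewrite -(@integral_itv_bndoo R 0 1 _ true false); last exact/measurable_EFinP.
pose F (t : R) := 2 * l ^+ 2 * (t * t).
have dF (t : R) : is_derive t (1 : R) F (4 * l ^+ 2 * t).
  rewrite /F; have dx := is_derive_id t (1 : R).
  have dM := is_deriveM dx dx.
  rewrite (_ : 4 * l ^+ 2 * t = (2 * l ^+ 2) *: (t *: 1 + t *: 1)); last first.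
    by rewrite /GRing.scale/=; ring.
  exact: is_deriveZ.
have cF (t : R) : {for t, continuous F}.
  by apply: differentiable_continuous; apply/derivable1_diffP; have [] := dF t.
rewrite (@continuous_FTC2 _ _ F)//=.
- by rewrite /F; ring.
- apply: continuous_subspaceT => t.
  by apply: cvgM; [exact: cvg_cst|exact: cvg_id].
- split.
  + by move=> t _; have [] := dF t.
  + by apply: cvg_at_right_filter; exact: cF.
  + by apply: cvg_at_left_filter; exact: cF.
- by move=> t _; rewrite derive1E; have [_ ->] := dF t.
Qed.

End SingularIntegral.

(** * Conclusion *)

Lemma harm_le_ln (R : realType) (n : nat) : (0 < n)%N -> harm R n <= 1 + ln n%:R.
Proof.
case: n => // n _; rewrite /harm big_ord_recl/= invr1 lerD2l.
have [_ /(_ isT)] := sum_inv_ln R (leq_addr n 1); rewrite ln1 subr0 add1n.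
apply: le_trans; rewrite big_add1/= big_mkord.
by [].
Qed.

Lemma count_error (R : realType) (X n : nat) : (0 < n)%N -> (X < n ^ 2)%N ->
  `|\sum_(d < X.+1) \sum_(m1 < n) \sum_(m2 < n) \sum_(q1 < 2 * n) \sum_(q2 < 2 * n)
     (dom m1 q1 d && dom m2 q2 d)%:R *
     ((q1 %| d - m1 ^ 2)%N%:R * (q2 %| d - m2 ^ 2)%N%:R) -
    2 * (X%:R * (X%:R + 1)) * ln 2 ^+ 2 * sigma_part R (2 * n)| <=
  17528 * (n%:R ^+ 3 * Num.sqrt n%:R * harm R (4 * n) ^+ 3).
Proof.
move=> n0 Xn; set r := Num.sqrt _; set l := harm _ _.
have n1 : 1 <= n%:R :> R by rewrite ler1n.
have r0 : 0 <= r by exact: sqrtr_ge0.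
have r2 : r ^+ 2 = n%:R by rewrite sqr_sqrtr.
have r1 : 1 <= r by rewrite -sqrtr1 ler_sqrt.
have l1 : 1 <= l by apply: harm_ge1; lia.
(* The block length just above [sqrt n] balances [n^3] against [n^2 H^2]. *)
pose H := (Num.truncn r).+1.
have rH : r < H%:R by rewrite -truncn_lt_nat.
have Hr : H%:R <= 2 * r.
  have : (Num.truncn r)%:R <= r by rewrite -truncn_ge_nat.
  have : H%:R = (Num.truncn r)%:R + 1 :> R by rewrite natr1.
  lra.
have H4n : (H <= 4 * n)%N.
  rewrite -(ler_nat R) natrM -r2; nra.
have K2r : (n %/ H).+1%:R <= 2 * r.
  have : ((n %/ H) * H)%N%:R <= n%:R :> R by rewrite ler_nat leq_divM.
  rewrite natrM -r2 -natr1.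
  have := ler0n R (n %/ H); move: ((n %/ H)%N%:R : R) => k; nra.
have h1 := total_defect_le R n0 Xn (isT : (0 < H)%N) H4n; rewrite -/l in h1.
have h2 := rho3_total_approx R Xn.
set M := \sum_(d < X.+1) _ in h2.
set S := \sum_(d < X.+1) _ in h1.
set U := \sum_(d < X.+1) _.
have SE : S = U - M.
  rewrite /S /U /M -sumrB; apply: eq_bigr => d _; rewrite -sumrB; apply: eq_bigr => m1 _.
  rewrite -sumrB; apply: eq_bigr => m2 _; rewrite -sumrB; apply: eq_bigr => q1 _.
  by rewrite -sumrB; apply: eq_bigr => q2 _; rewrite mulrBr.
set Z := 2 * _ * _ * _ in h2 *.
rewrite (_ : U - Z = S + (M - Z)); last by rewrite SE; ring.
apply: le_trans (ler_normD _ _) _.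
have l2 : harm R (2 * n) <= l by rewrite harm_le// leq_mul2r orbT.
set Q := n%:R ^+ 3 * r * l ^+ 3.
have g1 (c e : R) : 0 <= c -> 0 <= e ->
    (n %/ H).+1%:R * (c * n%:R ^+ 3 + e * n%:R ^+ 2 * H%:R ^+ 2) * l ^+ 3 <=
    2 * (c + 4 * e) * Q.
  move=> c0 e0; have HH : H%:R ^+ 2 <= 4 * n%:R :> R.
    by rewrite -r2 (_ : 4 * r ^+ 2 = (2 * r) ^+ 2); [rewrite ler_pXn2r ?nnegrE ?mulr_ge0|ring].
  have a1 : e * n%:R ^+ 2 * H%:R ^+ 2 <= e * n%:R ^+ 2 * (4 * n%:R) :> R.
    by rewrite ler_wpM2l// mulr_ge0 ?exprn_ge0.
  rewrite [leRHS](_ : _ = (2 * r) * ((c + 4 * e) * n%:R ^+ 3) * l ^+ 3); last by rewrite /Q; ring.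
  rewrite ler_wpM2r ?exprn_ge0 ?harm_ge0//; apply: ler_pM => //.
    by rewrite addr_ge0 ?mulr_ge0 ?exprn_ge0.
  lra.
have g2 (c : R) : 0 <= c -> c * n%:R ^+ 3 * harm R (2 * n) ^+ 2 <= c * Q.
  move=> c0; rewrite /Q -mulrA ler_wpM2l// -mulrA ler_wpM2l ?exprn_ge0//.
  apply: le_trans (_ : l ^+ 3 <= _); last by rewrite ler_peMl ?exprn_ge0 ?harm_ge0.
  apply: le_trans (_ : l ^+ 2 <= _); last by rewrite ler_weXn2l.
  by rewrite ler_pXn2r ?nnegrE ?harm_ge0.
(* The total constant is [2 * (6144 + 4 * 592) + 504 = 17528]. *)
move: (le_trans h1 (g1 _ _ (ler0n _ _) (ler0n _ _))) (le_trans h2 (g2 _ (ler0n _ _))); clear.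
by move: `|S| `|M - Z| Q => a b Q; lra.
Qed.

(** Two replacements are made: [X (X + 1)] by [x^2], at a cost of [2 x], and the truncated series by
    its limit, at a cost of [5 l / n] times [x^2 <= n^4]. *)
Lemma main_term_error (R : realType) (x : R) (n : nat) : 1 <= x -> x <= n%:R ^+ 2 ->
  `|2 * ((Num.truncn x)%:R * ((Num.truncn x)%:R + 1)) * ln 2 ^+ 2 * sigma_part R (2 * n) -
    c0 R * x ^+ 2| <=
  (4 * (13 * zeta R 2 / (14 * zeta R 3)) + 30) * (n%:R ^+ 3 * harm R (4 * n)).
Proof.
move=> x1 xn; set X := Num.truncn x; set S := 13 * _ / _; set l := harm _ _; set sg := sigma_part _ _.
have n0 : (0 < n)%N.
  by rewrite lt0n; apply/eqP => n0; move: xn; rewrite n0 expr0n/=; lra.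
have n1 : 1 <= n%:R :> R by rewrite ler1n.
have l1 : 1 <= l by apply: harm_ge1; lia.
have X1 : X%:R <= x by rewrite -truncn_ge_nat//; lra.
have X2 : x < X%:R + 1 by rewrite natr1 -truncn_lt_nat//; lra.
have X0 := ler0n R X.
have /andP[L0 L1] := ln2_le1 R.
have z2 := @zeta_ge1 R 2 isT; have z3 := @zeta_ge1 R 3 isT.
have S0 : 0 <= S by rewrite divr_ge0// mulr_ge0//; lra.
have cE : c0 R = S * (2 * ln 2 ^+ 2) by rewrite /c0 frakSE.
have sgl := sigma_part_limit R n0; rewrite -/sg -/S in sgl.
have ln4 : harm R n <= l by rewrite harm_le// leq_pmull.
have e1 : `|sg - S| <= 5 * l / n%:R.
  by apply: le_trans sgl _; rewrite ler_wpM2r ?invr_ge0// ler_wpM2l.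
have l20 : 0 <= ln 2 ^+ 2 :> R by exact: sqr_ge0.
have l21 : ln 2 ^+ 2 <= 1 :> R by rewrite exprn_ile1.
rewrite cE (_ : _ - _ = 2 * ln 2 ^+ 2 * ((X%:R * (X%:R + 1) - x ^+ 2) * sg + x ^+ 2 * (sg - S))); last ring.
rewrite normrM ger0_norm ?mulr_ge0//.
have sgb : `|sg| <= S + 5 * l.
  rewrite (_ : sg = S + (sg - S)); last by ring.
  apply: le_trans (ler_normD _ _) _; rewrite ger0_norm// lerD2l.
  apply: le_trans e1 _; rewrite ler_pdivrMr ?ltr0n// ler_peMr//; lra.
have Xx : `|X%:R * (X%:R + 1) - x ^+ 2| <= 2 * x by rewrite ler_norml; apply/andP; split; nra.
have t1 : `|(X%:R * (X%:R + 1) - x ^+ 2) * sg| <= 2 * n%:R ^+ 2 * (S + 5 * l).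
  rewrite normrM; apply: ler_pM => //; lra.
have t2 : `|x ^+ 2 * (sg - S)| <= 5 * n%:R ^+ 3 * l.
  rewrite normrM ger0_norm ?sqr_ge0//.
  apply: le_trans (_ : n%:R ^+ 4 * (5 * l / n%:R) <= _).
    apply: ler_pM => //; rewrite ?sqr_ge0// (_ : n%:R ^+ 4 = (n%:R ^+ 2) ^+ 2); last ring.
    by rewrite ler_pXn2r ?nnegrE ?exprn_ge0//; lra.
  rewrite le_eqVlt; apply/orP; left; apply/eqP; field.
  by rewrite pnatr_eq0 -lt0n.
apply: le_trans (_ : 2 * 1 * (2 * n%:R ^+ 2 * (S + 5 * l) + 5 * n%:R ^+ 3 * l) <= _).
  apply: ler_pM; rewrite ?mulr_ge0//; first by rewrite ler_wpM2l.
  by apply: le_trans (ler_normD _ _) _; exact: lerD.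
have n23 : n%:R ^+ 2 <= n%:R ^+ 3 :> R by rewrite ler_weXn2l.
have n30 : 0 <= n%:R ^+ 2 :> R by rewrite sqr_ge0.
have Sl : S <= S * l by rewrite ler_peMr.
have : n%:R ^+ 2 * (S + 5 * l) <= n%:R ^+ 3 * (S * l + 5 * l).
  apply: ler_pM => //; first by rewrite addr_ge0// mulr_ge0//; lra.
  by rewrite lerD2r.
lra.
Qed.

Lemma sqrtr_le (R : realType) (a b : R) : 0 <= b -> a <= b ^+ 2 -> Num.sqrt a <= b.
Proof. by move=> b0 ab; rewrite -[leRHS]ger0_norm// -sqrtr_sqr ler_wsqrtr. Qed.

Lemma final_combine (R : realType) (S T Q K Z P : R) : 0 <= S ->
  Q <= T -> T <= K * Z -> Z <= P -> 0 <= K ->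
  17528 * T + (4 * S + 30) * Q <= (17558 + 4 * S) * K * P.
Proof.
move=> S0 QT TZ ZP K0.
have S30 : 0 <= 4 * S + 30 by lra.
have S1 : 0 <= 17558 + 4 * S by lra.
have h1 := ler_wpM2l S30 QT.
have h2 := ler_wpM2l S1 (le_trans TZ (ler_wpM2l K0 ZP)).
rewrite mulrA in h2; move: h1 h2; clear.
by move: (_ * K * P) => V; lra.
Qed.

Unset Implicit Arguments.

Theorem mainTheorem1 (R : realType) (eps : R) :
  0 < eps -> eps < 54^-1 ->
  exists C : R, exists X0 : R, 1 < X0 /\
    forall x : R, X0 < x ->
      `| (W x)%:R - c0 R * x ^+ 2 | <= C * x `^ (2 - 54^-1 + eps).
Proof.
move=> eps0 _; set S := 13 * zeta R 2 / (14 * zeta R 3).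
have z2 := @zeta_ge1 R 2 isT; have z3 := @zeta_ge1 R 3 isT.
have S0 : 0 <= S by rewrite divr_ge0// mulr_ge0//; lra.
(* [17558 = 17528 + 30] adds the constants of the two error terms; the second factor comes from
   [n <= 2 z^20], [sqrt n <= 2 z^10] and [l <= 28 z]. *)
exists ((17558 + 4 * S) * (8 * 2 * 28 ^+ 3)), 2; split; first by lra.
move=> x x2; have x1 : 1 <= x by lra.
have x0 : 0 <= x by lra.
(* All error terms become integral powers of z = x^(1/40). *)
pose z := x `^ 40^-1.
have z1 : 1 <= z.
  by rewrite /z -[leLHS](powRr0 x); apply: ler_powR => //; rewrite invr_ge0.
have zE k : z ^+ k = x `^ (k%:R / 40).
  by rewrite -powR_mulrn ?powR_ge0// -powRrM mulrC.
have xz : x = z ^+ 40 by rewrite zE divff ?powRr1.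
have sx : Num.sqrt x = z ^+ 20.
  by rewrite xz (_ : z ^+ 40 = (z ^+ 20) ^+ 2) ?sqrtr_sqr ?ger0_norm ?exprn_ge0//; [lra|ring].
pose n := (Num.truncn (z ^+ 20)).+1.
have z20 : 1 <= z ^+ 20 by rewrite exprn_ege1.
have nz : z ^+ 20 < n%:R by rewrite -truncn_lt_nat//; lra.
have zn : n%:R <= 2 * z ^+ 20.
  have : (Num.truncn (z ^+ 20))%:R <= z ^+ 20 by rewrite -truncn_ge_nat//; lra.
  by rewrite /n -natr1; lra.
have xn : x <= n%:R ^+ 2.
  rewrite xz (_ : z ^+ 40 = (z ^+ 20) ^+ 2); last ring.
  by rewrite ler_pXn2r ?nnegrE//; lra.
have Xn : (Num.truncn x < n ^ 2)%N.
  rewrite truncn_lt_nat// natrX xz (_ : z ^+ 40 = (z ^+ 20) ^+ 2); last ring.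
  by rewrite ltr_pXn2r ?nnegrE//; lra.
have n0 : (0 < n)%N by [].
pose l := harm R (4 * n); pose r : R := Num.sqrt n%:R.
have l1 : 1 <= l by apply: harm_ge1.
have n1 : 1 <= n%:R :> R by rewrite ler1n.
have r1 : 1 <= r by rewrite -sqrtr1 ler_sqrt.
have rz : r <= 2 * z ^+ 10.
  apply: sqrtr_le; first by rewrite mulr_ge0// exprn_ge0// (le_trans ler01).
  apply: le_trans zn _; rewrite exprMn -exprM ler_wpM2r//; first by apply: le_trans z20.
  by rewrite expr2 ler_peMr// ler1n.
(* One power of [z] absorbs a logarithm: [1 + ln(8 z^20) <= 1 + 7 + 20 (z - 1)]. *)
have lz : l <= 28 * z.
  apply: le_trans (harm_le_ln R _) _ => //.
  have lnz : ln z <= z - 1.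
    by have := @le_ln1Dx R (z - 1); rewrite (_ : 1 + (z - 1) = z); [apply; lra|ring].
  have ln8 : ln 8 <= 7 :> R.
    by have := @le_ln1Dx R 7; rewrite (_ : 1 + 7 = 8); [apply; lra|lra].
  have : ln (4 * n)%:R <= ln (8 * z ^+ 20).
    rewrite ler_ln ?posrE ?ltr0n ?muln_gt0//; last by lra.
    by rewrite natrM; lra.
  rewrite lnM ?posrE//; last by lra.
  have -> : ln (z ^+ 20) = 20 * ln z by rewrite lnXn ?mulr_natl// (lt_le_trans ltr01).
  lra.
have main : n%:R ^+ 3 * r * l ^+ 3 <= 8 * 2 * 28 ^+ 3 * z ^+ 73.
  rewrite (_ : _ * z ^+ 73 = (2 * z ^+ 20) ^+ 3 * (2 * z ^+ 10) * (28 * z) ^+ 3); last ring.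
  apply: ler_pM; rewrite ?mulr_ge0 ?exprn_ge0//; try lra.
    by apply: ler_pM; rewrite ?exprn_ge0//; try lra; rewrite ler_pXn2r ?nnegrE//; lra.
  by rewrite ler_pXn2r ?nnegrE//; lra.
have nl : n%:R ^+ 3 * l <= n%:R ^+ 3 * r * l ^+ 3.
  rewrite -mulrA ler_wpM2l ?exprn_ge0//; apply: le_trans (_ : l ^+ 3 <= _).
    by rewrite -[leLHS]expr1 ler_weXn2l.
  by rewrite ler_peMl ?exprn_ge0//; lra.
(* The exponent is [73 = 3 * 20 + 10 + 3], and [73 / 40] is below [2 - 1/54]. *)
have zx : z ^+ 73 <= x `^ (2 - 54^-1 + eps).
  by rewrite zE; apply: ler_powR => //; lra.
have h1 := count_error R n0 Xn; rewrite -(WE x0 Xn) -/l -/r in h1.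
have h2 := main_term_error x1 xn; rewrite -/S -/l in h2.
set U := _ * ln 2 ^+ 2 * _ in h1 h2.
rewrite (_ : _ - _ = ((W x)%:R - U) + (U - c0 R * x ^+ 2)); last ring.
apply: le_trans (ler_normD _ _) _; apply: le_trans (lerD h1 h2) _.
by apply: final_combine S0 nl main zx _; rewrite mulr_ge0 ?exprn_ge0.
Qed.
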